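(* Let $N=2$, $\Omega\subset\mathbb{R}^2$ a bounded domain, $F$ as in the context, and $E(u)=\frac12\int_\Omega F^2(\nabla u)\,dx-\lambda\int_\Omega e^u\,dx$ on $W_0^{1,2}(\Omega)$. There exists a constant $\lambda_0>0$ such that for every $\lambda\in(0,\lambda_0)$ the functional $E$ has a critical point with critical value $c'<-\lambda|\Omega|$.
   Context: Standing assumptions on $F$: $F:\mathbb{R}^N\to[0,\infty)$ is convex, $F\in C^2(\mathbb{R}^N\setminus\{0\})$, $F(t\xi)=|t|F(\xi)$, $F(\xi)>0$ for $\xi\neq0$; $a|\xi|\le F(\xi)\le b|\xi|$ for constants $0<a\le b$; and $\mu^2|V|^2\le\sum_{i,j}F_{\xi_i\xi_j}(\xi)V_iV_j\le\Lambda|V|^2$ for all unit $\xi$ and all $V\perp\xi$. *)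

(* Defs.v *)
From mathcomp Require Import all_boot all_order all_algebra.
From mathcomp Require Import all_classical all_reals all_analysis.
Set Implicit Arguments. Unset Strict Implicit. Unset Printing Implicit Defensive.
Import Order.TTheory GRing.Theory Num.Theory numFieldNormedType.Exports.
Local Open Scope classical_set_scope.
Local Open Scope ring_scope.

Definition leb2 (R : realType) :=
  ((@lebesgue_measure R) \x (@lebesgue_measure R))%E.

Definition dir (R : realType) (b : bool) : R * R := if b then (1, 0) else (0, 1).

Fixpoint pderiv (R : realType) (l : seq bool) (f : R * R -> R) : R * R -> R :=
  match l with
  | [::] => f
  | b :: l' => fun x => 'D_(dir R b) (pderiv l' f) x
  end.

Definition dot2 (R : realType) (x y : R * R) : R := x.1 * y.1 + x.2 * y.2.
Definition enorm2 (R : realType) (x : R * R) : R := Num.sqrt (dot2 x x).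

Definition smooth2 (R : realType) (f : R * R -> R) : Prop :=
  forall l : seq bool,
    continuous (pderiv l f) /\
    forall (b : bool) (x : R * R), derivable (pderiv l f) x (dir R b).

Definition C2_on (R : realType) (U : set (R * R)) (f : R * R -> R) : Prop :=
  forall l : seq bool, (size l <= 2)%N ->
    forall x, U x ->
      {for x, continuous (pderiv l f)} /\
      ((size l <= 1)%N -> forall b : bool, derivable (pderiv l f) x (dir R b)).

Definition test_fun (R : realType) (Om : set (R * R)) (phi : R * R -> R) : Prop :=
  smooth2 phi /\
  exists K : set (R * R), compact K /\ K `<=` Om /\ forall x, ~ K x -> phi x = 0.

Definition grad2 (R : realType) (f : R * R -> R) (x : R * R) : R * R :=
  (pderiv [:: true] f x, pderiv [:: false] f x).

(* W_0^{1,2}(Om): u belongs to W_0^{1,2}(Om) with (weak) gradient G, i.e. u is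
   the limit in the W^{1,2}(Om) norm of a sequence of C_c^infty(Om) functions,
   whose gradients converge in L^2(Om) to G. *)
Definition W012 (R : realType) (Om : set (R * R))
    (u : R * R -> R) (G : R * R -> R * R) : Prop :=
  measurable_fun Om u /\ measurable_fun Om (fun x => (G x).1) /\
  measurable_fun Om (fun x => (G x).2) /\
  exists phi : nat -> R * R -> R,
    (forall n, test_fun Om (phi n)) /\
    ((fun n : nat => (\int[@leb2 R]_(x in Om) ((phi n x - u x) ^+ 2)%:E)%E)
        @ \oo --> 0%E) /\
    ((fun n : nat => (\int[@leb2 R]_(x in Om)
                 (((grad2 (phi n) x).1 - (G x).1) ^+ 2
                  + ((grad2 (phi n) x).2 - (G x).2) ^+ 2)%:E)%E)
        @ \oo --> 0%E).

Definition energy (R : realType) (F : R * R -> R) (lam : R) (Om : set (R * R))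
    (u : R * R -> R) (G : R * R -> R * R) : R :=
  2^-1 * Rintegral (@leb2 R) Om (fun x => F (G x) ^+ 2)
  - lam * Rintegral (@leb2 R) Om (fun x => expR (u x)).

Definition critical_point (R : realType) (F : R * R -> R) (lam : R)
    (Om : set (R * R)) (u : R * R -> R) (G : R * R -> R * R) : Prop :=
  forall (phi : R * R -> R) (Gphi : R * R -> R * R), W012 Om phi Gphi ->
    let e := fun t : R =>
      energy F lam Om (fun x => u x + t * phi x) (fun x => G x + t *: Gphi x) in
    derivable e 0 1 /\ 'D_1 e 0 = 0.

Definition hess_form (R : realType) (F : R * R -> R) (xi V : R * R) : R :=
  pderiv [:: true; true] F xi * V.1 * V.1
  + pderiv [:: true; false] F xi * V.1 * V.2
  + pderiv [:: false; true] F xi * V.2 * V.1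
  + pderiv [:: false; false] F xi * V.2 * V.2.

(* Main.v *)
Require Import Defs.
From mathcomp Require Import all_boot all_order all_algebra.
From mathcomp Require Import all_classical all_reals all_analysis.
From mathcomp Require Import measurable_realfun.
From mathcomp Require Import ring lra.
Import Order.TTheory GRing.Theory Num.Theory numFieldNormedType.Exports.
Set Implicit Arguments. Unset Strict Implicit. Unset Printing Implicit Defensive.
Local Open Scope classical_set_scope.
Local Open Scope ring_scope.

(** The critical point is the minimizer of the energy [E] over the test functions
    of the ball [int |grad phi|^2 <= 1/4] and their limits.

    Applying the inequality [|v|_2^2 <= |d1 v|_1 |d2 v|_1] to [v = g o phi] gives
    [int g(phi)^2 <= int g'(phi)^2 * int |grad phi|^2]; with [g = exp - 1] this
    bounds [int exp (2 phi)] on the ball, which is all of Moser-Trudinger that is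
    needed. Ellipticity and homogeneity give
    [c |V|^2 <= F^2(x + V) + F^2(x - V) - 2 F^2(x) <= C |V|^2]. The lower bound
    makes [E] uniformly convex on the ball for small [lam], so minimizing
    sequences are Cauchy in [W_0^{1,2}] and no weak compactness is used; for small
    [lam] the minimizer lies inside the ball. Along a line [u + t phi], the upper
    bound, convexity of [exp] and minimality in [t] and [- t] yield
    [0 <= E(u + t phi) - E(u) <= K t^2], hence a zero derivative. A positive bump
    function shows that the minimum is below [E(0) = - lam |Om|]. *)

(** The radius [1/4] comes from an absorption. With [X = int exp (2 phi)] and
    [D = int |grad phi|^2], the inequality for [g = exp - 1] reads [X / 2 - |Om| <= X D]; at
    [D <= 1/4] it gives [X <= 4 |Om|], while at [D >= 1/2] it gives no bound on [X]. Control of the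
    exponential is thus confined to the ball, and the real-valued integral of a non-integrable
    exponential is the default value [0]. So each competitor [u + t phi] must be exhibited as a
    limit of test functions that eventually lie in the ball. This is why the minimizer is brought
    down to [int |grad u|^2 <= 1/32]: splitting the gradient of an approximant of [u + t phi] into
    four terms costs a factor [4], and [4/32 + 4/128 + 4/64 + 4/128 = 1/4]. [F^2] may fail to be
    twice differentiable at the origin, and gradients may vanish on large sets. Hence ellipticity
    enters the energy only through second differences of [F^2], which make sense at every point; one
    two-sided estimate serves both the convexity of the ball problem and the derivative at the
    minimizer. *)

(** * Elementary inequalities between real numbers *)

Section Arithmetic.
Variable R : realFieldType.
Implicit Types x y z p q r s t u w X : R.

Lemma young_bound (P Q u w : R) :
  0 <= u -> 0 <= w -> P ^+ 2 <= u -> Q ^+ 2 <= w -> P * Q <= u + w.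
Proof. by move=> ? ? ? ?; have := sqr_ge0 (P - Q); nra. Qed.

Lemma sqr_sub1_ge (x : R) : 2^-1 * x ^+ 2 - 1 <= (x - 1) ^+ 2.
Proof. by have := sqr_ge0 (x - 2); nra. Qed.

Lemma exp_bound_arith (X m e S : R) : 0 <= X -> e <= 4^-1 ->
  S <= X * e -> 2^-1 * X - 1 * m <= S -> X <= 4 * m.
Proof. by move=> ? ? ? ?; nra. Qed.

Lemma sqrD_le x y : (x + y) ^+ 2 <= 2 * x ^+ 2 + 2 * y ^+ 2.
Proof. by have := sqr_ge0 (x - y); lra. Qed.

Lemma sqr_mid_le p q r s : (2^-1 * (p + r)) ^+ 2 + (2^-1 * (q + s)) ^+ 2 <=
  2^-1 * (p ^+ 2 + q ^+ 2 + (r ^+ 2 + s ^+ 2)).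
Proof. by have := sqr_ge0 (p - r); have := sqr_ge0 (q - s); lra. Qed.

Lemma sum16_le x y m : x <= 4 * m -> y <= 4 * m -> 2 * x + 2 * y <= 16 * m.
Proof. by lra. Qed.

Lemma strong_convexity_arith (lam A B A' B' P Q D m c : R) :
  lam * (A + B - 2 * A') <= lam * (8 * m * D) -> c * D <= P + Q - 2 * B' ->
  (c / 2 - lam * (8 * m)) * D <=
  2^-1 * P - lam * A + (2^-1 * Q - lam * B) - 2 * (2^-1 * B' - lam * A').
Proof. by lra. Qed.

Lemma half_addK (v w : R * R) : 2^-1 *: (v + w + (v - w)) = v.
Proof. by apply: injective_projections; rewrite /= /GRing.scale/=; field. Qed.

Lemma half_subK (v w : R * R) : 2^-1 *: (v + w - (v - w)) = w.
Proof. by apply: injective_projections; rewrite /= /GRing.scale/=; field. Qed.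

Lemma en_lb_arith (lam A P m : R) : 0 <= lam -> 0 <= P -> A <= 5 * m ->
  - (lam * (5 * m)) <= 2^-1 * P - lam * A.
Proof.
move=> l0 P0 Am; have := ler_wpM2l l0 Am; lra.
Qed.

(** Two values within [c e / 8] of the infimum [m], with a midpoint value at least [m], leave a
    convexity defect of at most [c e / 4]. *)
Lemma cauchy_arith (c k D E1 E2 E3 m e : R) : 0 < c -> c / 4 <= k -> 0 <= D ->
  k * D <= E1 + E2 - 2 * E3 -> m <= E3 -> E1 < m + c / 8 * e ->
  E2 < m + c / 8 * e -> D <= e.
Proof.
move=> c0 ck D0 h1 h2 h3 h4; have := ler_wpM2r D0 ck => h5.
have h6 : c / 4 * D <= c / 4 * e by lra.
by rewrite ler_pM2l// in h6; lra.
Qed.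

Lemma kappa_arith x y : x <= y / 4 -> y / 4 <= y / 2 - x.
Proof. by lra. Qed.

Lemma dist_eq0 x y : (forall e : R, 0 < e -> `|x - y| <= e) -> x = y.
Proof.
move=> H; apply/eqP; rewrite -subr_eq0 -normr_le0; apply/ler_addgt0Pr => e e0.
by rewrite add0r; exact: H.
Qed.

(** A nonpositive energy forces [P <= 2 lam A <= 10 lam m]. *)
Lemma small_norm_arith (a lam m P D A E : R) : 0 < a -> 0 <= lam -> 0 <= m ->
  10 * (lam * m) <= a ^+ 2 / 32 -> a ^+ 2 * D <= P -> A <= 5 * m ->
  E = 2^-1 * P - lam * A -> E <= 0 -> D <= 32^-1.
Proof.
move=> a0 l0 m0 h1 h2 h3 h4 h5; have := ler_wpM2l l0 h3 => h6.
have a2 : 0 < a ^+ 2 by rewrite exprn_gt0.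
by rewrite -(ler_pM2l a2); lra.
Qed.

(** Here [q] and [s] stand for components of limit gradients, [p] and [r] for those of their
    approximations; [(x + y)^2 <= 2 x^2 + 2 y^2] is applied at two levels. *)
Lemma sqr4_le p q r s t : (p + t * r) ^+ 2 <=
  4 * q ^+ 2 + 4 * (p - q) ^+ 2 + (4 * t ^+ 2 * s ^+ 2 + 4 * t ^+ 2 * (r - s) ^+ 2).
Proof.
have h1 := sqrD_le p (t * r); have h2 := sqrD_le q (p - q).
have h3 := sqrD_le (t * s) (t * (r - s)).
rewrite (_ : q + (p - q) = p) in h2; last by ring.
rewrite (_ : t * s + _ = t * r) in h3; last by ring.
by lra.
Qed.

(** Both [|t|] and [|t| X] are below [1/8], whence the product [1/64]. *)
Lemma small_t t X : 0 <= X -> `|t| < (8 * (X + 1))^-1 ->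
  t ^+ 2 <= 1 /\ t ^+ 2 * X <= 64^-1.
Proof.
move=> X0 ht; have X1 : 0 < 8 * (X + 1) by lra.
have ht' : `|t| * (8 * (X + 1)) < 1 by rewrite -ltr_pdivlMr// div1r.
rewrite -[t ^+ 2]ger0_norm ?sqr_ge0// normrX.
have := normr_ge0 t; move: `|t| ht' => s hs s0.
have hs1 : 8 * s <= 1 by nra.
have hs2 : 8 * (s * X) <= 1 by nra.
have sX : 0 <= s * X by rewrite mulr_ge0.
split; first by nra.
rewrite expr2 -mulrA; nra.
Qed.

(** The four summands are at most [1/8], [1/32], [1/16] and [1/32]. *)
Lemma ball_arith (A B E D t2 : R) : 0 <= t2 -> t2 <= 1 -> A <= 32^-1 ->
  B <= 128^-1 -> t2 * D <= 64^-1 -> E <= 128^-1 ->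
  4 * A + 4 * B + (4 * t2 * D + 4 * t2 * E) <= 4^-1.
Proof.
move=> t0 t1 hA hB hD hE; have := ler_wpM2l t0 hE => h.
have : t2 * 128^-1 <= 128^-1 by rewrite ler_piMl.
by lra.
Qed.

(** Since [E0 <= E'], the difference [E - E0] is at most [E + E' - 2 E0], where the exponential
    terms contribute with a favourable sign. *)
Lemma second_diff_arith (lam P P' Q A A' B E E' E0 K : R) : 0 <= lam ->
  E = 2^-1 * P - lam * A -> E' = 2^-1 * P' - lam * A' -> E0 = 2^-1 * Q - lam * B ->
  P + P' - 2 * Q <= K -> 2 * B <= A + A' -> E0 <= E' -> E - E0 <= 2^-1 * K.
Proof.
by move=> l0 h1 h2 h3 h4 h5 h6; have := ler_wpM2l l0 h5; lra.
Qed.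

(** The cost of a multiple [s phi] is quadratic in [s], its gain [lam s I0] linear; the condition on
    [s] makes the gain win. *)
Lemma bump_arith (lam b2 D0 I0 m s P A : R) : 0 < lam -> 0 <= b2 -> 0 <= D0 ->
  0 < s -> s * (b2 * D0 + 1) <= lam * I0 -> P <= b2 * (s ^+ 2 * D0) ->
  m + s * I0 <= A -> 2^-1 * P - lam * A < - (lam * m).
Proof.
move=> l0 b0 d0 s0 h1 h2 h3; have h4 := ler_wpM2l (ltW l0) h3.
have h5 := ler_wpM2l (ltW s0) h1.
have s2 : 0 < s ^+ 2 by rewrite exprn_gt0.
have : 0 <= s ^+ 2 * (b2 * D0) by rewrite !mulr_ge0// ltW.
by lra.
Qed.

Lemma scale_ball_arith (s D0 : R) : 0 <= D0 -> 0 < s -> s * (2 * (D0 + 1)) <= 1 ->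
  s ^+ 2 * D0 <= 4^-1.
Proof.
move=> d0 s0 h; have h1 : 2 * s <= 1 by nra.
have h2 : 2 * (s * D0) <= 1 by nra.
have : 0 <= s * D0 by rewrite mulr_ge0// ltW.
by rewrite expr2 -mulrA; nra.
Qed.

(** Expand [(y + z)^2] and use [2 y z <= t y^2 + z^2 / t]. *)
Lemma sqr_sub_young x y z t : 0 < t -> 0 <= x -> 0 <= y -> 0 <= z ->
  x <= y + z -> x ^+ 2 <= y ^+ 2 + (t * y ^+ 2 + (1 + t^-1) * z ^+ 2).
Proof.
move=> t0 x0 y0 z0 xyz; apply: (@le_trans _ _ ((y + z) ^+ 2)).
  by rewrite lerXn2r// nnegrE addr_ge0.
rewrite -subr_ge0 (_ : _ - _ = t^-1 * (t * y - z) ^+ 2).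
  by rewrite mulr_ge0 ?sqr_ge0// invr_ge0 ltW.
by field; rewrite gt_eqF.
Qed.

End Arithmetic.

(* Both the measure structure of [leb2] and the domain on which it lives are
   those of [lebesgue_measure], which inference does not recover from sets of
   [R * R]; these two definitions pin them down. *)
Definition lebesgue2 (R : realType) :=
  [the measure _ _ of (@lebesgue_measure R \x @lebesgue_measure R)%E].

Definition measurable_for d (T : measurableType d) (R : realType)
  (mu : {measure set T -> \bar R}) (A : set T) := measurable A.

(** * Measurability and bounded sets in the plane *)

Section Plane.
Variable R : realType.

(** Measurability refers to the product sigma-algebra; an open set is a countable union of open
    rectangles with rational endpoints. *)
Lemma open2_measurable (A : set (R * R)) : open A -> measurable A.
Proof.
move=> oA.
pose rect (q : rat * rat * (rat * rat)) : set (R * R) :=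
  `]ratr q.1.1, ratr q.1.2[%classic `*` `]ratr q.2.1, ratr q.2.2[%classic.
have -> : A = \bigcup_(q in [set q | rect q `<=` A]) rect q.
  apply/seteqP; split=> [x Ax|x [q /= qA]]; last exact: qA.
  have [e /= e0 eA] : exists2 e : R, 0 < e & ball x e `<=` A.
    by move: oA; rewrite openE => /(_ _ Ax)/nbhs_ballP[e e0 eA]; exists e.
  have itv (y : R) : exists q : rat * rat,
      [/\ y - e < ratr q.1, ratr q.1 < y, y < ratr q.2 & ratr q.2 < y + e].
    have /rat_in_itvoo[q1] : y - e < y by rewrite ltrBlDr ltrDl.
    have /rat_in_itvoo[q2] : y < y + e by rewrite ltrDl.
    by rewrite !in_itv/= => /andP[? ?] /andP[? ?]; exists (q1, q2).
  have [q1 [a1 a2 a3 a4]] := itv x.1; have [q2 [b1 b2 b3 b4]] := itv x.2.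
  exists (q1, q2); last by rewrite /rect/=; split; rewrite /= in_itv/=; apply/andP.
  move=> y [/=]; rewrite !in_itv/= => /andP[? ?] /andP[? ?]; apply: eA.
  split; rewrite /ball/= ltr_norml; lra.
rewrite bigcup_mkcond; apply: countable_bigcupT_measurable => // q.
by case: ifPn => // _; apply: measurableX; exact: measurable_itv.
Qed.

Lemma continuous2_measurable (f : R * R -> R) :
  continuous f -> measurable_fun setT f.
Proof.
move=> /continuousP cf; apply: (measurability _ (measurable_realfun.RGenOpens.measurableE R)).
move=> _ [_ [a [b ->] <-]]; rewrite setTI; apply: open2_measurable.
exact/cf/interval_open.
Qed.

Lemma measurable_fun_comp2 d (T : measurableType d) (D : set T) (f : R * R -> R)
    (g1 g2 : T -> R) : measurable D -> continuous f -> measurable_fun D g1 ->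
  measurable_fun D g2 -> measurable_fun D (fun x => f (g1 x, g2 x)).
Proof.
move=> mD cf mg1 mg2.
apply: (eq_measurable_fun (fun x => f ((g1 \_ D) x, (g2 \_ D) x))).
  by move=> x xD; rewrite /patch xD.
apply: (measurable_funS measurableT) => //.
apply: measurableT_comp; first exact: continuous2_measurable.
by apply: measurable_fun_pair; apply/(measurable_restrictT _ _).1.
Qed.

Lemma leb2_bounded_lty (A : set (R * R)) : measurable A -> bounded_set A ->
  (@leb2 R A < +oo)%E.
Proof.
move=> mA [M [_ /(_ (`|M| + 1))]] h.
have {}h x : A x -> `|x| <= `|M| + 1.
  by apply: h; rewrite (le_lt_trans (ler_norm _))// ltrDl.
set B := `|M| + 1 in h.
pose S := `[- B, B]%classic `*` `[- B, B]%classic : set (R * R).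
have mS : measurable S by apply: measurableX; exact: measurable_itv.
have AS : A `<=` S.
  move=> [x y] /h; rewrite prod_normE/= ge_max !ler_norml => /andP[xB yB].
  by rewrite /S; split; rewrite /= in_itv.
apply: (@le_lt_trans _ _ (@leb2 R S)); first by apply: le_measure; rewrite ?inE.
have [l ml] : exists l : R, lebesgue_measure (`[- B, B]%classic : set R) = l%:E.
  rewrite lebesgue_measure_itv/=; case: (_ < _)%E; last by exists 0.
  by exists (B - - B); rewrite EFinB.
have -> : @leb2 R S = (l%:E * l%:E)%E.
  by rewrite -ml; apply: product_measure1E; exact: measurable_itv.
by rewrite -EFinM ltry.
Qed.

End Plane.

(** * Square integrable functions *)

Section SquareIntegrable.
Context d (T : measurableType d) (R : realType)
  (mu : {measure set T -> \bar R}) (D : set T).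
Hypothesis mD : measurable D.
Implicit Types (f g h : T -> R) (r s : R).

Local Notation I f := (\int[mu]_(x in D) f x).
Local Notation L1 f := (mu.-integrable D (EFin \o f)).

Definition L2 f := measurable_fun D f /\ L1 (fun x => f x ^+ 2).

Lemma L1_measurable f : L1 f -> measurable_fun D f.
Proof. by move=> /integrableP[/measurable_EFinP]. Qed.

Lemma L1_le f g : measurable_fun D f -> L1 g ->
  (forall x, D x -> `|f x| <= g x) -> L1 f.
Proof.
move=> mf ig fg; apply: le_integrable ig => //; first exact/measurable_EFinP.
by move=> x Dx/=; rewrite lee_fin (le_trans (fg _ Dx))// ler_norm.
Qed.

Lemma L1_eq f g : (forall x, D x -> f x = g x) -> L1 f -> L1 g.
Proof.
move=> fg; apply: eq_integrable => // x; rewrite inE => Dx /=.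
by rewrite fg.
Qed.

Lemma I_eq f g : (forall x, D x -> f x = g x) -> I f = I g.
Proof. by move=> fg; apply: eq_Rintegral => x /set_mem; exact: fg. Qed.

Lemma L1_add f g : L1 f -> L1 g -> L1 (fun x => f x + g x).
Proof. by move=> f1 g1; exact: (integrableD mD f1 g1). Qed.

Lemma L1_scale r f : L1 f -> L1 (fun x => r * f x).
Proof. by move=> f1; exact: (integrableZl mD r f1). Qed.

Lemma L1_sub f g : L1 f -> L1 g -> L1 (fun x => f x - g x).
Proof. by move=> f1 g1; exact: (integrableB mD f1 g1). Qed.

Lemma L1_norm f : L1 f -> L1 (fun x => `|f x|).
Proof. by move=> f1; exact: (integrable_norm f1). Qed.

Lemma I_le f g : L1 f -> L1 g -> (forall x, D x -> f x <= g x) -> I f <= I g.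
Proof. exact: le_Rintegral. Qed.

Lemma I_fin f : L1 f -> (\int[mu]_(x in D) (f x)%:E)%E = (I f)%:E.
Proof. by move=> fi; rewrite fineK//; apply: integrable_fin_num. Qed.

Lemma L1_lint f r : measurable_fun D f -> (forall x, D x -> 0 <= f x) ->
  (\int[mu]_(x in D) (f x)%:E <= r%:E)%E -> L1 f /\ I f <= r.
Proof.
move=> mf f0 fr.
have fi : L1 f.
  apply/integrableP; split; first exact/measurable_EFinP.
  rewrite (eq_integral (EFin \o f)); first by rewrite (le_lt_trans fr) ?ltry.
  by move=> x /set_mem Dx; rewrite /= ger0_norm ?f0.
by split=> //; rewrite -lee_fin -I_fin.
Qed.

Lemma L2_sqr f : L2 f -> L1 (fun x => f x ^+ 2). Proof. by case. Qed.

Lemma L2_measurable f : L2 f -> measurable_fun D f. Proof. by case. Qed.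

Lemma L2_mul f g : L2 f -> L2 g -> L1 (fun x => f x * g x).
Proof.
move=> [mf f2] [mg g2]; apply: (L1_le (g := fun x => f x ^+ 2 + g x ^+ 2)).
- exact: measurable_funM.
- exact: L1_add.
- by move=> x _; rewrite ler_norml; apply/andP; split; nra.
Qed.

Lemma L2_add f g : L2 f -> L2 g -> L2 (fun x => f x + g x).
Proof.
move=> f2 g2; split; first by apply: measurable_funD; apply: L2_measurable.
apply: (L1_eq (f := fun x => f x ^+ 2 + 2 * (f x * g x) + g x ^+ 2)).
  by move=> x _; ring.
by apply: L1_add; [apply: L1_add; [case: f2|apply/L1_scale/L2_mul]|case: g2].
Qed.

Lemma L2_scale r f : L2 f -> L2 (fun x => r * f x).
Proof.
move=> [mf f2]; split; first exact: measurable_funM.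
apply: (L1_eq (f := fun x => r ^+ 2 * f x ^+ 2)); last exact: L1_scale.
by move=> x _; ring.
Qed.

Lemma L2_eq f g : (forall x, D x -> f x = g x) -> L2 f -> L2 g.
Proof.
move=> fg [mf f2]; split.
  by apply: eq_measurable_fun mf => x /set_mem; exact: fg.
by apply: L1_eq f2 => x Dx; rewrite fg.
Qed.

Lemma L2_sub f g : L2 f -> L2 g -> L2 (fun x => f x - g x).
Proof.
move=> f2 g2; apply: (L2_eq (f := fun x => f x + (-1) * g x)).
  by move=> x _; rewrite mulN1r.
exact/L2_add/L2_scale.
Qed.

Lemma L2_abs f : L2 f -> L2 (fun x => `|f x|).
Proof.
move=> [mf f2]; split; first exact: measurableT_comp.
by apply: L1_eq f2 => x _; rewrite real_normK// num_real.
Qed.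

Lemma I_young f g s : L2 f -> L2 g -> 0 < s ->
  I (fun x => f x * g x) <=
  s / 2 * I (fun x => f x ^+ 2) + s^-1 / 2 * I (fun x => g x ^+ 2).
Proof.
move=> f2 g2 s0; have [_ if2] := f2; have [_ ig2] := g2.
rewrite -!RintegralZl// -RintegralD//; last 2 first.
- exact: L1_scale.
- exact: L1_scale.
apply: I_le; first exact: L2_mul.
  by apply: L1_add; apply: L1_scale.
move=> x _; rewrite -subr_ge0.
rewrite [leRHS](_ : _ = s^-1 / 2 * (s * f x - g x) ^+ 2).
  by rewrite mulr_ge0 ?sqr_ge0// divr_ge0// invr_ge0 ltW.
by field; rewrite gt_eqF.
Qed.

Lemma I_cauchy_schwarz f g : L2 f -> L2 g ->
  I (fun x => f x * g x) ^+ 2 <=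
  I (fun x => f x ^+ 2) * I (fun x => g x ^+ 2).
Proof.
move=> f2 g2; have [_ if2] := f2; have [_ ig2] := g2.
set A := I (fun x => f x ^+ 2); set B := I (fun x => g x ^+ 2).
set C := I (fun x => f x * g x).
have key s : 0 <= s ^+ 2 * A + 2 * s * C + B.
  have iC : L1 (fun x => 2 * s * (f x * g x)) by exact/L1_scale/L2_mul.
  have iA : L1 (fun x => s ^+ 2 * f x ^+ 2) by exact: L1_scale.
  have iAC := L1_add iA iC.
  rewrite /A /B /C -!RintegralZl -?RintegralD//; last exact: L2_mul.
  apply: Rintegral_ge0 => x _.
  rewrite [leRHS](_ : _ = (s * f x + g x) ^+ 2) ?sqr_ge0//; ring.
have A0 : 0 <= A by apply: Rintegral_ge0 => x _; exact: sqr_ge0.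
have [A1|A1] := eqVneq A 0.
  rewrite A1 mul0r; have [->|C0] := eqVneq C 0; first by rewrite expr0n.
  (* For [A = 0] the quadratic is affine in [s]; at this [s] it would equal [-1]. *)
  have := key (- (B + 1) / (2 * C)); rewrite A1 mulr0 add0r.
  by rewrite (_ : 2 * _ * C + B = -1) ?ler0N1//; field.
(* The minimum point of the quadratic. *)
have := key (- C / A).
rewrite (_ : _ + B = B - C ^+ 2 / A); last by field.
by rewrite subr_ge0 ler_pdivrMr ?lt_neqAle ?A0 1?eq_sym ?A1// mulrC.
Qed.

Section FiniteMeasure.
Hypothesis Dfin : (mu D < +oo)%E.
Local Notation M := (fine (mu D)).

Lemma L1_cst r : L1 (fun=> r).
Proof.
apply/integrableP; split; first exact: measurable_cst.
by rewrite /= integral_cst// lte_mul_pinfty.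
Qed.

Lemma I_cst r : I (fun=> r) = r * M.
Proof. exact: Rintegral_cst. Qed.

Lemma L2_cst r : L2 (fun=> r).
Proof. by split => //; exact: L1_cst. Qed.

Lemma L1_bdd f r : measurable_fun D f -> (forall x, D x -> `|f x| <= r) -> L1 f.
Proof. by move=> mf fr; apply: (L1_le mf (L1_cst r)). Qed.

Lemma L2_bdd f r : measurable_fun D f -> (forall x, D x -> `|f x| <= r) -> L2 f.
Proof.
move=> mf fr; split=> //; apply: (L1_bdd (r := r ^+ 2)).
  exact: measurable_funX.
move=> x Dx; rewrite normrX lerXn2r// ?nnegrE//; last exact: fr.
by rewrite (le_trans _ (fr _ Dx)).
Qed.

Lemma L2_L1 f : L2 f -> L1 f.
Proof.
move=> f2; have := L2_mul f2 (L2_cst 1).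
by apply: L1_eq => x _; rewrite mulr1.
Qed.

End FiniteMeasure.
End SquareIntegrable.

(** * Completeness of the space of square integrable functions *)

Section RieszFischer.
Context d (T : measurableType d) (R : realType)
  (mu : {measure set T -> \bar R}) (D : set T).
Hypotheses (mD : measurable D) (Dfin : (mu D < +oo)%E).
Local Notation I f := (\int[mu]_(x in D) f x).
Local Notation L1 f := (mu.-integrable D (EFin \o f)).
Local Notation L2 f := (L2 mu D f).

Lemma limn_einf_ub (u : nat -> \bar R) (r : \bar R) (N : nat) :
  (forall n, (N <= n)%N -> (u n <= r)%E) -> (limn_einf u <= r)%E.
Proof.
move=> ur; rewrite limn_einf_lim; apply: lime_le; first exact: is_cvg_einfs.
exists N => //= n Nn; apply: le_trans (ur n Nn).
by apply: ereal_inf_lbound; exists n => //=.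
Qed.

(** On a set of finite measure the increments are also summable in the mean, so their sum [S] is
    integrable, hence finite almost everywhere. *)
Lemma fast_cauchy_ae_cvg (h : nat -> T -> R) : (forall n, L2 (h n)) ->
  (forall k, I (fun x => (h k.+1 x - h k x) ^+ 2) <= 4^-1 ^+ k) ->
  {ae mu, forall x, D x -> cvgn (h^~ x)}.
Proof.
move=> h2 hk; set M := fine (mu D).
have dk2 k : L2 (fun x => `|h k.+1 x - h k x|) by apply: L2_abs => //; exact: L2_sub.
have hk1 k : I (fun x => `|h k.+1 x - h k x|) <= (1 + M) / 2 * 2^-1 ^+ k.
  (* The Young weight [2^k] balances [4^-k] against the measure of [D]: both terms become multiples
     of [2^-k]. *)
  have s0 : 0 < (2 : R) ^+ k by rewrite exprn_gt0.
  have e1 : I (fun x => `|h k.+1 x - h k x| * 1) = I (fun x => `|h k.+1 x - h k x|).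
    by apply: I_eq => x _; rewrite mulr1.
  have e2 : I (fun x => `|h k.+1 x - h k x| ^+ 2) =
      I (fun x => (h k.+1 x - h k x) ^+ 2).
    by apply: I_eq => x _; rewrite real_normK// num_real.
  have e3 : I (fun=> 1 ^+ 2) = M by rewrite I_cst// expr1n mul1r.
  have := I_young mD (dk2 k) (L2_cst mD Dfin 1) s0.
  rewrite e1 e2 e3 => /le_trans; apply.
  apply: (@le_trans _ _ (2 ^+ k / 2 * 4^-1 ^+ k + (2 ^+ k)^-1 / 2 * M)).
    by rewrite lerD2r ler_wpM2l// divr_ge0// ltW.
  rewrite -exprVn (_ : 4^-1 = 2^-1 * 2^-1 :> R); last by field.
  rewrite exprMn le_eqVlt; apply/orP; left; apply/eqP.
  rewrite mulrACA -exprMn mulfV ?pnatr_eq0// expr1n.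
  by field.
pose S x := (\big[+%E/0%E]_(0 <= k <oo) (`|h k.+1 x - h k x|)%:E)%E.
have mk k : measurable_fun D (fun x => (`|h k.+1 x - h k x|)%:E).
  by apply/measurable_EFinP; case: (dk2 k).
have S0 x : (0 <= S x)%E by apply: nneseries_ge0.
have Sint : mu.-integrable D S.
  apply/integrableP; split.
    by apply: ge0_emeasurable_sum => // k x _ _; rewrite lee_fin.
  under eq_integral do rewrite gee0_abs//.
  rewrite integral_nneseries//.
  apply: (@le_lt_trans _ _ ((1 + M) / 2 / (1 - 2^-1))%:E); last by rewrite ltry.
  apply: lime_le; first by apply: is_cvg_nneseries => k _ _; apply: integral_ge0.
  apply: nearW => n.
  rewrite (eq_bigr (fun k => (I (fun x => `|h k.+1 x - h k x|))%:E)); last first.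
    by move=> k _; rewrite I_fin//; exact: L2_L1.
  rewrite sumEFin lee_fin.
  have M0 : 0 <= (1 + M) / 2 by rewrite divr_ge0// addr_ge0// fine_ge0.
  apply: le_trans (geometric_le_lim n M0 _ _); [|lra|rewrite ger0_norm; lra].
  by apply: ler_sum => k _; exact: hk1.
apply: filterS (integrable_ae mD Sint) => x Sx Dx.
have : cvgn (series (fun k => `|h k.+1 x - h k x|)).
  by apply: nnseries_is_cvg => //; rewrite ltey_eq Sx.
move=> /normed_cvg /(is_cvgD (is_cvg_cst (h 0%N x))).
rewrite (_ : (_ + _) = h^~ x)//; apply/funext => n.
by rewrite [RHS](eq_sum_telescope (h^~ x)).
Qed.

(** A fast subsequence converges almost everywhere, and Fatou's lemma along it bounds the distance
    of every late [f n] to the limit. The bound is on the extended integral, from which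
    [L2_complete] deduces that [g] is square integrable. *)
Lemma riesz_fischer (f : nat -> T -> R) : (forall n, L2 (f n)) ->
  (forall e : R, 0 < e -> exists N, forall n m, (N <= n)%N -> (N <= m)%N ->
     I (fun x => (f n x - f m x) ^+ 2) <= e) ->
  exists2 g : T -> R, measurable_fun D g & forall e : R, 0 < e -> exists N, forall n,
    (N <= n)%N -> (\int[mu]_(x in D) ((f n x - g x) ^+ 2)%:E <= e%:E)%E.
Proof.
move=> f2 fC.
have /choice[N NC] : forall k, exists N, forall n m, (N <= n)%N -> (N <= m)%N ->
    I (fun x => (f n x - f m x) ^+ 2) <= 4^-1 ^+ k.
  by move=> k; apply: fC; rewrite exprn_gt0.
(* Partial sums of [N] make [p j] at least every [N k] with [k <= j]. *)
pose p k := (\sum_(i < k.+1) N i)%N.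
have pN k j : (k <= j)%N -> (N k <= p j)%N.
  move=> kj; rewrite /p.
  by rewrite (bigD1 (Ordinal (kj : (k < j.+1)%N)))//= leq_addr.
(* The upper limit is measurable everywhere; where the subsequence converges it is the limit, and
   [fine] sends infinite values to [0]. *)
pose g x := fine (limn_esup (fun k => (f (p k) x)%:E)).
have cvgae : {ae mu, forall x, D x -> cvgn (fun k => f (p k) x)}.
  apply: (fast_cauchy_ae_cvg (h := fun k => f (p k))) => // k.
  by apply: (NC k); apply: pN.
have mg : measurable_fun D g.
  apply: (measurableT_comp (fine_measurable measurableT)).
  apply: measurable_fun_limn_esup => k; apply/measurable_EFinP.
  by case: (f2 (p k)).
exists g => // e e0.
have [k ke] : exists k, 4^-1 ^+ k <= e :> R.
  have : (fun k => 4^-1 ^+ k : R) @ \oo --> (0 : R).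
    by apply: cvg_expr; rewrite ger0_norm; lra.
  move=> /cvgrPdist_le/(_ e e0)[k _ /(_ k (leqnn k))/=].
  rewrite sub0r normrN ger0_norm ?exprn_ge0//; first by exists k.
exists (p k) => n kn.
have L (j : nat) := L2_sqr (L2_sub mD (f2 n) (f2 (p j))).
apply: (@le_trans _ _ (\int[mu]_(x in D)
    limn_einf (fun j => ((f n x - f (p j) x) ^+ 2)%:E))%E).
  apply: ae_ge0_le_integral => //.
  - by move=> x _; rewrite lee_fin sqr_ge0.
  - apply/measurable_EFinP/measurable_funX/measurable_funB => //.
    by case: (f2 n).
  - move=> x _; rewrite limn_einf_lim; apply: lime_ge; first exact: is_cvg_einfs.
    apply: nearW => j; apply: le_ereal_inf_tmp => _ [i _ <-].
    by rewrite lee_fin sqr_ge0.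
  - rewrite (_ : (fun x => _) =
      (fun x => - limn_esup (fun j => - ((f n x - f (p j) x) ^+ 2)%:E))%E).
      apply: measurableT_comp => //; apply: measurable_fun_limn_esup => j.
      apply: measurableT_comp => //; apply/measurable_EFinP.
      exact: L1_measurable (L j).
    by apply/funext => x; rewrite -limn_einfN; congr limn_einf; apply/funext => j; rewrite /= opprK.
  apply: filterS cvgae => x cx Dx; move/cx: Dx => {}cx.
  have gx : g x = limn (fun k => f (p k) x).
    rewrite /g; have /cvg_limn_einf_sup[_ ->]// :
      (fun k => (f (p k) x)%:E) @ \oo --> (limn (fun k => f (p k) x))%:E.
    by apply: cvg_EFin => //; exact: nearW.
  have /cvg_limn_einf_sup[-> _]// :
    (fun j => ((f n x - f (p j) x) ^+ 2)%:E) @ \oo --> ((f n x - g x) ^+ 2)%:E.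
  apply: cvg_EFin; first exact: nearW.
  by rewrite gx; apply: cvgM; apply: cvgB => //; exact: cvg_cst.
apply: (le_trans (fatou mu mD _ _)).
- by move=> j; apply/measurable_EFinP; exact: L1_measurable (L j).
- by move=> j x _; rewrite lee_fin sqr_ge0.
apply: (limn_einf_ub (N := k)) => j kj.
rewrite I_fin ?lee_fin//; apply: le_trans ke; apply: NC; last exact: pN.
by apply: leq_trans kn; exact: pN.
Qed.

Lemma L2_complete (f : nat -> T -> R) : (forall n, L2 (f n)) ->
  (forall e : R, 0 < e -> exists N, forall n m, (N <= n)%N -> (N <= m)%N ->
     I (fun x => (f n x - f m x) ^+ 2) <= e) ->
  exists2 g, L2 g & forall e : R, 0 < e -> exists N, forall n, (N <= n)%N ->
    I (fun x => (f n x - g x) ^+ 2) <= e.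
Proof.
move=> f2 /(riesz_fischer f2)[g mg H].
have mfg n : measurable_fun D (fun x => f n x - g x).
  by apply: measurable_funB => //; case: (f2 n).
have L n (e : R) : (\int[mu]_(x in D) ((f n x - g x) ^+ 2)%:E <= e%:E)%E ->
    L1 (fun x => (f n x - g x) ^+ 2) /\ I (fun x => (f n x - g x) ^+ 2) <= e.
  by apply: L1_lint => //; [exact: measurable_funX|move=> x _; exact: sqr_ge0].
exists g.
  have [N /(_ N (leqnn N))/L[i _]] := H 1 ltr01.
  have d2 : L2 (fun x => f N x - g x) by split.
  by apply: (L2_eq mD) (L2_sub mD (f2 N) d2) => x _; rewrite opprB addrC subrK.
by move=> e /H[N hN]; exists N => n /hN/L[].
Qed.

End RieszFischer.

(** * Calculus in the plane *)

Section Slices.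
Variable R : realType.
Implicit Types (f : R * R -> R) (x y : R).

Lemma is_derive_slice1 f x y : derivable f (x, y) (dir R true) ->
  is_derive x 1 (fun s => f (s, y)) (pderiv [:: true] f (x, y)).
Proof.
move=> df.
have E : (fun h : R => h^-1 *: (((fun s => f (s, y)) \o shift x) (h *: 1) - f (x, y))) =
         (fun h : R => h^-1 *: ((f \o shift (x, y)) (h *: dir R true) - f (x, y))).
  apply/funext => h /=; congr (_ *: (f _ - _)).
  by apply: injective_projections; rewrite /= ?scaler0 ?add0r.
by apply: DeriveDef; rewrite /derivable /derive E.
Qed.

Lemma is_derive_slice2 f x y : derivable f (x, y) (dir R false) ->
  is_derive y 1 (fun s => f (x, s)) (pderiv [:: false] f (x, y)).
Proof.
move=> df.
have E : (fun h : R => h^-1 *: (((fun s => f (x, s)) \o shift y) (h *: 1) - f (x, y))) =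
         (fun h : R => h^-1 *: ((f \o shift (x, y)) (h *: dir R false) - f (x, y))).
  apply/funext => h /=; congr (_ *: (f _ - _)).
  by apply: injective_projections; rewrite /= ?scaler0 ?add0r.
by apply: DeriveDef; rewrite /derivable /derive E.
Qed.

Lemma cont_slice1 f x y : {for (x, y), continuous f} ->
  {for x, continuous (fun s => f (s, y))}.
Proof.
move=> cf; apply: (@continuous_comp _ _ _ (fun s : R => (s, y)) f) => //.
by apply: (@cvg_pair _ _ _ _ (nbhs x) (nbhs y)); [exact: cvg_id|exact: cvg_cst].
Qed.

Lemma cont_slice2 f x y : {for (x, y), continuous f} ->
  {for y, continuous (fun s => f (x, s))}.
Proof.
move=> cf; apply: (@continuous_comp _ _ _ (fun s : R => (x, s)) f) => //.
by apply: (@cvg_pair _ _ _ _ (nbhs x) (nbhs y)); [exact: cvg_cst|exact: cvg_id].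
Qed.

Lemma le_int_derive (v v' : R -> R) (A x : R) : A < x -> v A = 0 ->
  continuous v' -> (forall s : R, is_derive s 1 v (v' s)) ->
  (`|v x|%:E <= \int[lebesgue_measure]_s `|v' s|%:E)%E.
Proof.
move=> Ax vA cv' dv.
have cv : continuous v.
  by move=> s; apply: differentiable_continuous; apply/derivable1_diffP; case: (dv s).
have FTC : (\int[lebesgue_measure]_(s in `[A, x]) (v' s)%:E = (v x)%:E - (v A)%:E)%E.
  apply: continuous_FTC2 => //.
  - exact: continuous_subspaceT.
  - split; first by move=> s _; case: (dv s).
    + by apply: cvg_at_right_filter; exact: cv.
    + by apply: cvg_at_left_filter; exact: cv.
  - by move=> s _; rewrite derive1E; case: (dv s).
have mv' : measurable_fun setT v' by exact: continuous_measurable_fun.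
rewrite vA sube0 in FTC.
rewrite -abse_EFin -FTC.
apply: le_trans (le_abse_integral _ _ _) _ => //.
  by apply/measurable_EFinP; exact: measurable_funS mv'.
apply: ge0_subset_integral => //.
by apply/measurable_EFinP; exact: measurableT_comp.
Qed.

Lemma derivable_locally0 f (p : R * R) (b : bool) :
  (\near p, f p = 0) -> 'D_(dir R b) f p = 0.
Proof.
by move=> f0; rewrite (near_eq_derive (g := cst 0))// derive_cst.
Qed.

End Slices.

(** * Mean value arguments and directional derivatives *)

Section Derivatives.
Variable R : realType.

(** A division-free form of differentiability that also covers [h = 0], suited to estimates. *)
Lemma is_derive_epsP (e : R -> R) (x l : R) :
  is_derive x 1 e l <->
  (forall eps : R, 0 < eps -> exists2 d : R, 0 < d &
    forall h, `|h| < d -> `|e (x + h) - e x - l * h| <= eps * `|h|).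
Proof.
split=> [[de <-] eps eps0|H].
  have := de; rewrite /derivable /derive => /cvgrPdist_le /(_ _ eps0)[d/= d0 hd].
  exists d => // h hlt; have [->|h0] := eqVneq h 0.
    by rewrite addr0 subrr mulr0 subrr normr0 mulr0.
  have := hd h; rewrite /= sub0r normrN => /(_ hlt h0).
  rewrite [h *: 1]mulr1 [h + x]addrC; set L := lim _ => Lh.
  rewrite (_ : _ - _ - _ = - (L - h^-1 *: (e (x + h) - e x)) * h); last first.
    by rewrite /GRing.scale/=; field.
  by rewrite normrM normrN ler_wpM2r.
have cv : h^-1 *: ((e \o shift x) (h *: 1) - e x) @[h --> 0^'] --> l.
  apply/cvgrPdist_le => eps eps0; have [d d0 hd] := H _ eps0.
  exists d => // h /=; rewrite sub0r normrN => hlt h0.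
  have := hd h hlt; rewrite [h *: 1]mulr1 [h + x]addrC => hx.
  rewrite (_ : _ - _ = - (e (x + h) - e x - l * h) / h); last first.
    by rewrite /GRing.scale/=; field.
  by rewrite normrM normrN normfV ler_pdivrMr ?normr_gt0.
apply: DeriveDef; first exact: cvgP cv.
exact: cvg_lim cv.
Qed.

Lemma is_derive_sqr (t : R) : is_derive t 1 (fun s : R => s ^+ 2) (2 * t).
Proof.
apply/is_derive_epsP => eps eps0; exists eps => // h hlt.
rewrite (_ : _ - _ - _ = h * h); last by ring.
by rewrite normrM ler_wpM2r// ltW.
Qed.

Lemma is_derive_unique (e : R -> R) (x l l' : R) :
  is_derive x 1 e l -> is_derive x 1 e l' -> l = l'.
Proof. by move=> [_ <-] [_ <-]. Qed.

Lemma is_derive_near (e g : R -> R) (x l d : R) : 0 < d ->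
  (forall h, `|h| < d -> e (x + h) = g (x + h)) ->
  is_derive x 1 e l -> is_derive x 1 g l.
Proof.
move=> d0 eg /is_derive_epsP H; apply/is_derive_epsP => eps /H[d' d'0 hd].
exists (Num.min d d'); first by rewrite lt_min d0.
move=> h; rewrite lt_min => /andP[hd1 hd2].
rewrite -eg// -[x in g x]addr0 -eg ?normr0// addr0; exact: hd.
Qed.

Lemma is_derive_lip (e : R -> R) (x l B : R) :
  (forall h, `|e (x + h) - e x| <= B * `|h|) -> is_derive x 1 e l -> `|l| <= B.
Proof.
move=> lip /is_derive_epsP H; apply/ler_addgt0Pr => eps /H[d d0 hd].
have h0 : 0 < d / 2 by lra.
have hlt : `|d / 2| < d by rewrite gtr0_norm//; lra.
have := hd _ hlt; have := lip (d / 2).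
rewrite (gtr0_norm h0) !ler_norml => /andP[? ?] /andP[? ?].
by apply/andP; split; nra.
Qed.

(** The mean value theorem with [a] and [b] in either order; it turns closeness of partial
    derivatives into an affine approximation in [chain2]. *)
Lemma mvt_est (g g' : R -> R) (a b L eps : R) :
  (forall s, `|s - a| <= `|b - a| -> is_derive s 1 g (g' s) /\ `|g' s - L| <= eps) ->
  `|g b - g a - L * (b - a)| <= eps * `|b - a|.
Proof.
move=> H.
have cg s : `|s - a| <= `|b - a| -> {for s, continuous g}.
  move=> /H[[dg _] _]; apply: differentiable_continuous; exact/derivable1_diffP.
have fin c : `|c - a| <= `|b - a| -> g b - g a = g' c * (b - a) ->
    `|g b - g a - L * (b - a)| <= eps * `|b - a|.
  move=> /H[_ Hc] ->; rewrite -mulrBl normrM ler_wpM2r//.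
have [ab|ab] := leP a b.
  have itv s : s \in `[a, b] -> `|s - a| <= `|b - a|.
    by rewrite in_itv/= => /andP[? ?]; rewrite !ger0_norm ?subr_ge0// lerD2r.
  have [c cab E] := MVT_segment ab (fun s sab =>
      (H s (itv s (subset_itv_oo_cc sab))).1)
      (continuous_in_subspaceT (fun s sab => cg s (itv s (set_mem sab)))).
  by apply: (fin c) => //; exact: itv.
have itv s : s \in `[b, a] -> `|s - a| <= `|b - a|.
  by rewrite in_itv/= => /andP[? ?]; rewrite !ler0_norm ?subr_le0//; lra.
have [c cab E] := MVT_segment (ltW ab) (fun s sab =>
      (H s (itv s (subset_itv_oo_cc sab))).1)
      (continuous_in_subspaceT (fun s sab => cg s (itv s (set_mem sab)))).
by apply: (fin c); [exact: itv|rewrite -opprB E; ring].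
Qed.

(** After subtracting [c t^2], two mean value steps suffice: on [[0, 1]] for the symmetrized
    function [chi], then on [[- s, s]] for [psi1]. *)
Lemma second_difference_ge (psi psi1 psi2 : R -> R) (c : R) :
  (forall t : R, is_derive t 1 psi (psi1 t)) ->
  (forall t : R, is_derive t 1 psi1 (psi2 t)) ->
  (forall t, c <= psi2 t) -> c <= psi 1 + psi (-1) - 2 * psi 0.
Proof.
move=> d1 d2 hc.
have cont (g g' : R -> R) : (forall t : R, is_derive t 1 g (g' t)) -> continuous g.
  by move=> dg s; apply: differentiable_continuous; apply/derivable1_diffP; case: (dg s).
have MV (g g' : R -> R) (a b : R) : a <= b -> (forall t : R, is_derive t 1 g (g' t)) ->
    exists2 z, a <= z <= b & g b - g a = g' z * (b - a).
  move=> ab dg; have [//|z] := MVT_segment ab (fun s _ => dg s).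
    by apply: continuous_subspaceT; exact: cont dg.
  by rewrite in_itv/= => zab ->; exists z.
pose chi t := psi t + psi (- t) - c * t ^+ 2.
pose chi1 t := psi1 t - psi1 (- t) - c * (2 * t).
have dchi (t : R) : is_derive t 1 chi (chi1 t).
  have dN : is_derive t 1 (fun s => psi (- s)) (psi1 (- t) * -1).
    by apply: (is_derive1_comp (d1 (- t))).
  have dX : is_derive t 1 (fun s => c * s ^+ 2) (c * (2 * t)).
    exact: (is_deriveZ c (is_derive_sqr t)).
  have -> : chi1 t = psi1 t + psi1 (- t) * -1 - c * (2 * t) by rewrite /chi1; ring.
  exact: (is_deriveB (is_deriveD (d1 t) dN) dX).
have [s /andP[s0 s1]] := MV chi chi1 0 1 ler01 dchi.
have sN : - s <= s by lra.
have [z _] := MV psi1 psi2 (- s) s sN d2.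
have := hc z; rewrite /chi /chi1 oppr0 => cz E1 E2.
have : 0 <= psi1 s - psi1 (- s) - c * (2 * s) by rewrite E1; nra.
move: E2; nra.
Qed.

Lemma second_difference_le (psi psi1 psi2 : R -> R) (c : R) :
  (forall t : R, is_derive t 1 psi (psi1 t)) ->
  (forall t : R, is_derive t 1 psi1 (psi2 t)) ->
  (forall t, psi2 t <= c) -> psi 1 + psi (-1) - 2 * psi 0 <= c.
Proof.
move=> d1 d2 hc.
have := @second_difference_ge (fun t => - psi t) (fun t => - psi1 t)
  (fun t => - psi2 t) (- c) (fun t => is_deriveN (d1 t)) (fun t => is_deriveN (d2 t)).
move=> H; have {}H : - c <= - psi 1 + - psi (-1) - 2 * - psi 0.
  by apply: H => t; rewrite lerN2.
by lra.
Qed.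

(** The increment from [p] to [p + h eta] is split along a horizontal and a vertical segment, on
    which the partial derivatives stay within [e] of their values at [p]. *)
Lemma chain2 (f : R * R -> R) (p eta : R * R) :
  (\forall q \near p, forall b, derivable f q (dir R b)) ->
  (forall b, {for p, continuous (pderiv [:: b] f)}) ->
  is_derive (0 : R) 1 (fun t => f (p + t *: eta))
    (pderiv [:: true] f p * eta.1 + pderiv [:: false] f p * eta.2).
Proof.
move=> df cf; apply/is_derive_epsP => eps eps0.
(* The summand [1] keeps the denominator positive when [eta = 0]. *)
pose e := eps / (`|eta.1| + `|eta.2| + 1).
have e0 : 0 < e by rewrite divr_gt0// ltr_wpDl// addr_ge0.
have : \forall q \near p, (forall b, derivable f q (dir R b)) /\
    (forall b, `|pderiv [:: b] f q - pderiv [:: b] f p| <= e).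
  have c1 := cf true; have c2 := cf false.
  move/cvgrPdist_le/(_ e e0) : c1 => c1; move/cvgrPdist_le/(_ e e0) : c2 => c2.
  apply: filterS (filterI df (filterI c1 c2)) => q [dq [h1 h2]]; split=> //.
  by case; rewrite distrC; [exact: h1|exact: h2].
move=> /nbhs_ballP[d/= d0 hd].
pose N := `|eta.1| + `|eta.2| + 1.
have N0 : 0 < N by rewrite ltr_wpDl// addr_ge0.
exists (d / N); first by rewrite divr_gt0.
move=> h hlt; rewrite add0r.
have hN : `|h| * N < d by rewrite -ltr_pdivlMr.
have h1 : `|h * eta.1| < d.
  rewrite normrM (le_lt_trans _ hN)// ler_wpM2l// /N.
  by have := normr_ge0 eta.2; lra.
have h2 : `|h * eta.2| < d.
  rewrite normrM (le_lt_trans _ hN)// ler_wpM2l// /N.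
  by have := normr_ge0 eta.1; lra.
case: p df cf hd => x y df cf hd.
rewrite scale0r addr0 (_ : (x, y) + h *: eta = (x + h * eta.1, y + h * eta.2))//.
have ball_in u w : `|u - x| < d -> `|w - y| < d -> ball (x, y) d (u, w).
  by move=> ? ?; split; rewrite /ball/= distrC.
have A1 := @mvt_est (fun s => f (s, y + h * eta.2))
  (fun s => pderiv [:: true] f (s, y + h * eta.2)) x (x + h * eta.1)
  (pderiv [:: true] f (x, y)) e.
have A2 := @mvt_est (fun s => f (x, s))
  (fun s => pderiv [:: false] f (x, s)) y (y + h * eta.2)
  (pderiv [:: false] f (x, y)) e.
have {}A1 : `|f (x + h * eta.1, y + h * eta.2) - f (x, y + h * eta.2)
   - pderiv [:: true] f (x, y) * (h * eta.1)| <= e * `|h * eta.1|.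
  move: A1; rewrite (addrC x) addrK => A1; apply: A1 => s sx.
  have := hd (s, y + h * eta.2); case.
    by apply: ball_in; [exact: le_lt_trans sx _|rewrite [y + _]addrC addrK].
  by move=> D1 D2; split; [apply: is_derive_slice1; exact: D1|exact: D2].
have {}A2 : `|f (x, y + h * eta.2) - f (x, y)
   - pderiv [:: false] f (x, y) * (h * eta.2)| <= e * `|h * eta.2|.
  move: A2; rewrite (addrC y) addrK => A2; apply: A2 => s sy.
  have := hd (x, s); case.
    by apply: ball_in; [rewrite subrr normr0|exact: le_lt_trans sy _].
  by move=> D1 D2; split; [apply: is_derive_slice2; exact: D1|exact: D2].
set P := pderiv [:: true] _ _ in A1 *; set Q := pderiv [:: false] _ _ in A2 *.
rewrite -['D_(1, 0) f (x, y)]/P -['D_(0, 1) f (x, y)]/Q.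
rewrite (_ : _ - _ - _ =
  (f (x + h * eta.1, y + h * eta.2) - f (x, y + h * eta.2) - P * (h * eta.1)) +
  (f (x, y + h * eta.2) - f (x, y) - Q * (h * eta.2))); last by ring.
rewrite (le_trans (ler_normD _ _))// (le_trans (lerD A1 A2))//.
rewrite !normrM -mulrDr -mulrDr mulrCA [leRHS]mulrC ler_wpM2l//.
rewrite /e mulrAC ler_pdivrMr// ler_wpM2l ?(ltW eps0)//.
by rewrite lerDl.
Qed.

Lemma is_derive_quadratic (e : R -> R) (d K : R) : 0 < d -> 0 <= K ->
  (forall t, `|t| < d -> 0 <= e t - e 0 <= K * t ^+ 2) -> is_derive (0 : R) 1 e 0.
Proof.
move=> d0 K0 H; apply/is_derive_epsP => eps eps0.
have K1 : 0 < K + 1 by rewrite ltr_wpDl.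
exists (Num.min d (eps / (K + 1))); first by rewrite lt_min d0 divr_gt0.
move=> h; rewrite lt_min ltr_pdivlMr// add0r mul0r subr0 => /andP[/H/andP[h1 h2] h3].
rewrite ger0_norm// (le_trans h2)// -[h ^+ 2]ger0_norm ?sqr_ge0// normrX expr2 mulrA.
by rewrite ler_wpM2r// mulrC; have := normr_ge0 h; lra.
Qed.

End Derivatives.

(** * Test functions and Sobolev inequalities *)

Section TestFunctions.
Variables (R : realType) (Om : set (R * R)).
Implicit Types (phi psi : R * R -> R).

Lemma test_cont phi : test_fun Om phi -> continuous phi.
Proof. by case=> /(_ [::])[]. Qed.

Lemma test_pderiv_cont phi b : test_fun Om phi -> continuous (pderiv [:: b] phi).
Proof. by case=> /(_ [:: b])[]. Qed.

Lemma test_derivable phi b x : test_fun Om phi -> derivable phi x (dir R b).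
Proof. by case=> /(_ [::])[_ +] _; exact. Qed.

Lemma test_pderiv_supp phi b (K : set (R * R)) : compact K ->
  (forall x, ~ K x -> phi x = 0) -> forall x, ~ K x -> pderiv [:: b] phi x = 0.
Proof.
move=> cK phi0 x Kx; apply: derivable_locally0.
have oK : open (~` K).
  by apply: closed_openC; apply: compact_closed => //; exact: norm_hausdorff.
by apply: filterS (open_nbhs_nbhs (conj oK Kx)) => y; exact: phi0.
Qed.

Lemma test_out phi x : test_fun Om phi -> ~ Om x -> phi x = 0.
Proof. by move=> [_ [K [_ [KO phi0]]]] Ox; apply: phi0 => /KO. Qed.

Lemma test_pderiv_out phi b x : test_fun Om phi -> ~ Om x -> pderiv [:: b] phi x = 0.
Proof.
by move=> [_ [K [cK [KO phi0]]]] Ox; apply: (test_pderiv_supp b cK phi0) => /KO.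
Qed.

Lemma cont_supp_bdd phi (K : set (R * R)) : compact K -> continuous phi ->
  (forall x, ~ K x -> phi x = 0) -> exists B, forall x, `|phi x| <= B.
Proof.
move=> cK cphi phi0.
have : compact (phi @` K).
  by apply: continuous_compact => //; exact: continuous_subspaceT.
move=> /compact_bounded[M [_ /(_ (`|M| + 1))]] h.
exists (`|M| + 1) => x; have [Kx|Kx] := pselect (K x); last first.
  by rewrite phi0// normr0 addr_ge0.
by apply: h; [rewrite (le_lt_trans (ler_norm _))// ltrDl|exists x].
Qed.

Lemma test_bdd phi : test_fun Om phi -> exists B, forall x, `|phi x| <= B.
Proof.
move=> tphi; have cphi := test_cont tphi; case: tphi => _ [K [cK [_ phi0]]].
exact: cont_supp_bdd cK cphi phi0.
Qed.

Lemma test_pderiv_bdd phi b : test_fun Om phi ->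
  exists B, forall x, `|pderiv [:: b] phi x| <= B.
Proof.
move=> tphi; have cphi := test_pderiv_cont (b := b) tphi; case: tphi => _ [K [cK [_ phi0]]].
exact: cont_supp_bdd cK cphi (test_pderiv_supp b cK phi0).
Qed.

Lemma test_far phi : test_fun Om phi -> exists B, forall x, B < `|x| -> phi x = 0.
Proof.
move=> [_ [K [/compact_bounded[M [_ /(_ (`|M| + 1))]] h [_ phi0]]]].
exists (`|M| + 1) => x Mx; apply: phi0 => Kx.
have /(_ x Kx) : forall x, K x -> `|x| <= `|M| + 1.
  by apply: h; rewrite (le_lt_trans (ler_norm _))// ltrDl.
by rewrite leNgt Mx.
Qed.

Lemma derive_lin (f g : R * R -> R) (c : R) (x v : R * R) :
  derivable f x v -> derivable g x v ->
  derivable (fun y => f y + c * g y) x v /\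
  'D_v (fun y => f y + c * g y) x = 'D_v f x + c * 'D_v g x.
Proof.
move=> df dg.
by have [] := is_deriveD (derivableP df) (is_deriveZ c (derivableP dg)).
Qed.

Lemma pderiv_lin phi psi (c : R) : smooth2 phi -> smooth2 psi -> forall l,
  pderiv l (fun x => phi x + c * psi x) =
  (fun x => pderiv l phi x + c * pderiv l psi x).
Proof.
move=> sphi spsi; elim=> [//|b l IH]; apply/funext => x /=.
by rewrite IH; exact: (derive_lin c ((sphi l).2 b x) ((spsi l).2 b x)).2.
Qed.

Lemma test_lin phi psi (c : R) : test_fun Om phi -> test_fun Om psi ->
  test_fun Om (fun x => phi x + c * psi x).
Proof.
move=> [sphi [K [cK [KO phi0]]]] [spsi [L [cL [LO psi0]]]]; split.
  move=> l; rewrite pderiv_lin//; split.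
    move=> x; apply: cvgD; first exact: (sphi l).1.
    by apply: cvgM; [exact: cvg_cst|exact: (spsi l).1].
  by move=> b x; exact: (derive_lin c ((sphi l).2 b x) ((spsi l).2 b x)).1.
exists (K `|` L); split; first exact: compactU.
split; first by move=> x [/KO|/LO].
by move=> x KLx; rewrite phi0 ?psi0 ?mulr0 ?addr0// => ?; apply: KLx; [right|left].
Qed.

Lemma test0 : test_fun Om (fun=> 0).
Proof.
have D0 l : pderiv l (fun=> 0 : R) = (fun=> 0) :> (R * R -> R).
  by elim: l => //= b l ->; apply/funext => x; rewrite derive_cst.
split; last by exists set0; split; [exact: compact0|split].
by move=> l; rewrite D0; split=> [x|b x]; [exact: cvg_cst|exact: derivable_cst].
Qed.

End TestFunctions.

(** * The Gagliardo-Nirenberg inequality in the plane *)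

Section Sobolev.
Variables (R : realType) (Om : set (R * R)).
Hypotheses (Om_open : open Om) (Om_bdd : bounded_set Om).
Let mOm : measurable_for (lebesgue2 R) Om := open2_measurable Om_open.
Let Omfin : (lebesgue2 R Om < +oo)%E := leb2_bounded_lty mOm Om_bdd.
Local Notation mu := (lebesgue2 R).
Local Notation leb := (@lebesgue_measure R).
Local Notation I f := (\int[mu]_(x in Om) f x).
Local Notation L1 f := (mu.-integrable Om (EFin \o f)).
Local Notation L2 f := (L2 mu Om f).

Definition dirichlet (phi : R * R -> R) : R :=
  I (fun x => (grad2 phi x).1 ^+ 2 + (grad2 phi x).2 ^+ 2).

Lemma L2_cont_bdd (f : R * R -> R) : continuous f ->
  (exists B, forall x, `|f x| <= B) -> L2 f.
Proof.
move=> cf [B fB]; apply: (L2_bdd mOm Omfin (r := B)) => //.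
exact: measurable_funS (continuous2_measurable cf).
Qed.

Lemma L2_test phi : test_fun Om phi -> L2 phi.
Proof. by move=> t; apply: L2_cont_bdd; [exact: test_cont t|exact: test_bdd t]. Qed.

Lemma L2_pderiv phi b : test_fun Om phi -> L2 (pderiv [:: b] phi).
Proof.
by move=> t; apply: L2_cont_bdd; [exact: test_pderiv_cont t|exact: test_pderiv_bdd t].
Qed.

(* [|v x y| <= int |d1 v| dx] depends on [y] only and [|v x y| <= int |d2 v| dy]
   on [x] only, hence Tonelli factors the integral of their product. *)
Lemma gagliardo_nirenberg (v v1 v2 : R * R -> R) (A : R) :
  continuous v -> continuous v1 -> continuous v2 ->
  (forall x y, x <= A \/ y <= A -> v (x, y) = 0) ->
  (forall x y : R, is_derive x 1 (fun s => v (s, y)) (v1 (x, y))) ->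
  (forall x y : R, is_derive y 1 (fun s => v (x, s)) (v2 (x, y))) ->
  (\int[mu]_p (v p ^+ 2)%:E <=
   \int[mu]_p `|v1 p|%:E * \int[mu]_p `|v2 p|%:E)%E.
Proof.
move=> cv cv1 cv2 v0 dv1 dv2.
pose a y := (\int[leb]_x `|v1 (x, y)|%:E)%E.
pose b x := (\int[leb]_y `|v2 (x, y)|%:E)%E.
have c1 y : continuous (fun s => v1 (s, y)) by move=> s; exact: (cont_slice1 (cv1 (s, y))).
have c2 x : continuous (fun s => v2 (x, s)) by move=> s; exact: (cont_slice2 (cv2 (x, s))).
have va x y : (`|v (x, y)|%:E <= a y)%E.
  (* A starting point strictly left of [x] and of [A], so that [v] vanishes there whatever the
     position of [x]. *)
  apply: (@le_int_derive _ (fun s => v (s, y)) _ (Num.min A x - 1)) => //.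
  - by rewrite ltrBlDr (le_lt_trans (y := x)) ?ge_min ?lexx ?orbT// ltrDl.
  - by apply: v0; left; rewrite lerBlDr (le_trans (y := A)) ?ge_min ?lexx// lerDl.
have vb x y : (`|v (x, y)|%:E <= b x)%E.
  apply: (@le_int_derive _ (fun s => v (x, s)) _ (Num.min A y - 1)) => //.
  - by rewrite ltrBlDr (le_lt_trans (y := y)) ?ge_min ?lexx ?orbT// ltrDl.
  - by apply: v0; right; rewrite lerBlDr (le_trans (y := A)) ?ge_min ?lexx// lerDl.
have m1 : measurable_fun [set: measurableTypeR R * measurableTypeR R] (fun p => `|v1 p|%:E).
  by apply/measurable_EFinP; apply: measurableT_comp => //; exact: continuous2_measurable.
have m2 : measurable_fun [set: measurableTypeR R * measurableTypeR R] (fun p => `|v2 p|%:E).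
  by apply/measurable_EFinP; apply: measurableT_comp => //; exact: continuous2_measurable.
have n1 p : (0 <= `|v1 p|%:E)%E by rewrite lee_fin.
have n2 p : (0 <= `|v2 p|%:E)%E by rewrite lee_fin.
have ma : measurable_fun setT a :=
  measurable_fun_fubini_tonelli_G (m1 := leb) _ m1 n1.
have mb : measurable_fun setT b :=
  measurable_fun_fubini_tonelli_F (m2 := leb) _ m2 n2.
have a0 y : (0 <= a y)%E by apply: integral_ge0.
have b0 x : (0 <= b x)%E by apply: integral_ge0.
rewrite (fubini_tonelli2 _ m1 n1) (fubini_tonelli1 _ m2 n2).
rewrite fubini_tonelli1; last 2 first.
- by apply/measurable_EFinP/measurable_funX; exact: continuous2_measurable.
- by move=> p; rewrite lee_fin sqr_ge0.
rewrite -[X in (_ <= X * _)%E]/(\int[leb]_y a y)%E -[X in (_ <= _ * X)%E]/(\int[leb]_x b x)%E.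
rewrite -ge0_integralZl//; last by apply: integral_ge0.
apply: ge0_le_integral => //.
- by move=> x _; apply: integral_ge0 => y _; rewrite lee_fin sqr_ge0.
- apply: measurable_fun_fubini_tonelli_F => [|p]; last by rewrite lee_fin sqr_ge0.
  by apply/measurable_EFinP/measurable_funX; exact: continuous2_measurable.
- exact: measurable_funeM.
move=> x _; rewrite /fubini_F -ge0_integralZr//; apply: ge0_le_integral => //.
- by move=> y _; rewrite lee_fin sqr_ge0.
- apply/measurable_EFinP/measurable_funX; apply: continuous_measurable_fun => y.
  exact: (cont_slice2 (cv (x, y))).
- by apply: emeasurable_funM => //; exact: measurable_cst.
move=> y _; rewrite -[_ ^+ 2]ger0_norm ?sqr_ge0// normrX expr2 EFinM.
by apply: lee_pmul.
Qed.

End Sobolev.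

(** * Sobolev and exponential inequalities for test functions *)

Section SobolevTest.
Variables (R : realType) (Om : set (R * R)).
Hypotheses (Om_open : open Om) (Om_bdd : bounded_set Om).
Let mOm : measurable_for (lebesgue2 R) Om := open2_measurable Om_open.
Let Omfin : (lebesgue2 R Om < +oo)%E := leb2_bounded_lty mOm Om_bdd.
Local Notation mu := (lebesgue2 R).
Local Notation I f := (\int[mu]_(x in Om) f x).
Local Notation L1 f := (mu.-integrable Om (EFin \o f)).
Local Notation L2 f := (L2 mu Om f).
Local Notation M := (fine (mu Om)).
Local Notation dirichlet := (dirichlet Om).
Implicit Types (phi : R * R -> R) (g : R -> R).

Lemma integral_out (f : R * R -> R) : (forall x, ~ Om x -> f x = 0) ->
  (\int[mu]_x (f x)%:E = \int[mu]_(x in Om) (f x)%:E)%E.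
Proof.
move=> f0; rewrite [RHS]integral_mkcond; apply: eq_integral => x _.
rewrite /patch; case: ifPn => // xOm.
by rewrite f0// => /mem_set; rewrite (negPf xOm).
Qed.

Lemma L2_comp_test phi g : test_fun Om phi -> continuous g -> L2 (g \o phi).
Proof.
move=> tphi cg; apply: L2_cont_bdd => //.
  by move=> x; apply: continuous_comp; [exact: test_cont tphi x|exact: cg].
have [B phiB] := test_bdd tphi.
have : compact (g @` `[- B, B]).
  by apply: continuous_compact; [exact: continuous_subspaceT|exact: segment_compact].
move=> /compact_bounded[N [_ /(_ (`|N| + 1))]] h.
exists (`|N| + 1) => x; apply: h; first by rewrite (le_lt_trans (ler_norm _))// ltrDl.
by exists (phi x) => //=; rewrite in_itv/= -ler_norml.
Qed.

Lemma dirichletE phi : test_fun Om phi ->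
  dirichlet phi = I (fun x => pderiv [:: true] phi x ^+ 2) +
                  I (fun x => pderiv [:: false] phi x ^+ 2).
Proof.
move=> tphi; rewrite /dirichlet /grad2/= (RintegralD mOm)//.
- by have [] := L2_pderiv Om_open Om_bdd true tphi.
- by have [] := L2_pderiv Om_open Om_bdd false tphi.
Qed.

Lemma dirichlet_ge0 phi : 0 <= dirichlet phi.
Proof. by apply: Rintegral_ge0 => x _; rewrite addr_ge0 ?sqr_ge0. Qed.

(** The condition [g 0 = 0] makes [g o phi] vanish off [Om], so the planar inequality becomes one on
    [Om]; Cauchy-Schwarz then separates [g'(phi)] from each partial derivative of [phi]. *)
Lemma sobolev_comp phi g g' : test_fun Om phi -> g 0 = 0 -> continuous g' ->
  (forall s : R, is_derive s 1 g (g' s)) ->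
  I (fun x => g (phi x) ^+ 2) <= I (fun x => g' (phi x) ^+ 2) * dirichlet phi.
Proof.
move=> tphi g0 cg' dg.
have cg : continuous g.
  by move=> s; apply: differentiable_continuous; apply/derivable1_diffP; case: (dg s).
have cphi := test_cont tphi.
have cgphi : continuous (g \o phi).
  by move=> x; apply: continuous_comp; [exact: cphi|exact: cg].
have cg'phi : continuous (g' \o phi).
  by move=> x; apply: continuous_comp; [exact: cphi|exact: cg'].
have cd b : continuous (pderiv [:: b] phi) by exact: test_pderiv_cont tphi.
pose v b x := g' (phi x) * pderiv [:: b] phi x.
have cv b : continuous (v b) by move=> x; apply: cvgM; [exact: cg'phi|exact: cd].
have [B phiB] := test_far tphi.
have L2g' : L2 (fun x => g' (phi x)) by exact: L2_comp_test cg'.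
have L2d b : L2 (pderiv [:: b] phi) by exact: L2_pderiv.
have L1v b : L1 (fun x => `|v b x|).
  exact/L1_norm/(L2_mul mOm L2g' (L2d b)).
have vOm b : (\int[mu]_x `|v b x|%:E = (I (fun x => `|v b x|))%:E)%E.
  rewrite -(I_fin mOm)//; apply: integral_out => x xOm.
  by rewrite /v (test_pderiv_out b tphi)// mulr0 normr0.
have GN : (\int[mu]_x (g (phi x) ^+ 2)%:E <=
    \int[mu]_x `|v true x|%:E * \int[mu]_x `|v false x|%:E)%E.
  apply: (gagliardo_nirenberg (A := - (`|B| + 1))) => //.
  - move=> x y xy; rewrite phiB// prod_normE/= lt_max.
    have BB := ler_norm B.
    case: xy => h; [apply/orP; left|apply/orP; right];
      rewrite (lt_le_trans (y := `|B| + 1)) ?(le_lt_trans BB) ?ltrDl//;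
      by rewrite lerNr in h; rewrite (le_trans h)// -normrN ler_norm.
  - move=> x y; rewrite /v.
    have := is_derive_slice1 (test_derivable (b := true) (x := (x, y)) tphi).
    exact: (is_derive1_comp (dg _)).
  - move=> x y; rewrite /v.
    have := is_derive_slice2 (test_derivable (b := false) (x := (x, y)) tphi).
    exact: (is_derive1_comp (dg _)).
rewrite (integral_out (f := fun x => g (phi x) ^+ 2)) in GN; last first.
  by move=> x xOm; rewrite (test_out tphi xOm) g0 expr0n.
rewrite !vOm (I_fin mOm) in GN; last exact: (L2_sqr (L2_comp_test tphi cg)).
rewrite -EFinM lee_fin in GN.
apply: (le_trans GN).
have CS b : I (fun x => `|v b x|) ^+ 2 <=
    I (fun x => g' (phi x) ^+ 2) * I (fun x => pderiv [:: b] phi x ^+ 2).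
  have := I_cauchy_schwarz mOm (L2_abs mOm L2g') (L2_abs mOm (L2d b)).
  congr (_ ^+ 2 <= _ * _); apply: I_eq => x _.
  - by rewrite -normrM.
  - by rewrite real_normK// num_real.
  - by rewrite real_normK// num_real.
rewrite dirichletE//.
have G0 (f h : R * R -> R) : 0 <= I (fun x => f x ^+ 2) * I (fun x => h x ^+ 2).
  by apply: mulr_ge0; apply: Rintegral_ge0 => x _; rewrite sqr_ge0.
by rewrite mulrDr; apply: young_bound; rewrite ?CS.
Qed.

(** Poincare's inequality, from [g = id]. *)
Lemma sobolev2 phi : test_fun Om phi ->
  I (fun x => phi x ^+ 2) <= M * dirichlet phi.
Proof.
move=> tphi.
have := sobolev_comp (g := id) (g' := fun=> 1) tphi erefl _ _.
rewrite (I_cst _ mOm) expr1n mul1r; by apply => x; exact: cvg_cst.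
Qed.

(** The choice [g s = s^2] gives an inequality of Ladyzhenskaya type, whose factor [int phi^2] is
    bounded by [sobolev2]. *)
Lemma sobolev4 phi : test_fun Om phi ->
  I (fun x => phi x ^+ 4) <= 4 * M * dirichlet phi ^+ 2.
Proof.
move=> tphi.
have := sobolev_comp (g := fun x => x ^+ 2) (g' := fun x => 2 * x) tphi _ _ _.
rewrite (_ : I (fun x => (phi x ^+ 2) ^+ 2) = I (fun x => phi x ^+ 4)); last first.
  by apply: I_eq => x _; rewrite -exprM.
rewrite (_ : I (fun x => (2 * phi x) ^+ 2) = 4 * I (fun x => phi x ^+ 2)); last first.
  rewrite -(RintegralZl _ mOm); last by have [] := L2_test Om_open Om_bdd tphi.
  by apply: I_eq => x _; ring.
move=> H; apply: (le_trans (H _ _ _)).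
- by rewrite expr0n.
- by move=> x; apply: cvgM; [exact: cvg_cst|exact: cvg_id].
- by move=> s; exact: is_derive_sqr.
rewrite expr2 mulrA ler_wpM2r ?dirichlet_ge0// -mulrA ler_wpM2l//.
exact: sobolev2.
Qed.

(** With [y = exp phi], the bound [(y - 1)^2 >= y^2 / 2 - 1] puts half of [int exp (2 phi)] on the
    left, where the quarter on the right is absorbed; the integral is finite because [phi] is
    bounded. *)
Lemma exp_bound phi : test_fun Om phi -> dirichlet phi <= 4^-1 ->
  I (fun x => expR (2 * phi x)) <= 4 * M.
Proof.
move=> tphi D4.
have ce : continuous (@expR R) by exact: continuous_expR.
have L2e : L2 (fun x => expR (phi x)) by exact: L2_comp_test ce.
have := sobolev_comp (g := fun x => expR x - 1) (g' := expR) tphi _ ce _.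
have e2 : I (fun x => expR (phi x) ^+ 2) = I (fun x => expR (2 * phi x)).
  by apply: I_eq => x _; rewrite -expRM_natl mulr_natl.
rewrite e2 => /(_ _ _)H.
have {}H : I (fun x => (expR (phi x) - 1) ^+ 2) <= I (fun x => expR (2 * phi x)) * dirichlet phi.
  apply: H; first by rewrite expR0 subrr.
  by move=> s; rewrite -[expR s]subr0; apply: is_deriveB.
have i2 : L1 (fun x => expR (phi x) ^+ 2) by case: L2e.
have i1 := L2_cst mOm Omfin 1.
have ic := L1_cst mOm Omfin 1.
have h : I (fun x => 2^-1 * expR (phi x) ^+ 2 - 1) <= I (fun x => (expR (phi x) - 1) ^+ 2).
  apply: (I_le mOm); last by move=> x _; exact: sqr_sub1_ge.
  - by apply: L1_sub => //; exact: L1_scale.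
  - by have [] := L2_sub mOm L2e i1.
rewrite (RintegralB mOm)// ?(RintegralZl _ mOm)// ?(I_cst _ mOm)// ?e2 in h; last exact: L1_scale.
have X0 : 0 <= I (fun x => expR (2 * phi x)).
  by apply: Rintegral_ge0 => x _; exact: expR_ge0.
exact: exp_bound_arith X0 D4 H h.
Qed.

End SobolevTest.

(** * The norm F *)

Section Finsler.
Variables (R : realType) (F : R * R -> R) (a b mu Lam : R).
Hypotheses (F_ge0 : forall xi, 0 <= F xi)
  (F_convex : forall (x y : R * R) (t : R), 0 <= t <= 1 ->
     F (t *: x + (1 - t) *: y) <= t * F x + (1 - t) * F y)
  (F_C2 : C2_on [set xi : R * R | xi != 0] F)
  (F_hom : forall (t : R) (xi : R * R), F (t *: xi) = `|t| * F xi)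
  (a_gt0 : 0 < a) (a_le_b : a <= b)
  (F_bounds : forall xi : R * R, a * enorm2 xi <= F xi /\ F xi <= b * enorm2 xi)
  (mu_gt0 : 0 < mu) (Lam_gt0 : 0 < Lam)
  (F_ell : forall xi V : R * R, enorm2 xi = 1 -> dot2 V xi = 0 ->
     mu ^+ 2 * enorm2 V ^+ 2 <= hess_form F xi V /\
     hess_form F xi V <= Lam * enorm2 V ^+ 2).
Implicit Types (q V W x y : R * R).

Definition sqn x : R := x.1 ^+ 2 + x.2 ^+ 2.

Lemma sqn_ge0 x : 0 <= sqn x. Proof. by rewrite addr_ge0 ?sqr_ge0. Qed.

Lemma enorm2_sqr x : enorm2 x ^+ 2 = sqn x.
Proof. by rewrite /enorm2 /dot2 -!expr2 sqr_sqrtr// sqn_ge0. Qed.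

Lemma enorm2_ge0 x : 0 <= enorm2 x. Proof. exact: sqrtr_ge0. Qed.

Lemma sqn_eq0 x : (sqn x == 0) = (x == 0).
Proof.
case: x => x y; rewrite /sqn/= paddr_eq0 ?sqr_ge0// !sqrf_eq0.
by [].
Qed.

Lemma sqn_gt0 x : x != 0 -> 0 < sqn x.
Proof. by move=> x0; rewrite lt_neqAle eq_sym sqn_eq0 x0 sqn_ge0. Qed.

Lemma F_sqr_bounds x : a ^+ 2 * sqn x <= F x ^+ 2 <= b ^+ 2 * sqn x.
Proof.
have [l u] := F_bounds x; have := enorm2_ge0 x; rewrite -enorm2_sqr => e0.
by rewrite -!exprMn; apply/andP; split;
  rewrite lerXn2r// nnegrE ?mulr_ge0// ltW// (lt_le_trans a_gt0).
Qed.

(** Convexity at the midpoint, rescaled by homogeneity. *)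
Lemma F_sub x y : F (x + y) <= F x + F y.
Proof.
have h : 0 <= (2^-1 : R) <= 1 by apply/andP; split; lra.
have := F_convex x y h; rewrite (_ : 1 - 2^-1 = 2^-1); last by field.
rewrite -scalerDr F_hom ger0_norm//; lra.
Qed.

Lemma F_lip x y : `|F (x + y) - F x| <= F y.
Proof.
rewrite ler_norml; have h1 := F_sub x y; have := F_sub (x + y) (- y).
rewrite addrK -scaleN1r F_hom normrN1 mul1r => h2.
by apply/andP; split; lra.
Qed.

Lemma F_continuous : continuous F.
Proof.
move=> x; apply/cvgrPdist_le => e e0.
have b0 : 0 < b by exact: lt_le_trans a_le_b.
have d0 : 0 < e / (2 * b) by rewrite divr_gt0// mulr_gt0.
apply: filterS (nbhsx_ballx x _ d0) => y [y1 y2].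
have -> : F y = F (x + (y - x)) by rewrite addrC subrK.
rewrite distrC.
apply: (le_trans (F_lip _ _)); apply: (le_trans (F_bounds _).2).
move: y1 y2; rewrite /ball/= !(distrC x.1) !(distrC x.2) => y1 y2.
suff : enorm2 (y - x) <= 2 * (e / (2 * b)).
  move=> h; rewrite (le_trans (ler_wpM2l (ltW b0) h))// le_eqVlt; apply/orP; left.
  by apply/eqP; field; rewrite gt_eqF.
have d20 : 0 <= 2 * (e / (2 * b)) by rewrite mulr_ge0// ltW.
rewrite -(ler_pXn2r (n := 2))// ?nnegrE ?enorm2_ge0//.
rewrite enorm2_sqr /sqn/= -(real_normK (num_real (y.1 - x.1))) -(real_normK (num_real (y.2 - x.2))).
have := normr_ge0 (y.1 - x.1); have := normr_ge0 (y.2 - x.2).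
move: d0 y1 y2; set d := e / _; set u := `|_|; set w := `|_|; nra.
Qed.

Lemma near_nz q : q != 0 -> \forall x \near q, x != 0.
Proof.
move=> q0; have oq : open [set x : R * R | x != 0].
  rewrite (_ : [set x | _] = ~` [set 0]); last first.
    by apply/seteqP; split=> x /= /eqP.
  by apply: closed_openC; exact/accessible_closed_set1/hausdorff_accessible/norm_hausdorff.
exact: open_nbhs_nbhs (conj oq q0).
Qed.

Lemma nz_near q V : q != 0 ->
  exists2 d : R, 0 < d & forall h, `|h| < d -> q + h *: V != 0.
Proof.
move=> q0.
have /nbhs_ballP[d/= d0 hd] := near_nz q0.
have N0 : 0 < `|V.1| + `|V.2| + 1 by rewrite ltr_wpDl// addr_ge0.
exists (d / (`|V.1| + `|V.2| + 1)); first by rewrite divr_gt0.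
move=> h; rewrite ltr_pdivlMr// => hV; apply: hd.
have V1 := normr_ge0 V.1; have V2 := normr_ge0 V.2; have h0 := normr_ge0 h.
by split; rewrite /ball/= opprD addrA subrr sub0r normrN normrM; nra.
Qed.

Definition dF q V := pderiv [:: true] F q * V.1 + pderiv [:: false] F q * V.2.

(** The derivative of [dF _ W] in the direction [V]; the two arguments are not interchangeable by
    definition, since the mixed partials appear in both orders. *)
Definition d2F q V W :=
  (pderiv [:: true; true] F q * V.1 + pderiv [:: false; true] F q * V.2) * W.1 +
  (pderiv [:: true; false] F q * V.1 + pderiv [:: false; false] F q * V.2) * W.2.

Lemma hess_d2F q V : hess_form F q V = d2F q V V.
Proof.
rewrite /hess_form /d2F; move: (pderiv _ F q) (pderiv _ F q) (pderiv _ F q) (pderiv _ F q).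
by move=> *; ring.
Qed.

Lemma dFD q (s t : R) V W : dF q (s *: V + t *: W) = s * dF q V + t * dF q W.
Proof.
rewrite /dF; move: (pderiv _ F q) (pderiv _ F q) => x y /=; rewrite /GRing.scale/=.
by ring.
Qed.

Lemma dFZ q (s : R) V : dF q (s *: V) = s * dF q V.
Proof. by rewrite -[s *: V]addr0 -[0 in LHS](scale0r V) dFD mul0r addr0. Qed.

Lemma d2FDl q (s t : R) V V' W :
  d2F q (s *: V + t *: V') W = s * d2F q V W + t * d2F q V' W.
Proof.
rewrite /d2F; move: (pderiv _ F q) (pderiv _ F q) (pderiv _ F q) (pderiv _ F q).
by move=> * /=; rewrite /GRing.scale/=; ring.
Qed.

Lemma d2FDr q (s t : R) V W W' :
  d2F q V (s *: W + t *: W') = s * d2F q V W + t * d2F q V W'.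
Proof.
rewrite /d2F; move: (pderiv _ F q) (pderiv _ F q) (pderiv _ F q) (pderiv _ F q).
by move=> * /=; rewrite /GRing.scale/=; ring.
Qed.

Lemma d2FZl q (s : R) V W : d2F q (s *: V) W = s * d2F q V W.
Proof. by rewrite -[s *: V]addr0 -[0 in LHS](scale0r V) d2FDl mul0r addr0. Qed.

Lemma d2FZr q (s : R) V W : d2F q V (s *: W) = s * d2F q V W.
Proof. by rewrite -[s *: W]addr0 -[0 in LHS](scale0r W) d2FDr mul0r addr0. Qed.

Lemma is_derive_F0 q V : q != 0 ->
  is_derive (0 : R) 1 (fun t => F (q + t *: V)) (dF q V).
Proof.
move=> q0; apply: chain2.
  by apply: filterS (near_nz q0) => x x0 c; exact: (F_C2 (l := [::]) _ x0).2.
by move=> c; exact: (F_C2 (l := [:: c]) _ q0).1.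
Qed.

Lemma is_derive_dF0 q V W : q != 0 ->
  is_derive (0 : R) 1 (fun t => dF (q + t *: V) W) (d2F q V W).
Proof.
move=> q0.
have H c : is_derive (0 : R) 1 (fun t => pderiv [:: c] F (q + t *: V))
    (pderiv [:: true; c] F q * V.1 + pderiv [:: false; c] F q * V.2).
  apply: (chain2 (f := pderiv [:: c] F)).
    by apply: filterS (near_nz q0) => x x0 c'; exact: (F_C2 (l := [:: c]) _ x0).2.
  by move=> c'; exact: (F_C2 (l := [:: c'; c]) _ q0).1.
have E := is_deriveD (is_deriveZ W.1 (H true)) (is_deriveZ W.2 (H false)).
have -> : d2F q V W = W.1 *: (pderiv [:: true; true] F q * V.1 + pderiv [:: false; true] F q * V.2)
  + W.2 *: (pderiv [:: true; false] F q * V.1 + pderiv [:: false; false] F q * V.2).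
  rewrite /d2F; move: (pderiv _ F q) (pderiv _ F q) (pderiv _ F q) (pderiv _ F q).
  by move=> * /=; rewrite /GRing.scale/=; ring.
apply: (is_derive_near ltr01 _ E) => h _; rewrite /dF [_ * W.1]mulrC [_ * W.2]mulrC.
by [].
Qed.

Lemma is_derive_line (f : R * R -> R) q V (t l : R) :
  is_derive (0 : R) 1 (fun s => f (q + t *: V + s *: V)) l ->
  is_derive t 1 (fun s => f (q + s *: V)) l.
Proof.
move=> /is_derive_epsP H; apply/is_derive_epsP => eps /H[d d0 hd].
exists d => // h /hd; rewrite add0r scale0r addr0.
by rewrite scalerDl addrA.
Qed.

(** Differentiate [F (c q + h V) = c F (q + (h / c) V)] at [h = 0]. *)
Lemma dF_hom (c : R) q V : 0 < c -> q != 0 -> dF (c *: q) V = dF q V.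
Proof.
move=> c0 q0; have cq0 : c *: q != 0.
  by rewrite scaler_eq0 negb_or gt_eqF.
apply: is_derive_unique (is_derive_F0 V cq0) _.
have E := is_deriveZ c (is_derive_F0 (c^-1 *: V) q0).
have -> : dF q V = c *: dF q (c^-1 *: V).
  by rewrite dFZ /GRing.scale/= mulrA mulfV ?mul1r// gt_eqF.
apply: (is_derive_near ltr01 _ E) => h _; rewrite !add0r.
have -> : c *: q + h *: V = c *: (q + h *: (c^-1 *: V)).
  by rewrite scalerDr !scalerA mulrAC mulfV ?mul1r// gt_eqF.
by rewrite F_hom gtr0_norm.
Qed.

(** Euler's identity: along the ray, [F (q + h q) = (1 + h) F q] for [|h| < 1]. *)
Lemma dF_euler q : q != 0 -> dF q q = F q.
Proof.
move=> q0; apply: is_derive_unique (is_derive_F0 q q0) _.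
have E : is_derive (0 : R) 1 (fun t => F q + t * F q) (F q).
  apply/is_derive_epsP => eps eps0; exists 1 => // h _.
  rewrite (_ : _ - _ - _ = 0); last by ring.
  by rewrite normr0 mulr_ge0// ltW.
apply: is_derive_near ltr01 _ E => h h1.
rewrite add0r (_ : q + h *: q = (1 + h) *: q); last by rewrite scalerDl scale1r.
rewrite F_hom ger0_norm; first by ring.
by move: h1; rewrite ltr_norml => /andP[? ?]; lra.
Qed.

(** By [dF_hom], [dF _ W] is constant along the ray through [q]. *)
Lemma d2F_radial1 q W : q != 0 -> d2F q q W = 0.
Proof.
move=> q0; apply: is_derive_unique (is_derive_dF0 q W q0) _.
have E : is_derive (0 : R) 1 (fun=> dF q W) 0 by exact: is_derive_cst.
apply: is_derive_near ltr01 _ E => h h1.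
rewrite add0r (_ : q + h *: q = (1 + h) *: q); last by rewrite scalerDl scale1r.
rewrite dF_hom//.
by move: h1; rewrite ltr_norml => /andP[? ?]; lra.
Qed.

(** Differentiating Euler's identity along [q + t V] gives [d2F q V q + dF q V = dF q V]. *)
Lemma d2F_radial2 q V : q != 0 -> d2F q V q = 0.
Proof.
move=> q0; have [d d0 hd] := nz_near V q0.
have E1 := is_derive_dF0 V q q0.
have E2 := is_derive_dF0 V V q0.
have E3 := is_deriveD E1 (is_deriveM (is_derive_id (0 : R) 1) E2).
have E4 : is_derive (0 : R) 1 (fun t => F (q + t *: V))
   (d2F q V q + (0 *: d2F q V V + dF (q + 0 *: V) V *: 1)).
  apply: is_derive_near d0 _ E3 => h hlt /=.
  rewrite add0r -[RHS]dF_euler ?hd//.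
  rewrite -[LHS]/(dF (q + h *: V) q + h * dF (q + h *: V) V).
  by have := dFD (q + h *: V) 1 h q V; rewrite scale1r mul1r.
have := is_derive_unique E4 (is_derive_F0 V q0).
rewrite !scale0r add0r addr0 [_ *: 1]mulr1 => /(congr1 (fun z => z - dF q V)).
by rewrite addrK subrr.
Qed.

Lemma d2F_hom (c : R) q V W : 0 < c -> q != 0 ->
  d2F (c *: q) V W = c^-1 * d2F q V W.
Proof.
move=> c0 q0; have cq0 : c *: q != 0 by rewrite scaler_eq0 negb_or gt_eqF.
have -> : c^-1 * d2F q V W = d2F q (c^-1 *: V) W.
  by rewrite d2FZl.
apply: is_derive_unique (is_derive_dF0 V W cq0) _.
have [d d0 hd] := nz_near (c^-1 *: V) q0.
apply: is_derive_near d0 _ (is_derive_dF0 (c^-1 *: V) W q0) => h hlt.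
rewrite !add0r -(dF_hom W c0 (hd _ hlt)) scalerDr !scalerA.
by rewrite mulrAC mulfV ?mul1r// gt_eqF.
Qed.

Definition perp q : R * R := (- q.2, q.1).

(** Ellipticity is assumed at unit vectors. Dividing [q] and [perp q] by [|q|] multiplies the form
    by [|q|] through homogeneity and by [|q|^-2] through bilinearity. *)
Lemma d2F_perp_bounds q : q != 0 ->
  mu ^+ 2 * enorm2 q <= d2F q (perp q) (perp q) <= Lam * enorm2 q.
Proof.
move=> q0; set r := enorm2 q.
have r0 : 0 < r.
  by rewrite lt_neqAle enorm2_ge0 andbT eq_sym -sqrf_eq0 enorm2_sqr sqn_eq0.
have rN : r != 0 by rewrite gt_eqF.
have r2 := enorm2_sqr q; rewrite -/r /sqn in r2.
have u1 : enorm2 (r^-1 *: q) = 1.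
  apply/eqP; rewrite -(eqrXn2 (n := 2))// ?enorm2_ge0// enorm2_sqr expr1n /sqn/=.
  by apply/eqP; rewrite /GRing.scale/= !exprMn -mulrDr -r2; field.
have u2 : enorm2 (r^-1 *: perp q) = 1.
  apply/eqP; rewrite -(eqrXn2 (n := 2))// ?enorm2_ge0// enorm2_sqr expr1n /sqn/=.
  by apply/eqP; rewrite /GRing.scale/= !exprMn -mulrDr sqrrN addrC -r2; field.
have du : dot2 (r^-1 *: perp q) (r^-1 *: q) = 0.
  by rewrite /dot2/= /GRing.scale/=; ring.
have [l h] := F_ell u1 du.
have E : hess_form F (r^-1 *: q) (r^-1 *: perp q) = r^-1 * d2F q (perp q) (perp q).
  rewrite hess_d2F d2F_hom ?invr_gt0// invrK.
  by rewrite d2FZl d2FZr; field.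
move: l h; rewrite E u2 expr1n !mulr1 ler_pdivlMl// ler_pdivrMl// => l h.
by rewrite mulrC l mulrC h.
Qed.

(** The triangle inequality for [F] yields [|dF q V| <= F V]. *)
Lemma dF_bound q V : q != 0 -> dF q V ^+ 2 <= b ^+ 2 * sqn V.
Proof.
move=> q0.
have /(is_derive_lip (B := F V)) : is_derive (0 : R) 1 (fun t => F (q + t *: V)) (dF q V).
  exact: is_derive_F0.
move=> H; have {}H : `|dF q V| <= F V.
  by apply: H => h; rewrite add0r scale0r addr0 mulrC -F_hom; exact: F_lip.
have /andP[_] := F_sqr_bounds V; apply: le_trans.
by rewrite -[leLHS]real_normK ?num_real// lerXn2r// nnegrE.
Qed.

Lemma perp_decomp q V : q != 0 -> exists al be : R,
  V = al *: q + be *: perp q /\ sqn V = (al ^+ 2 + be ^+ 2) * sqn q.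
Proof.
move=> q0; have N0 : q.1 ^+ 2 + q.2 ^+ 2 != 0 by rewrite gt_eqF// sqn_gt0.
exists ((V.1 * q.1 + V.2 * q.2) / sqn q), ((V.2 * q.1 - V.1 * q.2) / sqn q).
rewrite /sqn; split; last by field.
by apply: injective_projections; rewrite /= /GRing.scale/=; field.
Qed.

(** The middle term is the second derivative of [F^2] along [V]. Write [V = al q + be perp q]: the
    second differential sees only [be], and Euler's identity gives [al F q = X - Y] with
    [X = dF q V], [Y = be dF q (perp q)]. Hence [a^2 |V|^2 <= 2 X^2 + (2 b^2 + a^2) be^2 |q|^2]; the
    fraction in the constant is the multiple of the Hessian term that pays for the last summand. *)
Lemma d2F_sqr_bounds q V : q != 0 ->
  a ^+ 2 / (1 + (2 * b ^+ 2 + a ^+ 2) / (2 * a * mu ^+ 2)) * sqn V <=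
    2 * dF q V ^+ 2 + 2 * (F q * d2F q V V) <=
  (2 * b ^+ 2 + 2 * b * Lam) * sqn V.
Proof.
move=> q0; have [al [be [VE VN]]] := perp_decomp V q0.
have /andP[l u] := d2F_perp_bounds q0.
have [Fl Fu] := F_bounds q; have r2 := enorm2_sqr q; have r0 := enorm2_ge0 q.
have E : d2F q V V = be ^+ 2 * d2F q (perp q) (perp q).
  have e1 := d2FDl q al be q (perp q) V; rewrite -VE in e1.
  have e2 := d2FDr q al be (perp q) q (perp q); rewrite -VE in e2.
  by rewrite e1 e2 (d2F_radial1 V q0) (d2F_radial2 (perp q) q0) !mulr0 !add0r mulrA -expr2.
have dV : dF q V = al * F q + be * dF q (perp q).
  by rewrite -[F q in RHS](dF_euler q0) {1}VE dFD.
have ub := dF_bound V q0; have pb := dF_bound (perp q) q0.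
have pn : sqn (perp q) = sqn q by rewrite /sqn /= sqrrN addrC.
have /andP[Ql _] := F_sqr_bounds q.
rewrite pn in pb; have N0 := sqn_ge0 q; have V0 := sqn_ge0 V.
have b0 : 0 < b by exact: lt_le_trans a_le_b.
have FHl : a * mu ^+ 2 * sqn q <= F q * d2F q (perp q) (perp q).
  rewrite -r2 (_ : _ * _ = (a * enorm2 q) * (mu ^+ 2 * enorm2 q)); last by ring.
  by apply: ler_pM => //; rewrite mulr_ge0 ?sqr_ge0// ltW.
have FHu : F q * d2F q (perp q) (perp q) <= b * Lam * sqn q.
  rewrite -r2 (_ : b * _ * _ = (b * enorm2 q) * (Lam * enorm2 q)); last by ring.
  by apply: ler_pM => //; apply: le_trans l; rewrite mulr_ge0 ?sqr_ge0.
rewrite E (_ : F q * _ = be ^+ 2 * (F q * d2F q (perp q) (perp q))); last by ring.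
move: FHl FHu; set H := F q * d2F _ _ _ => FHl FHu.
have be2 := sqr_ge0 be; have al2 := sqr_ge0 al.
apply/andP; split; last first.
  rewrite [leRHS]mulrDl; apply: lerD; first by rewrite -mulrA ler_wpM2l.
  rewrite -mulrA -[leRHS]mulrA ler_wpM2l// [leRHS]mulrA VN.
  apply: (@le_trans _ _ (be ^+ 2 * (b * Lam * sqn q))); first exact: ler_wpM2l.
  rewrite mulrCA ler_wpM2l ?mulr_ge0 ?(ltW b0) ?(ltW Lam_gt0)//.
  by rewrite ler_wpM2r// lerDr.
set X := dF q V in dV *; set Y := be * dF q (perp q) in dV.
have Y2 : Y ^+ 2 <= be ^+ 2 * (b ^+ 2 * sqn q) by rewrite exprMn ler_wpM2l.
have A2 : al ^+ 2 * (a ^+ 2 * sqn q) <= 2 * X ^+ 2 + 2 * Y ^+ 2.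
  apply: (@le_trans _ _ ((al * F q) ^+ 2)); first by rewrite exprMn ler_wpM2l.
  have -> : al * F q = X - Y by rewrite dV addrK.
  by have := sqr_ge0 (X + Y); nra.
have aHl : be ^+ 2 * (a * mu ^+ 2 * sqn q) <= be ^+ 2 * H by rewrite ler_wpM2l.
have m0 : 0 < 2 * a * mu ^+ 2 by rewrite !mulr_gt0.
set K := (2 * b ^+ 2 + a ^+ 2) / (2 * a * mu ^+ 2).
have K0 : 0 <= K.
  rewrite divr_ge0 ?(ltW m0)//.
  by have := sqr_ge0 a; have := sqr_ge0 b; lra.
have K1 : 0 < 1 + K by rewrite ltr_wpDr.
rewrite mulrAC ler_pdivrMr// VN.
have KE : K * (2 * (be ^+ 2 * (a * mu ^+ 2 * sqn q))) =
    (2 * b ^+ 2 + a ^+ 2) * (be ^+ 2 * sqn q).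
  by rewrite /K; field; rewrite gt_eqF//= gt_eqF.
have KH := ler_wpM2l K0 aHl.
have H0 : 0 <= be ^+ 2 * H.
  by apply: le_trans aHl; rewrite mulr_ge0// mulr_ge0// mulr_ge0 ?sqr_ge0// ltW.
have XK : 0 <= K * X ^+ 2 by rewrite mulr_ge0 ?sqr_ge0.
move: A2 Y2 KE KH H0 XK; lra.
Qed.

(* A line through the origin is handled by homogeneity; along any other line
   [F ^+ 2] is twice differentiable. *)
Lemma F_sqr_second_difference : exists c C : R, [/\ 0 < c, 0 <= C &
  forall x V, c * sqn V <= F (x + V) ^+ 2 + F (x - V) ^+ 2 - 2 * F x ^+ 2
              <= C * sqn V].
Proof.
have b0 : 0 < b by exact: lt_le_trans a_le_b.
have m0 : 0 < 2 * a * mu ^+ 2 by rewrite !mulr_gt0// exprn_gt0.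
set K := (2 * b ^+ 2 + a ^+ 2) / (2 * a * mu ^+ 2).
have K0 : 0 <= K.
  rewrite divr_ge0 ?(ltW m0)//.
  by have := sqr_ge0 a; have := sqr_ge0 b; lra.
have K1 : 0 < 1 + K by rewrite ltr_wpDr.
exists (a ^+ 2 / (1 + K)), (2 * b ^+ 2 + 2 * b * Lam); split.
- by rewrite divr_gt0// exprn_gt0.
- by rewrite addr_ge0 ?mulr_ge0 ?sqr_ge0// ltW.
move=> x V.
have [[t xtV]|nz] := pselect (exists t : R, x + t *: V = 0).
  have -> : x = (- t) *: V by apply/eqP; rewrite scaleNr -addr_eq0 xtV.
  rewrite -[X in F (_ + X)]scale1r -scalerDl -[X in F (_ - X)]scale1r -scalerBl !F_hom.
  rewrite !exprMn !real_normK ?num_real//.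
  rewrite (_ : _ - _ = 2 * F V ^+ 2); last by ring.
  have /andP[l u] := F_sqr_bounds V; have V0 := sqn_ge0 V.
  apply/andP; split.
    apply: (@le_trans _ _ (a ^+ 2 * sqn V)).
      by rewrite ler_wpM2r// ler_pdivrMr// ler_peMr ?sqr_ge0// lerDl.
    by have := sqr_ge0 (F V); lra.
  rewrite mulrDl -mulrA; have : 0 <= 2 * b * Lam * sqn V by rewrite !mulr_ge0// ltW.
  lra.
have {}nz t : x + t *: V != 0 by apply/eqP => h; apply: nz; exists t.
pose psi t := F (x + t *: V) ^+ 2.
pose psi1 t := 2 * (F (x + t *: V) * dF (x + t *: V) V).
pose psi2 t := 2 * dF (x + t *: V) V ^+ 2 + 2 * (F (x + t *: V) * d2F (x + t *: V) V V).
have dFt (t : R) : is_derive t 1 (fun s => F (x + s *: V)) (dF (x + t *: V) V).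
  by apply: is_derive_line; exact: is_derive_F0.
have ddFt (t : R) : is_derive t 1 (fun s => dF (x + s *: V) V) (d2F (x + t *: V) V V).
  by apply: (is_derive_line (f := fun y => dF y V)); exact: is_derive_dF0.
have dpsi (t : R) : is_derive t 1 psi (psi1 t).
  have E := is_deriveM (dFt t) (dFt t).
  have -> : psi1 t = F (x + t *: V) *: dF (x + t *: V) V + F (x + t *: V) *: dF (x + t *: V) V.
    by rewrite /psi1 mulr_natl mulr2n.
  exact: E.
have dpsi1 (t : R) : is_derive t 1 psi1 (psi2 t).
  have E := is_deriveZ 2 (is_deriveM (dFt t) (ddFt t)).
  have -> : psi2 t = 2 *: (F (x + t *: V) *: d2F (x + t *: V) V V +
      dF (x + t *: V) V *: dF (x + t *: V) V).
    by rewrite /psi2 -mulrDr addrC.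
  exact: E.
have bnd t := d2F_sqr_bounds V (nz t).
have -> : F (x + V) ^+ 2 + F (x - V) ^+ 2 - 2 * F x ^+ 2 = psi 1 + psi (-1) - 2 * psi 0.
  by rewrite /psi scale1r scaleN1r scale0r addr0.
apply/andP; split.
  by apply: (second_difference_ge dpsi dpsi1) => t; have /andP[] := bnd t.
by apply: (second_difference_le dpsi dpsi1) => t; have /andP[] := bnd t.
Qed.

End Finsler.

(** * Bump functions *)

Section Bump1.
Variables (R : realType) (c d : R).
Hypothesis cd : c < d.
Implicit Types (P : {poly R}) (k : nat) (x : R).

Definition bump_wt : {poly R} := ('X - c%:P) * (d%:P - 'X).
Local Notation W := bump_wt.

Lemma bump_wtE x : W.[x] = (x - c) * (d - x).
Proof. by rewrite /bump_wt !hornerE. Qed.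

Lemma bump_wt_gt0 x : c < x < d -> 0 < W.[x].
Proof. by move=> /andP[? ?]; rewrite bump_wtE mulr_gt0 ?subr_gt0. Qed.

(* The derivatives of [exp (- 1 / w)], [w = (x - c) (d - x)], are all of the form
   [P / w ^ k * exp (- 1 / w)] with [P] a polynomial. *)
Definition bump P k x : R :=
  if c < x < d then P.[x] * W.[x]^-1 ^+ k * expR (- W.[x]^-1) else 0.

(** The numerator over [w^(k+2)] in the derivative of [P / w^k exp (- 1 / w)]. *)
Definition bump_num P k : {poly R} :=
  P^`() * W ^+ 2 - k%:R%:P * P * W^`() * W + P * W^`().

(** From [exp y >= y^(k+2) / (k+2)!] at [y = 1 / w]; the two spare powers leave [w^2]. *)
Lemma bump_decay k (w : R) : 0 < w -> w^-1 ^+ k * expR (- w^-1) <= k.+2`!%:R * w ^+ 2.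
Proof.
move=> w0; have y0 : 0 <= w^-1 by rewrite invr_ge0 ltW.
have := expR_ge1Dxn k.+1 y0; rewrite expRN => H.
have f0 : 0 < k.+2`!%:R :> R by rewrite ltr0n fact_gt0.
have {}H : w^-1 ^+ k.+2 <= k.+2`!%:R * expR w^-1.
  rewrite mulrC -ler_pdivrMr//; apply: le_trans H; first by rewrite lerDr.
rewrite ler_pdivrMr ?expR_gt0// mulrAC -ler_pdivrMr ?exprn_gt0//.
by apply: le_trans H; rewrite -[k.+2]addn2 exprD [w^-1 ^+ 2]exprVn.
Qed.

(** For [x0] outside the interval and [x] inside, [w <= (d - c) |x - x0|], so decay like [w^2]
    becomes quadratic contact at [x0]; in particular the derivative there is [0]. *)
Lemma bump_flat P k x0 : ~~ (c < x0 < d) ->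
  exists2 C : R, 0 <= C & forall x, `|bump P k x| <= C * (x - x0) ^+ 2.
Proof.
move=> x0cd.
have : compact (horner P @` `[c, d]).
  apply: continuous_compact; last exact: segment_compact.
  by apply: continuous_subspaceT => x; exact: continuous_horner.
move=> /compact_bounded[N [_ /(_ (`|N| + 1))]] h.
have {}h x : c <= x <= d -> `|P.[x]| <= `|N| + 1.
  move=> xcd; apply: h; last by exists x => //=; rewrite in_itv.
  by rewrite (le_lt_trans (ler_norm _))// ltrDl.
set B := `|N| + 1 in h.
have B0 : 0 <= B by rewrite addr_ge0.
exists (B * (k.+2`!%:R * (d - c) ^+ 2)); first by rewrite mulr_ge0// mulr_ge0// sqr_ge0.
move=> x; rewrite /bump; case: ifPn => xcd; last first.
  by rewrite normr0 mulr_ge0 ?sqr_ge0// mulr_ge0// mulr_ge0// sqr_ge0.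
have w0 := bump_wt_gt0 xcd; have [cx xd] := andP xcd.
rewrite -mulrA normrM -[leRHS]mulrA ler_pM//; first by apply: h; rewrite !ltW.
rewrite ger0_norm; last by rewrite mulr_ge0 ?expR_ge0// exprn_ge0// invr_ge0 ltW.
apply: (le_trans (bump_decay k w0)); rewrite -mulrA ler_wpM2l// -exprMn.
rewrite -[leRHS]real_normK ?num_real// lerXn2r ?nnegrE// ?(ltW w0)//.
rewrite bump_wtE normrM (gtr0_norm (_ : 0 < d - c)) ?subr_gt0//.
have [x0c|x0c] := leP x0 c.
  rewrite ger0_norm; last by lra.
  have : 0 <= (d - c) * (c - x0) by rewrite mulr_ge0// subr_ge0// ltW.
  by have := sqr_ge0 (x - c); lra.
have dx0 : d <= x0 by move: x0cd; rewrite x0c/= -leNgt.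
rewrite ler0_norm; last by lra.
have : 0 <= (d - c) * (x0 - d) by rewrite mulr_ge0// subr_ge0// ltW.
by have := sqr_ge0 (d - x); lra.
Qed.

Lemma is_derive_horner P x : is_derive x 1 (horner P) P^`().[x].
Proof.
by apply: DeriveDef; [exact: derivable_horner|rewrite derivE derive1E].
Qed.

Lemma is_derive_bump P k x :
  is_derive x 1 (bump P k) (bump (bump_num P k) k.+2 x).
Proof.
have [xcd|xcd] := boolP (c < x < d); last first.
  have [C C0 hC] := bump_flat P k xcd.
  rewrite /bump (negPf xcd) -/(bump P k); apply/is_derive_epsP => eps eps0.
  exists (eps / (C + 1)); first by rewrite divr_gt0// ltr_wpDl.
  move=> h; rewrite ltr_pdivlMr ?ltr_wpDl// => hlt.
  have -> : bump P k x = 0 by rewrite /bump (negPf xcd).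
  rewrite mul0r !subr0 (le_trans (hC _))// (addrC x) addrK.
  rewrite -[h ^+ 2]ger0_norm ?sqr_ge0// normrX expr2 mulrA ler_wpM2r//.
  by have := normr_ge0 h; lra.
have w0 := bump_wt_gt0 xcd; have wN : W.[x] != 0 by rewrite gt_eqF.
have dP := is_derive_horner P x; have dW := is_derive_horner W x.
have dV := is_deriveV wN dW.
have dVk := is_deriveX k dV.
have dN : is_derive x 1 (fun y => - W.[y]^-1) (- (- W.[x] ^- 2 *: W^`().[x])).
  exact: is_deriveN dV.
have dE := is_derive1_comp (is_derive_expR _) dN.
have D := is_deriveM (is_deriveM dP dVk) dE.
have [cx xd] := andP xcd.
have e0 : 0 < Num.min (x - c) (d - x) by rewrite lt_min !subr_gt0 cx.
apply: (is_derive_near e0 (e := (horner P * (fun y => W.[y]^-1) ^+ k) *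
  (expR \o (fun y => - W.[y]^-1)))).
  move=> h; rewrite lt_min !ltr_norml => /andP[/andP[? ?] /andP[? ?]].
  rewrite /bump (_ : c < x + h < d) ?lexx//; last by apply/andP; split; lra.
  rewrite -[LHS]/(P.[x + h] * ((fun y => W.[y]^-1) ^+ k) (x + h) *
    expR (- W.[x + h]^-1)).
  by rewrite exprfctE.
apply: is_derive_eq D _.
rewrite /bump xcd exprfctE.
have -> : (bump_num P k).[x] =
    P^`().[x] * W.[x] ^+ 2 - k%:R * P.[x] * W^`().[x] * W.[x] + P.[x] * W^`().[x].
  by rewrite /bump_num !(hornerD, hornerN, hornerM, hornerC, horner_exp).
rewrite -[LHS]/(P.[x] * W.[x]^-1 ^+ k *
    (expR (- W.[x]^-1) * - (- W.[x] ^- 2 * W^`().[x])) +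
  expR (- W.[x]^-1) * (P.[x] * ((k%:R * W.[x]^-1 ^+ k.-1) *
    (- W.[x] ^- 2 * W^`().[x])) + W.[x]^-1 ^+ k * P^`().[x])).
move: (W.[x]) (W^`().[x]) (P.[x]) (P^`().[x]) wN => w w' p p' wN.
move: (expR _) => E.
(* The power rule has exponent [k.-1], which is truncated at [k = 0]. *)
case: k {dVk} => [|k]; first by rewrite !expr0 -[2%N in LHS]/(1.+1)%N; field.
rewrite /= !exprVn !exprS; have : w ^+ k != 0 by rewrite expf_neq0.
by move: (w ^+ k) => z zN; field; rewrite ?wN ?zN.
Qed.

Fixpoint bump_seq n : {poly R} * nat :=
  if n is n'.+1 then (bump_num (bump_seq n').1 (bump_seq n').2, (bump_seq n').2.+2)
  else (1, 0%N).

Definition bump_n n := bump (bump_seq n).1 (bump_seq n).2.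

Lemma is_derive_bump_n n x : is_derive x 1 (bump_n n) (bump_n n.+1 x).
Proof. exact: is_derive_bump. Qed.

Lemma bump0_gt0 x : c < x < d -> 0 < bump_n 0 x.
Proof.
by move=> xcd; rewrite /bump_n /bump xcd /= hornerC expr0 !mul1r expR_gt0.
Qed.

Lemma bump0_out x : ~~ (c < x < d) -> bump_n 0 x = 0.
Proof. by move=> /negPf xcd; rewrite /bump_n /bump xcd. Qed.

Lemma bump0_ge0 x : 0 <= bump_n 0 x.
Proof.
by have [/bump0_gt0/ltW//|/bump0_out ->] := boolP (c < x < d).
Qed.

End Bump1.

(** * A bump in the plane as a product of one-dimensional ones *)

Section Bump2.
Variables (R : realType) (Om : set (R * R)).
Hypotheses (Om_open : open Om) (Om_bdd : bounded_set Om) (Om_ne : Om !=set0).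
Let mOm : measurable_for (lebesgue2 R) Om := open2_measurable Om_open.

Lemma derive_dir1 (f : R * R -> R) (p : R * R) (l : R) :
  is_derive p.1 1 (fun s => f (s, p.2)) l ->
  derivable f p (dir R true) /\ 'D_(dir R true) f p = l.
Proof.
case: p => x y /= [].
have E : (fun h : R => h^-1 *: (((fun s => f (s, y)) \o shift x) (h *: 1) - f (x, y))) =
         (fun h : R => h^-1 *: ((f \o shift (x, y)) (h *: dir R true) - f (x, y))).
  apply/funext => h /=; congr (_ *: (f _ - _)).
  by apply: injective_projections; rewrite /= ?scaler0 ?add0r.
by rewrite /derivable /derive E.
Qed.

Lemma derive_dir2 (f : R * R -> R) (p : R * R) (l : R) :
  is_derive p.2 1 (fun s => f (p.1, s)) l ->
  derivable f p (dir R false) /\ 'D_(dir R false) f p = l.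
Proof.
case: p => x y /= [].
have E : (fun h : R => h^-1 *: (((fun s => f (x, s)) \o shift y) (h *: 1) - f (x, y))) =
         (fun h : R => h^-1 *: ((f \o shift (x, y)) (h *: dir R false) - f (x, y))).
  apply/funext => h /=; congr (_ *: (f _ - _)).
  by apply: injective_projections; rewrite /= ?scaler0 ?add0r.
by rewrite /derivable /derive E.
Qed.

(** The derivative along [l] depends only on how often each direction occurs in [l]. *)
Lemma smooth2_prod (G1 G2 : nat -> R -> R) :
  (forall n (x : R), is_derive x 1 (G1 n) (G1 n.+1 x)) ->
  (forall n (x : R), is_derive x 1 (G2 n) (G2 n.+1 x)) ->
  smooth2 (fun p => G1 0%N p.1 * G2 0%N p.2).
Proof.
move=> d1 d2.
have key i j (b : bool) (p : R * R) :
    derivable (fun p => G1 i p.1 * G2 j p.2) p (dir R b) /\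
    'D_(dir R b) (fun p => G1 i p.1 * G2 j p.2) p =
      G1 (i + b)%N p.1 * G2 (j + ~~ b)%N p.2.
  case: b; rewrite ?addn1 ?addn0.
    apply: derive_dir1; rewrite mulrC.
    rewrite (_ : (fun s => _) = (G2 j p.2 \*: G1 i)); last first.
      by apply/funext => s; rewrite /= mulrC.
    exact: (is_deriveZ (G2 j p.2) (d1 i p.1)).
  apply: derive_dir2.
  exact: (is_deriveZ (G1 i p.1) (d2 j p.2)).
have PE l : pderiv l (fun p => G1 0%N p.1 * G2 0%N p.2) =
    (fun p => G1 (count id l) p.1 * G2 (count negb l) p.2).
  elim: l => //= b l ->; apply/funext => p.
  by rewrite (key _ _ b p).2 addnC [X in G2 X]addnC.
have cont (G : nat -> R -> R) : (forall n (x : R), is_derive x 1 (G n) (G n.+1 x)) ->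
    forall n, continuous (G n).
  move=> dG n x; apply: differentiable_continuous; apply/derivable1_diffP.
  by case: (dG n x).
move=> l; rewrite PE; split=> [p|b p]; last exact: (key _ _ b p).1.
apply: cvgM.
  apply: (@continuous_comp _ _ _ fst (G1 _)); last exact: cont.
  exact: cvg_fst.
apply: (@continuous_comp _ _ _ snd (G2 _)); last exact: cont.
exact: cvg_snd.
Qed.

Lemma bump_exists : exists phi, test_fun Om phi /\
  0 < \int[lebesgue2 R]_(x in Om) phi x.
Proof.
have [p0 Op0] := Om_ne.
have /nbhs_ballP[r/= r0 rOm] : nbhs p0 Om by exact: open_nbhs_nbhs (conj Om_open Op0).
pose c1 := p0.1 - r / 2; pose d1 := p0.1 + r / 2.
pose c2 := p0.2 - r / 2; pose d2 := p0.2 + r / 2.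
have cd1 : c1 < d1 by rewrite /c1 /d1; lra.
have cd2 : c2 < d2 by rewrite /c2 /d2; lra.
pose phi (p : R * R) := bump_n c1 d1 0 p.1 * bump_n c2 d2 0 p.2.
have sphi : smooth2 phi.
  by apply: smooth2_prod => n x; exact: is_derive_bump_n.
have phi0 p : 0 <= phi p by rewrite mulr_ge0// bump0_ge0.
pose K := `[c1, d1]%classic `*` `[c2, d2]%classic : set (R * R).
have KO : K `<=` Om.
  move=> [x y] [/=]; rewrite !in_itv/= /c1 /d1 /c2 /d2 => /andP[? ?] /andP[? ?].
  by apply: rOm; split; rewrite /ball/= ltr_norml; apply/andP; split; lra.
have tphi : test_fun Om phi.
  split=> //; exists K; split; first by apply: compact_setX; exact: segment_compact.
  split=> // -[x y] Kxy; rewrite /phi/=; apply/eqP; rewrite mulf_eq0.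
  apply/orP; have [xK|xK] := boolP (c1 < x < d1); last by left; rewrite bump0_out.
  have [yK|yK] := boolP (c2 < y < d2); last by right; rewrite bump0_out.
  exfalso; apply: Kxy; move: xK yK => /andP[? ?] /andP[? ?].
  by split; rewrite /= in_itv/= !ltW.
exists phi; split=> //; rewrite lt_neqAle Rintegral_ge0 ?andbT//.
apply/eqP => I0.
have Ofin : (lebesgue2 R Om < +oo)%E := leb2_bounded_lty mOm Om_bdd.
have L1phi := L2_L1 mOm Ofin (L2_test Om_open Om_bdd tphi).
have mphi : measurable_fun Om (EFin \o phi).
  by apply/measurable_EFinP; exact: L1_measurable L1phi.
(* A nonnegative function of integral zero vanishes almost everywhere, yet [phi] is positive on the
   rectangle [U] of positive measure. *)
have : ae_eq (lebesgue2 R) Om (EFin \o phi) (cst 0%E).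
  apply/(ae_eq_integral_abs _ mOm mphi).
  transitivity (\int[lebesgue2 R]_(x in Om) (phi x)%:E)%E.
    by apply: eq_integral => x _; rewrite gee0_abs// lee_fin.
  by rewrite (I_fin mOm)// -I0.
move=> [N [mN N0 HN]].
pose U := `]c1, d1[%classic `*` `]c2, d2[%classic : set (R * R).
have UN : U `<=` N.
  move=> [x y] [/=]; rewrite !in_itv/= => xU yU; apply: HN => /= H.
  have : phi (x, y) = 0.
    suff /H[] : Om (x, y) by [].
    apply: KO; move: xU yU => /andP[? ?] /andP[? ?].
    by split; rewrite /= in_itv/= !ltW.
  apply/eqP; rewrite gt_eqF// mulr_gt0//; exact: bump0_gt0.
have mU : measurable_for (lebesgue2 R) U.
  by apply: measurableX; exact: measurable_itv.
have U0 : (lebesgue2 R U <= 0)%E by rewrite -N0; apply: le_measure; rewrite ?inE.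
have UE : lebesgue2 R U = ((d1 - c1)%:E * (d2 - c2)%:E)%E.
  have li (c d : R) : c < d -> lebesgue_measure (`]c, d[%classic : set R) = (d - c)%:E.
    by move=> cd; rewrite lebesgue_measure_itv/= lte_fin cd EFinB.
  by rewrite -li// -li//; apply: product_measure1E; exact: measurable_itv.
move: U0; rewrite UE -EFinM lee_fin leNgt mulr_gt0// subr_gt0//.
Qed.

End Bump2.

(** * The energy *)

Section ExpInequalities.
Variable R : realType.
Implicit Types p q k : R.

Lemma expR_sub_le p q : expR p - expR q <= expR p * (p - q).
Proof.
have := expR_ge1Dx (q - p); rewrite expRD expRN => H.
have p0 := expR_gt0 p.
have : expR p * (1 + (q - p)) <= expR q.
  by rewrite -ler_pdivlMl// mulrC.
by lra.
Qed.

Lemma expR_mid_ge p q : 2 * expR p <= expR (p + q) + expR (p - q).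
Proof. by have := expR_sub_le p (p + q); have := expR_sub_le p (p - q); lra. Qed.

(** With [x = exp (p / 2)] and [y = exp (q / 2)] the left side is [(x - y)^2], and for [q <= p]
    convexity gives [x - y <= x (p - q) / 2]. *)
Lemma expR_mid_le p q :
  expR p + expR q - 2 * expR (2^-1 * (p + q)) <=
  (2^-1 * (p - q)) ^+ 2 * (expR p + expR q).
Proof.
wlog qp : p q / q <= p.
  move=> H; have [/H//|/ltW/H] := leP q p.
  rewrite (addrC q p) (addrC (expR q)) => /le_trans; apply.
  by rewrite le_eqVlt; apply/orP; left; apply/eqP; ring.
have half (x : R) : expR x = expR (2^-1 * x) ^+ 2.
  by rewrite -expRM_natl; congr expR; rewrite -mulr_natl; field.
have -> : expR (2^-1 * (p + q)) = expR (2^-1 * p) * expR (2^-1 * q).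
  by rewrite -expRD; congr expR; ring.
rewrite (half p) (half q).
have h1 := expR_sub_le (2^-1 * p) (2^-1 * q).
have h0 : expR (2^-1 * q) <= expR (2^-1 * p) by rewrite ler_expR; lra.
have p0 := expR_gt0 (2^-1 * p); have q0 := expR_gt0 (2^-1 * q).
move: h1 h0 p0 q0; set x := expR _; set y := expR _ => h1 h0 p0 q0.
have -> : x ^+ 2 + y ^+ 2 - 2 * (x * y) = (x - y) ^+ 2 by ring.
apply: (@le_trans _ _ ((x * (2^-1 * p - 2^-1 * q)) ^+ 2)).
  by rewrite lerXn2r// nnegrE; lra.
rewrite exprMn mulrC (_ : 2^-1 * p - 2^-1 * q = 2^-1 * (p - q)); last by ring.
by rewrite ler_wpM2l ?sqr_ge0// lerDl sqr_ge0.
Qed.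

(** Truncation at [k] makes the exponential Lipschitz from above, so convergence in the mean is
    enough to control it. *)
Lemma expR_trunc_le p q k :
  expR (2 * Num.min p k) <= expR (2 * q) + 2 * expR (2 * k) * `|p - q|.
Proof.
have h := expR_sub_le (2 * Num.min p k) (2 * Num.min q k).
have hq : expR (2 * Num.min q k) <= expR (2 * q).
  by rewrite ler_expR ler_pM2l// ge_min lexx.
have hk : expR (2 * Num.min p k) <= expR (2 * k).
  by rewrite ler_expR ler_pM2l// ge_min lexx orbT.
have hm : Num.min p k - Num.min q k <= `|p - q|.
  have := ler_norm (p - q); have := normr_ge0 (p - q).
  by rewrite !minEle; case: ifPn; case: ifPn; rewrite -?ltNge => *; lra.
have e0 := expR_gt0 (2 * Num.min p k); have n0 := normr_ge0 (p - q).
move: h hq hk hm e0 n0.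
move: (expR (2 * Num.min p k)) (expR (2 * Num.min q k)) (expR (2 * q)) (expR (2 * k)) `|p - q|.
move: (Num.min p k) (Num.min q k) => mp mq ep eq e2q ek n h hq hk hm e0 n0.
have h1 : ep * (2 * mp - 2 * mq) <= ep * (2 * n) by rewrite ler_pM2l//; lra.
have h2 : ep * (2 * n) <= ek * (2 * n) by rewrite ler_wpM2r// mulr_ge0.
by lra.
Qed.

Lemma expR_le1D p : expR p <= 1 + expR (2 * p).
Proof.
have -> : expR (2 * p) = expR p ^+ 2 by rewrite -expRM_natl mulr_natl.
by have := sqr_ge0 (expR p - 1); have := expR_gt0 p; lra.
Qed.

End ExpInequalities.

(** * Gradient fields and continuity of the anisotropic term *)

Section Energy.
Variables (R : realType) (F : R * R -> R) (a b : R) (Om : set (R * R)).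
Hypotheses (F_ge0 : forall x, 0 <= F x) (F_cont : continuous F)
  (F_sub : forall x y, F (x + y) <= F x + F y)
  (F_sqr_bounds : forall x, a ^+ 2 * sqn x <= F x ^+ 2 <= b ^+ 2 * sqn x)
  (Om_open : open Om) (Om_bdd : bounded_set Om).
Let mOm : measurable_for (lebesgue2 R) Om := open2_measurable Om_open.
Let Omfin : (lebesgue2 R Om < +oo)%E := leb2_bounded_lty mOm Om_bdd.
Local Notation mu := (lebesgue2 R).
Local Notation I f := (\int[mu]_(x in Om) f x).
Local Notation L1 f := (mu.-integrable Om (EFin \o f)).
Local Notation L2 f := (L2 mu Om f).
Local Notation M := (fine (mu Om)).
Local Notation dirichlet := (dirichlet Om).
Implicit Types (phi psi u v f h : R * R -> R) (G H : R * R -> R * R).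

Definition L2v G := L2 (fun x => (G x).1) /\ L2 (fun x => (G x).2).

Definition vnorm2 G := I (fun x => sqn (G x)).

Lemma M_ge0 : 0 <= M. Proof. exact: fine_ge0. Qed.

Lemma L2v_sqn G : L2v G -> L1 (fun x => sqn (G x)).
Proof. by move=> [[_ g1] [_ g2]]; apply: L1_add. Qed.

Lemma L2v_lin G H (t : R) : L2v G -> L2v H -> L2v (fun x => G x + t *: H x).
Proof.
by move=> [g1 g2] [h1 h2]; split; apply: L2_add => //; apply: L2_scale.
Qed.

Lemma L2v_sub G H : L2v G -> L2v H -> L2v (fun x => G x - H x).
Proof. by move=> [g1 g2] [h1 h2]; split; apply: L2_sub. Qed.

Lemma L2v_grad phi : test_fun Om phi -> L2v (grad2 phi).
Proof. by move=> t; split; apply: L2_pderiv. Qed.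

Lemma L1_F G : L2v G -> L1 (fun x => F (G x) ^+ 2).
Proof.
move=> g2; have [[mg1 _] [mg2 _]] := g2.
apply: (L1_le mOm (g := fun x => b ^+ 2 * sqn (G x))).
- apply: measurable_funX.
  have := measurable_fun_comp2 mOm F_cont mg1 mg2.
  by apply: eq_measurable_fun => x _; rewrite -surjective_pairing.
- by apply: L1_scale => //; exact: L2v_sqn.
- by move=> x _; rewrite ger0_norm ?sqr_ge0//; have /andP[] := F_sqr_bounds (G x).
Qed.

Lemma vnorm2_ge0 G : 0 <= vnorm2 G.
Proof. by apply: Rintegral_ge0 => x _; exact: sqn_ge0. Qed.

Lemma I_F_le G : L2v G -> I (fun x => F (G x) ^+ 2) <= b ^+ 2 * vnorm2 G.
Proof.
move=> g2; rewrite -(RintegralZl _ mOm); last exact: L2v_sqn.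
apply: (I_le mOm); [exact: L1_F|by apply: L1_scale => //; exact: L2v_sqn|].
by move=> x _; have /andP[] := F_sqr_bounds (G x).
Qed.

Lemma I_F_ge G : L2v G -> a ^+ 2 * vnorm2 G <= I (fun x => F (G x) ^+ 2).
Proof.
move=> g2; rewrite -(RintegralZl _ mOm); last exact: L2v_sqn.
apply: (I_le mOm); [by apply: L1_scale => //; exact: L2v_sqn|exact: L1_F|].
by move=> x _; have /andP[] := F_sqr_bounds (G x).
Qed.

(** The threshold [d] is uniform in [f]. Young's inequality with weight [e / (B + 1)] leaves at most
    [e / 2] for each factor. *)
Lemma I_small_prod (B e : R) : 0 <= B -> 0 < e -> exists2 d : R, 0 < d &
  forall f h, L2 f -> L2 h -> I (fun x => f x ^+ 2) <= B ->
    I (fun x => h x ^+ 2) <= d -> I (fun x => f x * h x) <= e.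
Proof.
move=> B0 e0; have B1 : 0 < B + 1 by rewrite ltr_wpDl.
pose s := e / (B + 1); have s0 : 0 < s by rewrite divr_gt0.
exists (e * s); first by rewrite mulr_gt0.
move=> f h f2 h2 fB hd; apply: (le_trans (I_young mOm f2 h2 s0)).
apply: (@le_trans _ _ (s / 2 * B + s^-1 / 2 * (e * s))).
  by apply: lerD; rewrite ler_wpM2l// divr_ge0// ?invr_ge0 ltW.
have -> : s^-1 / 2 * (e * s) = e / 2 by field; rewrite gt_eqF.
have : s * B <= e by rewrite /s mulrAC ler_pdivrMr// ler_pM2l// lerDl.
by lra.
Qed.

(** One-sided but uniform over bounded [H], so that exchanging the two fields gives continuity. It
    rests on [F G <= F H + F (G - H)] and Young's inequality for the square. *)
Lemma I_F_usc (B e : R) : 0 <= B -> 0 < e -> exists2 d : R, 0 < d &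
  forall G H, L2v G -> L2v H -> vnorm2 H <= B ->
    vnorm2 (fun x => G x - H x) <= d ->
    I (fun x => F (G x) ^+ 2) <= I (fun x => F (H x) ^+ 2) + e.
Proof.
move=> B0 e0; have b2 := sqr_ge0 b.
have K1 : 0 < b ^+ 2 * B + 1 by rewrite ltr_wpDl// mulr_ge0.
pose t := e / 2 / (b ^+ 2 * B + 1); have t0 : 0 < t by rewrite !divr_gt0.
have c0 : 0 < (1 + t^-1) * b ^+ 2 + 1.
  by rewrite ltr_wpDl// mulr_ge0// addr_ge0// invr_ge0 ltW.
exists (e / 2 / ((1 + t^-1) * b ^+ 2 + 1)); first by rewrite !divr_gt0.
move=> G H g2 h2 HB GH; have gh2 := L2v_sub g2 h2.
have iG := L1_F g2; have iH := L1_F h2; have iD := L1_F gh2.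
have i1 := L1_scale mOm t iH; have i2 := L1_scale mOm (1 + t^-1) iD.
apply: (@le_trans _ _ (I (fun x => F (H x) ^+ 2 +
    (t * F (H x) ^+ 2 + (1 + t^-1) * F (G x - H x) ^+ 2)))).
  apply: (I_le mOm) => //; first by apply: L1_add => //; exact: L1_add.
  move=> x _; apply: sqr_sub_young => //.
  by have := F_sub (H x) (G x - H x); rewrite addrC subrK addrC.
rewrite (RintegralD mOm)//; last exact: L1_add.
rewrite lerD2l (RintegralD mOm)// !(RintegralZl _ mOm)//.
have h1 : t * I (fun x => F (H x) ^+ 2) <= e / 2.
  apply: (@le_trans _ _ (t * (b ^+ 2 * B))).
    by rewrite ler_pM2l// (le_trans (I_F_le h2))// ler_wpM2l.
  by rewrite /t mulrAC ler_pdivrMr// ler_wpM2l ?lerDl// divr_ge0// ltW.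
have h3 : (1 + t^-1) * I (fun x => F (G x - H x) ^+ 2) <= e / 2.
  apply: (@le_trans _ _ ((1 + t^-1) * (b ^+ 2 * vnorm2 (fun x => G x - H x)))).
    by rewrite ler_wpM2l ?I_F_le// addr_ge0// invr_ge0 ltW.
  rewrite mulrA; apply: (@le_trans _ _ (((1 + t^-1) * b ^+ 2 + 1) * vnorm2 (fun x => G x - H x))).
    by rewrite ler_wpM2r ?vnorm2_ge0// lerDl.
  by rewrite mulrC -ler_pdivlMr.
by lra.
Qed.

End Energy.

(** * Limits of test functions and passage to the limit in the energy *)

Section Approximation.
Variables (R : realType) (F : R * R -> R) (a b : R) (Om : set (R * R)).
Hypotheses (F_ge0 : forall x, 0 <= F x) (F_cont : continuous F)
  (F_sub : forall x y, F (x + y) <= F x + F y)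
  (F_sqr_bounds : forall x, a ^+ 2 * sqn x <= F x ^+ 2 <= b ^+ 2 * sqn x)
  (Om_open : open Om) (Om_bdd : bounded_set Om).
Let mOm : measurable_for (lebesgue2 R) Om := open2_measurable Om_open.
Let Omfin : (lebesgue2 R Om < +oo)%E := leb2_bounded_lty mOm Om_bdd.
Local Notation mu := (lebesgue2 R).
Local Notation I f := (\int[mu]_(x in Om) f x).
Local Notation L1 f := (mu.-integrable Om (EFin \o f)).
Local Notation L2 f := (L2 mu Om f).
Local Notation M := (fine (mu Om)).
Local Notation dirichlet := (dirichlet Om).
Implicit Types (phi u v f h : R * R -> R) (G H : R * R -> R * R).

Local Notation L2v G := (L2v Om G).
Local Notation vnorm2 G := (vnorm2 Om G).

Lemma energyE lam u G : energy F lam Om u G =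
  2^-1 * I (fun x => F (G x) ^+ 2) - lam * I (fun x => expR (u x)).
Proof. by []. Qed.

(** Membership in [W012] with its sequence named, in terms of real integrals: square integrability
    of the limits makes these finite. *)
Definition approx (psi : nat -> R * R -> R) v H :=
  [/\ forall n, test_fun Om (psi n), L2 v, L2v H &
  forall e : R, 0 < e -> exists N, forall n, (N <= n)%N ->
    I (fun x => (psi n x - v x) ^+ 2) <= e /\
    vnorm2 (fun x => grad2 (psi n) x - H x) <= e].

Lemma cvg0_eps (s : nat -> \bar R) : s @ \oo --> 0%E -> forall e : R, 0 < e ->
  exists N, forall n, (N <= n)%N -> (s n <= e%:E)%E.
Proof.
move=> /fine_cvgP[[N1 _ h1] /cvgrPdist_le h2] e e0.
have [N2 _ hN2] := h2 e e0; exists (maxn N1 N2) => n; rewrite geq_max => /andP[n1 n2].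
rewrite -(fineK (h1 _ n1)) lee_fin; have := hN2 _ n2; rewrite sub0r normrN /=.
by apply: le_trans; exact: ler_norm.
Qed.

Lemma eps_cvg0 (s : nat -> \bar R) : (forall n, 0 <= s n)%E ->
  (forall e : R, 0 < e -> exists N, forall n, (N <= n)%N -> (s n <= e%:E)%E) ->
  s @ \oo --> 0%E.
Proof.
move=> s0 H; have [N1 hN1] := H 1 ltr01.
have sfin n : (N1 <= n)%N -> s n \is a fin_num.
  by move=> /hN1 h; rewrite ge0_fin_numE// (le_lt_trans h)// ltry.
apply/fine_cvgP; split; first by exists N1.
apply/cvgrPdist_le => e e0; have [N hN] := H e e0.
exists (maxn N1 N) => // n /=; rewrite geq_max => /andP[n1 n2].
rewrite sub0r normrN ger0_norm ?fine_ge0// -lee_fin fineK ?sfin//; exact: hN.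
Qed.

Lemma W012_approx u G : W012 Om u G -> exists psi, approx psi u G.
Proof.
move=> [mu_ [mG1 [mG2 [psi [tpsi [c1 c2]]]]]].
have mg n c : measurable_fun Om (pderiv [:: c] (psi n)).
  by have [] := L2_pderiv Om_open Om_bdd c (tpsi n).
have mp n : measurable_fun Om (psi n).
  by have [] := L2_test Om_open Om_bdd (tpsi n).
have m1 n : measurable_fun Om (fun x => (psi n x - u x) ^+ 2).
  by apply: measurable_funX; exact: measurable_funB.
have mq1 n : measurable_fun Om (fun x => ((grad2 (psi n) x).1 - (G x).1) ^+ 2).
  by apply: measurable_funX; apply: measurable_funB => //; exact: mg.
have mq2 n : measurable_fun Om (fun x => ((grad2 (psi n) x).2 - (G x).2) ^+ 2).
  by apply: measurable_funX; apply: measurable_funB => //; exact: mg.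
have m2 n := measurable_funD (mq1 n) (mq2 n).
have z1 n (x : R * R) : Om x -> 0 <= (psi n x - u x) ^+ 2 by rewrite sqr_ge0.
have z2 n (x : R * R) : Om x -> 0 <= ((grad2 (psi n) x).1 - (G x).1) ^+ 2
                  + ((grad2 (psi n) x).2 - (G x).2) ^+ 2.
  by rewrite addr_ge0 ?sqr_ge0.
have e1 := cvg0_eps c1; have e2 := cvg0_eps c2.
(* One approximant at distance at most [1] shows that the limit is square integrable, as
   [u = psi - (psi - u)]. *)
have [N1 /(_ N1 (leqnn _)) hN1] := e1 1 ltr01.
have [N2 /(_ N2 (leqnn _)) hN2] := e2 1 ltr01.
have L2u : L2 u.
  have d2 : L2 (fun x => psi N1 x - u x).
    by split; [exact: (measurable_funB (mp N1) mu_)|exact: (L1_lint mOm (m1 N1) (z1 N1) hN1).1].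
  have := L2_sub mOm (L2_test Om_open Om_bdd (tpsi N1)) d2.
  by apply: (L2_eq mOm) => x _; rewrite opprB addrC subrK.
have i2 := (L1_lint mOm (m2 N2) (z2 N2) hN2).1.
have [gd1 gd2] := L2v_grad Om_open Om_bdd (tpsi N2).
have L2G1 : L2 (fun x => (G x).1).
  have d2 : L2 (fun x => (grad2 (psi N2) x).1 - (G x).1).
    split; first exact: (measurable_funB (mg N2 true) mG1).
    apply: (L1_le mOm (mq1 N2) i2) => x _; rewrite ger0_norm ?sqr_ge0//= lerDl.
    exact: sqr_ge0.
  have := L2_sub mOm gd1 d2.
  by apply: (L2_eq mOm) => x _; rewrite opprB addrC subrK.
have L2G2 : L2 (fun x => (G x).2).
  have d2 : L2 (fun x => (grad2 (psi N2) x).2 - (G x).2).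
    split; first exact: (measurable_funB (mg N2 false) mG2).
    apply: (L1_le mOm (mq2 N2) i2) => x _; rewrite ger0_norm ?sqr_ge0//= lerDr.
    exact: sqr_ge0.
  have := L2_sub mOm gd2 d2.
  by apply: (L2_eq mOm) => x _; rewrite opprB addrC subrK.
exists psi; split=> // e e0.
have [N hN] := e1 e e0; have [N' hN'] := e2 e e0.
exists (maxn N N') => n; rewrite geq_max => /andP[n1 n2]; split.
  exact: (L1_lint mOm (m1 n) (z1 n) (hN _ n1)).2.
exact: (L1_lint mOm (m2 n) (z2 n) (hN' _ n2)).2.
Qed.

Lemma approx_W012 (psi : nat -> R * R -> R) u G : approx psi u G -> W012 Om u G.
Proof.
move=> [tpsi u2 g2 H]; have [g21 g22] := g2.
split; first exact: L2_measurable u2.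
split; first exact: L2_measurable g21.
split; first exact: L2_measurable g22.
exists psi; split=> //; split; apply: eps_cvg0 => [n|e /H[N hN]].
- by apply: integral_ge0 => x _; rewrite lee_fin sqr_ge0.
- exists N => n /hN[h _]; rewrite (I_fin mOm) ?lee_fin//.
  by apply: L2_sqr; apply: L2_sub => //; exact: L2_test.
- by apply: integral_ge0 => x _; rewrite lee_fin addr_ge0 ?sqr_ge0.
- exists N => n /hN[_ h].
  rewrite (I_fin mOm (f := fun x => sqn (grad2 (psi n) x - G x))) ?lee_fin//.
  by apply: L2v_sqn => //; apply: L2v_sub => //; exact: L2v_grad.
Qed.

Section LimitEnergy.
Variables (psi : nat -> R * R -> R) (v : R * R -> R) (H : R * R -> R * R) (N0 : nat).
Hypotheses (app : approx psi v H)
  (ball_psi : forall n, (N0 <= n)%N -> dirichlet (psi n) <= 4^-1).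

(** The bound first passes to the limit for the exponential truncated at [k], by square-mean
    convergence, then for [k] to infinity by Fatou's lemma. The ball condition is asked from [N0] on
    because perturbed sequences enter the ball only eventually. *)
Lemma approx_exp2 : L1 (fun x => expR (2 * v x)) /\ I (fun x => expR (2 * v x)) <= 4 * M.
Proof.
have [tpsi v2 H2 cpsi] := app; have mv := L2_measurable v2.
have mtr (k : R) : measurable_fun Om (fun x => expR (2 * Num.min (v x) k)).
  apply: measurableT_comp => //; apply: measurable_funM => //.
  exact: measurable_minr.
have itr (k : R) : L1 (fun x => expR (2 * Num.min (v x) k)).
  apply: (L1_bdd mOm Omfin (r := expR (2 * k)) (mtr k)) => x _.
  by rewrite ger0_norm ?expR_ge0// ler_expR ler_pM2l// ge_min lexx orbT.
have bnd (k : R) : I (fun x => expR (2 * Num.min (v x) k)) <= 4 * M.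
  apply/ler_addgt0Pr => e e0.
  have k0 := expR_gt0 (2 * k).
  have e'0 : 0 < e / (2 * expR (2 * k)) by rewrite divr_gt0// mulr_gt0.
  have [d d0 hd] := I_small_prod Om_open (M_ge0 Om) e'0.
  have [N hN] := cpsi d d0.
  pose n := maxn N0 N.
  have hn : (N0 <= n)%N by rewrite leq_maxl.
  have [hI _] := hN n (leq_maxr _ _).
  have dv2 : L2 (fun x => v x - psi n x) by apply: L2_sub => //; exact: L2_test.
  have ad2 := L2_abs mOm dv2.
  have hab : I (fun x => `|v x - psi n x|) <= e / (2 * expR (2 * k)).
    have -> : I (fun x => `|v x - psi n x|) = I (fun x => 1 * `|v x - psi n x|).
      by apply: I_eq => x _; rewrite mul1r.
    apply: (hd (fun=> 1)) => //; first exact: L2_cst.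
      by rewrite (I_cst _ mOm) expr1n mul1r.
    apply: le_trans hI; rewrite le_eqVlt; apply/orP; left; apply/eqP.
    by apply: I_eq => x _; rewrite real_normK ?num_real// -sqrrN opprB.
  have ie : L1 (fun x => expR (2 * psi n x)).
    have ce : continuous (fun x : R => expR x) by exact: continuous_expR.
    have := L2_sqr (L2_comp_test Om_open Om_bdd (tpsi n) ce).
    by apply: (L1_eq mOm) => x _; rewrite /= -expRM_natl mulr_natl.
  have ia := L1_scale mOm (2 * expR (2 * k)) (L2_L1 mOm Omfin ad2).
  apply: (@le_trans _ _ (I (fun x => expR (2 * psi n x) +
      2 * expR (2 * k) * `|v x - psi n x|))).
    by apply: (I_le mOm) => //; [exact: L1_add|move=> x _; exact: expR_trunc_le].
  rewrite (RintegralD mOm)// (RintegralZl _ mOm)//; last exact: L2_L1.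
  apply: lerD; first by apply: exp_bound => //; exact: ball_psi.
  by rewrite mulrC -ler_pdivlMr ?mulr_gt0.
apply: (L1_lint mOm) => //.
  by apply: measurableT_comp => //; apply: measurable_funM.
have -> : (\int[mu]_(x in Om) (expR (2 * v x))%:E = \int[mu]_(x in Om) limn_einf
    (fun n : nat => (expR (2 * Num.min (v x) n%:R))%:E))%E.
  apply: eq_integral => x _; apply/esym.
  have /cvg_limn_einf_sup[-> _]// :
    (fun n : nat => (expR (2 * Num.min (v x) n%:R))%:E) @ \oo --> (expR (2 * v x))%:E.
  (* The truncation is inactive once [n] exceeds [|v x|]. *)
  apply: cvg_near_cst; exists (Num.truncn `|v x|).+1 => // n /= hn.
  rewrite min_l// (le_trans (ler_norm _))// ltW//.
  by rewrite (lt_le_trans (truncnS_gt _))// ler_nat.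
apply: (le_trans (fatou mu mOm _ _)).
- by move=> n; apply/measurable_EFinP; exact: mtr.
- by move=> n x _; rewrite lee_fin expR_ge0.
by apply: (limn_einf_ub (N := 0)) => n _; rewrite (I_fin mOm)// lee_fin.
Qed.

Lemma approx_L2_exp : L2 (fun x => expR (v x)).
Proof.
have [_ v2 _ _] := app; split.
  by apply: measurableT_comp => //; exact: L2_measurable v2.
by apply: (L1_eq mOm) approx_exp2.1 => x _; rewrite -expRM_natl mulr_natl.
Qed.

(** From [exp v <= 1 + exp (2 v)], hence [5 = 1 + 4]. *)
Lemma approx_exp_le : I (fun x => expR (v x)) <= 5 * M.
Proof.
have [ie he] := approx_exp2.
apply: (@le_trans _ _ (I (fun x => 1 + expR (2 * v x)))).
  apply: (I_le mOm).
  - exact: (L2_L1 mOm Omfin approx_L2_exp).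
  - by apply: L1_add => //; exact: L1_cst.
  - by move=> x _; exact: expR_le1D.
rewrite (RintegralD mOm)//; last exact: L1_cst.
by rewrite (I_cst _ mOm) mul1r; lra.
Qed.

(** Each one-sided difference of exponentials obeys [exp p - exp q <= exp p (p - q)]: a factor with
    bounded square integral times one that tends to zero in square mean. *)
Lemma approx_energy lam : 0 <= lam -> forall e : R, 0 < e ->
  exists N, forall n, (N <= n)%N ->
    `|energy F lam Om (psi n) (grad2 (psi n)) - energy F lam Om v H| <= e.
Proof.
move=> lam0 e e0; have [tpsi v2 H2 cpsi] := app.
have lam1 : 0 < lam + 1 by rewrite ltr_wpDl.
pose e1 := e / 2 / (lam + 1); have e10 : 0 < e1 by rewrite !divr_gt0.
have M40 : 0 <= 4 * M by rewrite mulr_ge0// M_ge0.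
have [d1 d10 hd1] := I_small_prod Om_open M40 e10.
(* The one-sided estimate is used around [H], of known norm, and around the gradients of [psi n],
   bounded by [1/4]. *)
have [d2 d20 hd2] := I_F_usc F_ge0 F_cont F_sub F_sqr_bounds Om_open (vnorm2_ge0 Om H) e0.
have q0 : 0 <= 4^-1 :> R by rewrite invr_ge0.
have [d3 d30 hd3] := I_F_usc F_ge0 F_cont F_sub F_sqr_bounds Om_open q0 e0.
have [N hN] := cpsi _ d10; have [N' hN'] := cpsi _ d20; have [N'' hN''] := cpsi _ d30.
exists (maxn N0 (maxn N (maxn N' N''))) => n.
rewrite !geq_max => /and4P[n0 n1 n2 n3].
have [h1 _] := hN _ n1; have [_ h2] := hN' _ n2; have [_ h3] := hN'' _ n3.
have g2 := L2v_grad Om_open Om_bdd (tpsi n).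
have A1 := hd2 _ _ g2 H2 (lexx _) h2.
have A2 : I (fun x => F (H x) ^+ 2) <= I (fun x => F (grad2 (psi n) x) ^+ 2) + e.
  apply: hd3 => //; first exact: ball_psi.
  apply: le_trans h3; rewrite le_eqVlt; apply/orP; left; apply/eqP.
  by apply: I_eq => x _; rewrite /sqn /= -sqrrN opprB -[X in _ + X = _]sqrrN opprB.
have ce : continuous (fun x : R => expR x) by exact: continuous_expR.
have ep2 : L2 (fun x => expR (psi n x)) := L2_comp_test Om_open Om_bdd (tpsi n) ce.
have ev2 := approx_L2_exp.
have p2 := L2_test Om_open Om_bdd (tpsi n).
have bp : I (fun x => expR (psi n x) ^+ 2) <= 4 * M.
  apply: le_trans (exp_bound Om_open Om_bdd (tpsi n) (ball_psi n0)).
  rewrite le_eqVlt; apply/orP; left; apply/eqP.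
  by apply: I_eq => x _; rewrite -expRM_natl mulr_natl.
have bv : I (fun x => expR (v x) ^+ 2) <= 4 * M.
  apply: le_trans approx_exp2.2; rewrite le_eqVlt; apply/orP; left; apply/eqP.
  by apply: I_eq => x _; rewrite -expRM_natl mulr_natl.
have dpv := L2_sub mOm p2 v2; have dvp := L2_sub mOm v2 p2.
have B1 : I (fun x => expR (psi n x)) - I (fun x => expR (v x)) <= e1.
  rewrite -(RintegralB mOm); [|exact: L2_L1|exact: L2_L1].
  apply: le_trans (hd1 _ _ ep2 dpv bp h1).
  apply: (I_le mOm); [|exact: L2_mul|move=> x _; exact: expR_sub_le].
  by apply: L1_sub => //; exact: L2_L1.
have B2 : I (fun x => expR (v x)) - I (fun x => expR (psi n x)) <= e1.
  rewrite -(RintegralB mOm); [|exact: L2_L1|exact: L2_L1].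
  have h1' : I (fun x => (v x - psi n x) ^+ 2) <= d1.
    apply: le_trans h1; rewrite le_eqVlt; apply/orP; left; apply/eqP.
    by apply: I_eq => x _; rewrite -sqrrN opprB.
  apply: le_trans (hd1 _ _ ev2 dvp bv h1').
  apply: (I_le mOm); [|exact: L2_mul|move=> x _; exact: expR_sub_le].
  by apply: L1_sub => //; exact: L2_L1.
have le1 : lam * e1 <= e / 2.
  by rewrite /e1 mulrC mulrAC ler_pdivrMr// ler_wpM2l ?lerDl// divr_ge0// ltW.
rewrite !energyE.
move: A1 A2 (ler_wpM2l lam0 B1) (ler_wpM2l lam0 B2); rewrite !mulrBr.
move: (lam * I (fun x => expR (psi n x))) (lam * I (fun x => expR (v x))).
move: (I (fun x => F (H x) ^+ 2)) (I (fun x => F (grad2 (psi n) x) ^+ 2)) le1.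
move: (lam * e1) => z A B le1 P Q A1 A2 B1' B2'.
by rewrite ler_norml; apply/andP; split; lra.
Qed.

End LimitEnergy.
End Approximation.

(** * Strong convexity of the energy on the ball *)

Section Minimization.
Variables (R : realType) (F : R * R -> R) (a b : R) (Om : set (R * R)).
Hypotheses (F_cont : continuous F)
  (F_sqr_bounds : forall x, a ^+ 2 * sqn x <= F x ^+ 2 <= b ^+ 2 * sqn x)
  (Om_open : open Om) (Om_bdd : bounded_set Om).
Let mOm : measurable_for (lebesgue2 R) Om := open2_measurable Om_open.
Let Omfin : (lebesgue2 R Om < +oo)%E := leb2_bounded_lty mOm Om_bdd.
Local Notation mu := (lebesgue2 R).
Local Notation I f := (\int[mu]_(x in Om) f x).
Local Notation L1 f := (mu.-integrable Om (EFin \o f)).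
Local Notation L2 f := (L2 mu Om f).
Local Notation M := (fine (mu Om)).
Local Notation dirichlet := (dirichlet Om).
Implicit Types (phi psi u v f h : R * R -> R) (G H : R * R -> R * R).

Local Notation L2v G := (L2v Om G).
Local Notation vnorm2 G := (vnorm2 Om G).
Local Notation approx := (approx Om).
Variables (c C lam : R).
Hypotheses (F_second : forall x V,
    c * sqn V <= F (x + V) ^+ 2 + F (x - V) ^+ 2 - 2 * F x ^+ 2 <= C * sqn V)
  (lam_gt0 : 0 < lam).
Local Notation en phi := (energy F lam Om phi (grad2 phi)).

Lemma test_scale phi (s : R) : test_fun Om phi -> test_fun Om (fun x => s * phi x).
Proof.
move=> tphi; have := test_lin s (test0 Om) tphi.
by rewrite (_ : (fun x => 0 + _) = (fun x => s * phi x))//; apply/funext => x; rewrite add0r.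
Qed.

Lemma grad_lin phi psi (s : R) : test_fun Om phi -> test_fun Om psi ->
  grad2 (fun x => phi x + s * psi x) = (fun x => grad2 phi x + s *: grad2 psi x).
Proof.
move=> [sphi _] [spsi _]; apply/funext => x; rewrite /grad2 !pderiv_lin//.
Qed.

Lemma grad0 : grad2 (fun=> 0 : R) = (fun=> 0) :> (R * R -> R * R).
Proof.
apply/funext => x; rewrite /grad2; congr pair; rewrite /=; exact: derive_cst.
Qed.

Lemma grad_scale phi (s : R) : test_fun Om phi ->
  grad2 (fun x => s * phi x) = (fun x => s *: grad2 phi x).
Proof.
move=> tphi; have := grad_lin s (test0 Om) tphi; rewrite grad0.
rewrite (_ : (fun x => 0 + s * phi x) = (fun x => s * phi x)); last first.
  by apply/funext => x; rewrite add0r.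
by move=> ->; apply/funext => x; rewrite add0r.
Qed.

Lemma vnorm2_mid G H : L2v G -> L2v H ->
  vnorm2 (fun x => 2^-1 *: (G x + H x)) <= 2^-1 * (vnorm2 G + vnorm2 H).
Proof.
move=> g2 h2; have iG := L2v_sqn Om_open g2; have iH := L2v_sqn Om_open h2.
rewrite -(RintegralD mOm)// -(RintegralZl _ mOm); last exact: L1_add.
apply: (I_le mOm).
- apply: L2v_sqn => //; split.
    by apply: L2_scale => //; apply: L2_add => //; [case: g2|case: h2].
  by apply: L2_scale => //; apply: L2_add => //; [case: g2|case: h2].
- by apply: L1_scale => //; exact: L1_add.
- move=> x _; rewrite /sqn /= /GRing.scale/=.
  exact: sqr_mid_le.
Qed.

Lemma vnorm2Z G (s : R) : L2v G -> vnorm2 (fun x => s *: G x) = s ^+ 2 * vnorm2 G.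
Proof.
move=> g2; rewrite -(RintegralZl _ mOm); last exact: L2v_sqn.
by apply: I_eq => x _; rewrite /sqn /= /GRing.scale/=; ring.
Qed.

Lemma L2_exp_test phi : test_fun Om phi -> L2 (fun x => expR (phi x)).
Proof.
move=> tphi; have ce : continuous (fun x : R => expR x) by exact: continuous_expR.
exact: (L2_comp_test Om_open Om_bdd tphi ce).
Qed.

(** By [expR_mid_le] the defect is at most [int d^2 (exp phi + exp psi)]. Cauchy-Schwarz bounds its
    square by the product of [4 M D^2], from [sobolev4], and [16 M], from [exp_bound]; the root is
    [8 M D]. *)
Lemma exp_defect phi psi : test_fun Om phi -> test_fun Om psi ->
  dirichlet phi <= 4^-1 -> dirichlet psi <= 4^-1 ->
  I (fun x => expR (phi x)) + I (fun x => expR (psi x)) -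
    2 * I (fun x => expR (2^-1 * (phi x + 1 * psi x))) <=
  8 * M * dirichlet (fun x => 2^-1 * (phi x + (-1) * psi x)).
Proof.
move=> tphi tpsi Dphi Dpsi.
set d := fun x => 2^-1 * (phi x + (-1) * psi x).
have td : test_fun Om d by apply: test_scale; exact: test_lin.
have tw : test_fun Om (fun x => 2^-1 * (phi x + 1 * psi x)).
  by apply: test_scale; exact: test_lin.
have e1 := L2_exp_test tphi; have e2 := L2_exp_test tpsi; have e3 := L2_exp_test tw.
have i1 := L2_L1 mOm Omfin e1; have i2 := L2_L1 mOm Omfin e2.
have i3 := L1_scale mOm 2 (L2_L1 mOm Omfin e3).
have e12 := L2_add mOm e1 e2.
have d2 : L2 (fun x => d x ^+ 2).
  have cs : continuous (fun x : R => x ^+ 2) by exact: exprn_continuous.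
  exact: (L2_comp_test Om_open Om_bdd td cs).
have i12 := L1_add mOm i1 i2.
have CS := I_cauchy_schwarz mOm d2 e12.
have S4 := sobolev4 Om_open Om_bdd td.
have E4 : I (fun x => (d x ^+ 2) ^+ 2) = I (fun x => d x ^+ 4).
  by apply: I_eq => x _; rewrite -exprM.
have Eb : I (fun x => (expR (phi x) + expR (psi x)) ^+ 2) <= 16 * M.
  have b1 := exp_bound Om_open Om_bdd tphi Dphi.
  have b2 := exp_bound Om_open Om_bdd tpsi Dpsi.
  have j1 : L1 (fun x => expR (2 * phi x)).
    by apply: (L1_eq mOm) (L2_sqr e1) => x _; rewrite -expRM_natl mulr_natl.
  have j2 : L1 (fun x => expR (2 * psi x)).
    by apply: (L1_eq mOm) (L2_sqr e2) => x _; rewrite -expRM_natl mulr_natl.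
  have k1 := L1_scale mOm 2 j1; have k2 := L1_scale mOm 2 j2.
  apply: (@le_trans _ _ (I (fun x => 2 * expR (2 * phi x) + 2 * expR (2 * psi x)))).
    apply: (I_le mOm); [exact: L2_sqr e12|exact: L1_add|move=> x _].
    have h (y : R) : expR (2 * y) = expR y ^+ 2 by rewrite -expRM_natl mulr_natl.
    by rewrite !h; exact: sqrD_le.
  by rewrite (RintegralD mOm)// !(RintegralZl _ mOm)//; exact: sum16_le.
have D0 := dirichlet_ge0 Om d.
have key : I (fun x => d x ^+ 2 * (expR (phi x) + expR (psi x))) <= 8 * M * dirichlet d.
  have M0 := M_ge0 Om.
  have R0 : 0 <= 8 * M * dirichlet d by rewrite mulr_ge0// mulr_ge0.
  have L0 : 0 <= I (fun x => d x ^+ 2 * (expR (phi x) + expR (psi x))).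
    by apply: Rintegral_ge0 => x _; rewrite mulr_ge0 ?sqr_ge0// addr_ge0// expR_ge0.
  rewrite -(ler_pXn2r (n := 2))// ?nnegrE//.
  apply: (le_trans CS); rewrite E4.
  apply: (@le_trans _ _ (4 * M * dirichlet d ^+ 2 * (16 * M))).
    apply: ler_pM => //.
    - by apply: Rintegral_ge0 => x _; rewrite -[4%N]/(2 * 2)%N exprM sqr_ge0.
    - by apply: Rintegral_ge0 => x _; rewrite sqr_ge0.
  by rewrite le_eqVlt; apply/orP; left; apply/eqP; ring.
apply: le_trans key.
rewrite -(RintegralZl _ mOm); last exact: L2_L1 e3.
rewrite -(RintegralD mOm)// -(RintegralB mOm)//.
apply: (I_le mOm); [exact: L1_sub|exact: L2_mul|move=> x _].
by rewrite /d mul1r mulN1r; exact: expR_mid_le.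
Qed.

(** For the midpoint [w] and half difference [d], [phi = w + d] and [psi = w - d], so [F_second] at
    [(w, d)] gives the gain [c / 2] while [exp_defect] is the loss. The factors [1] and [-1] fit the
    shape of [test_lin]. *)
Lemma strong_convexity phi psi : test_fun Om phi -> test_fun Om psi ->
  dirichlet phi <= 4^-1 -> dirichlet psi <= 4^-1 ->
  (c / 2 - lam * (8 * M)) * dirichlet (fun x => 2^-1 * (phi x + (-1) * psi x)) <=
  en phi + en psi - 2 * en (fun x => 2^-1 * (phi x + 1 * psi x)).
Proof.
move=> tphi tpsi Dphi Dpsi.
set d := fun x => 2^-1 * (phi x + (-1) * psi x).
set w := fun x => 2^-1 * (phi x + 1 * psi x).
have td : test_fun Om d by apply: test_scale; exact: test_lin.
have tw : test_fun Om w by apply: test_scale; exact: test_lin.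
have ed := exp_defect tphi tpsi Dphi Dpsi.
have gd : grad2 d = fun x => 2^-1 *: (grad2 phi x + (-1) *: grad2 psi x).
  by rewrite grad_scale; [rewrite grad_lin|exact: test_lin].
have gw : grad2 w = fun x => 2^-1 *: (grad2 phi x + 1 *: grad2 psi x).
  by rewrite grad_scale; [rewrite grad_lin|exact: test_lin].
have g1 := L2v_grad Om_open Om_bdd tphi; have g2 := L2v_grad Om_open Om_bdd tpsi.
have g3 := L2v_grad Om_open Om_bdd tw; have g4 := L2v_grad Om_open Om_bdd td.
have q1 := L1_F F_cont F_sqr_bounds Om_open g1.
have q2 := L1_F F_cont F_sqr_bounds Om_open g2.
have q3 := L1_scale mOm 2 (L1_F F_cont F_sqr_bounds Om_open g3).
have Qd : c * dirichlet d <= I (fun x => F (grad2 phi x) ^+ 2) +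
    I (fun x => F (grad2 psi x) ^+ 2) - 2 * I (fun x => F (grad2 w x) ^+ 2).
  rewrite -!(RintegralZl _ mOm); [|exact: L1_F|exact: (L2v_sqn Om_open g4)].
  rewrite -(RintegralD mOm)// -(RintegralB mOm)//; last exact: L1_add.
  apply: (I_le mOm).
  - by apply: L1_scale => //; exact: (L2v_sqn Om_open g4).
  - by apply: L1_sub => //; exact: L1_add.
  move=> x _.
  have /andP[+ _] := F_second (grad2 w x) (grad2 d x); move=> /le_trans; apply.
  rewrite gw gd scale1r scaleN1r -scalerDr -scalerBr.
  by rewrite half_addK half_subK.
rewrite !energyE.
exact: strong_convexity_arith (ler_wpM2l (ltW lam_gt0) ed) Qd.
Qed.

End Minimization.

(** * The minimizer *)

Section Minimizer.
Variables (R : realType) (F : R * R -> R) (a b : R) (Om : set (R * R)).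
Hypotheses (F_ge0 : forall x, 0 <= F x) (F_cont : continuous F)
  (F_sub : forall x y, F (x + y) <= F x + F y)
  (F_sqr_bounds : forall x, a ^+ 2 * sqn x <= F x ^+ 2 <= b ^+ 2 * sqn x)
  (Om_open : open Om) (Om_bdd : bounded_set Om).
Let mOm : measurable_for (lebesgue2 R) Om := open2_measurable Om_open.
Let Omfin : (lebesgue2 R Om < +oo)%E := leb2_bounded_lty mOm Om_bdd.
Local Notation mu := (lebesgue2 R).
Local Notation I f := (\int[mu]_(x in Om) f x).
Local Notation L1 f := (mu.-integrable Om (EFin \o f)).
Local Notation L2 f := (L2 mu Om f).
Local Notation M := (fine (mu Om)).
Local Notation dirichlet := (dirichlet Om).
Implicit Types (phi psi u v f h : R * R -> R) (G H : R * R -> R * R).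

Local Notation L2v G := (L2v Om G).
Local Notation vnorm2 G := (vnorm2 Om G).
Local Notation approx := (approx Om).
Variables (c C lam : R).
Hypotheses (c_gt0 : 0 < c) (F_second : forall x V,
    c * sqn V <= F (x + V) ^+ 2 + F (x - V) ^+ 2 - 2 * F x ^+ 2 <= C * sqn V)
  (lam_gt0 : 0 < lam) (lam_convex : lam * (8 * M) <= c / 4).
Local Notation en phi := (energy F lam Om phi (grad2 phi)).

Lemma F0 : F 0 = 0.
Proof.
have /andP[_] := F_sqr_bounds 0.
rewrite /sqn /= expr0n /= addr0 mulr0 => h.
by apply/eqP; rewrite -sqrf_eq0 eq_le h sqr_ge0.
Qed.

(** Makes the bounds proved for limits available for a single test function. *)
Lemma approx_cst phi : test_fun Om phi -> approx (fun=> phi) phi (grad2 phi).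
Proof.
move=> tphi; split=> //; [exact: L2_test|exact: L2v_grad|].
move=> e e0; exists 0%N => n _; split.
  apply: le_trans (ltW e0); rewrite le_eqVlt; apply/orP; left; apply/eqP.
  transitivity (I (fun=> 0 : R)); last by rewrite (I_cst _ mOm) mul0r.
  by apply: I_eq => x _; rewrite subrr expr0n.
apply: le_trans (ltW e0); rewrite le_eqVlt; apply/orP; left; apply/eqP.
transitivity (I (fun=> 0 : R)); last by rewrite (I_cst _ mOm) mul0r.
by apply: I_eq => x _; rewrite subrr /sqn /= expr0n /= addr0.
Qed.

Lemma en_lb phi : test_fun Om phi -> dirichlet phi <= 4^-1 ->
  - (lam * (5 * M)) <= en phi.
Proof.
move=> tphi D4; rewrite energyE; apply: en_lb_arith; first exact: ltW.
  by apply: Rintegral_ge0 => x _; exact: sqr_ge0.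
by apply: (approx_exp_le (N0 := 0) Om_open Om_bdd (approx_cst tphi)).
Qed.

(** Only test functions compete; the minimizer is a limit of them and may lie outside this class. *)
Definition levels : set R :=
  [set e | exists phi, [/\ test_fun Om phi, dirichlet phi <= 4^-1 & e = en phi]].

Lemma dirichlet0 : dirichlet (fun=> 0) = 0.
Proof.
rewrite /dirichlet grad0; transitivity (I (fun=> 0 : R)).
  by apply: I_eq => x _; rewrite /= expr0n /= addr0.
by rewrite (I_cst _ mOm) mul0r.
Qed.

Lemma en0 : en (fun=> 0) = - (lam * M).
Proof.
rewrite energyE grad0.
have -> : I (fun=> F 0 ^+ 2) = 0 by rewrite F0 expr0n (I_cst _ mOm) mul0r.
have -> : I (fun=> expR 0) = M by rewrite expR0 (I_cst _ mOm) mul1r.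
by rewrite mulr0 sub0r.
Qed.

Lemma levels_inf : has_inf levels.
Proof.
split.
  exists (en (fun=> 0)), (fun=> 0); split=> //; first exact: test0.
  by rewrite dirichlet0 invr_ge0.
by exists (- (lam * (5 * M))) => _ [phi [tphi D4 ->]]; exact: en_lb.
Qed.

Lemma inf_levels_le phi : test_fun Om phi -> dirichlet phi <= 4^-1 ->
  inf levels <= en phi.
Proof. by move=> tphi D4; apply: ge_inf; [case: levels_inf|exists phi]. Qed.

Lemma minimizer : exists (psi : nat -> R * R -> R) u G,
  [/\ approx psi u G, forall n, dirichlet (psi n) <= 4^-1 &
      energy F lam Om u G = inf levels].
Proof.
have /choice[psi psiP] : forall n : nat, exists phi, [/\ test_fun Om phi,
    dirichlet phi <= 4^-1 & en phi < inf levels + n.+1%:R^-1].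
  move=> n; have n0 : 0 < n.+1%:R^-1 :> R by rewrite invr_gt0.
  have [_ [phi [tphi D4 ->]] h] := inf_adherent n0 levels_inf.
  by exists phi.
have tpsi n : test_fun Om (psi n) by case: (psiP n).
have Dpsi n : dirichlet (psi n) <= 4^-1 by case: (psiP n).
pose d n k := fun x => 2^-1 * (psi n x + (-1) * psi k x).
have td n k : test_fun Om (d n k) by apply: test_scale; exact: test_lin.
have archi (e : R) : 0 < e -> exists N : nat, forall n, (N <= n)%N -> n.+1%:R^-1 <= e.
  move=> e0; exists (Num.truncn e^-1) => n Nn.
  rewrite -[e]invrK lef_pV2 ?posrE ?invr_gt0//.
  by rewrite ltW// (lt_le_trans (truncnS_gt _))// ler_nat.
(* Midpoints stay in the ball by convexity of the Dirichlet integral, so their energy is at least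
   the infimum and strong convexity makes half differences small. *)
have cauchy (e : R) : 0 < e -> exists N, forall n k, (N <= n)%N -> (N <= k)%N ->
    dirichlet (d n k) <= e.
  move=> e0; have e10 : 0 < c / 8 * e / 2 by rewrite !divr_gt0// mulr_gt0// divr_gt0.
  have [N hN] := archi _ e10; exists N => n k Nn Nk.
  have [t1 D1 h1] := psiP n; have [t2 D2 h2] := psiP k.
  have tw : test_fun Om (fun x => 2^-1 * (psi n x + 1 * psi k x)).
    by apply: test_scale; exact: test_lin.
  have Dw : dirichlet (fun x => 2^-1 * (psi n x + 1 * psi k x)) <= 4^-1.
    have gw : grad2 (fun x => 2^-1 * (psi n x + 1 * psi k x)) =
        fun x => 2^-1 *: (grad2 (psi n) x + grad2 (psi k) x).
      rewrite (grad_scale _ (test_lin 1 t1 t2)) (grad_lin _ t1 t2).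
      by apply/funext => x; rewrite scale1r.
    rewrite -[leLHS]/(vnorm2 (grad2 _)) gw.
    apply: (le_trans (vnorm2_mid Om_open (L2v_grad Om_open Om_bdd t1)
      (L2v_grad Om_open Om_bdd t2))).
    rewrite ler_pdivrMl//; apply: (le_trans (lerD D1 D2)).
    by rewrite -mulr2n mulr_natl.
  apply: (cauchy_arith c_gt0 _ (dirichlet_ge0 Om _)
    (strong_convexity F_cont F_sqr_bounds Om_open Om_bdd F_second lam_gt0 t1 t2 D1 D2)
    (inf_levels_le tw Dw)).
  - exact: kappa_arith.
  - apply: lt_le_trans h1 _; rewrite lerD2l; apply: (le_trans (hN _ Nn)).
    by rewrite ler_pdivrMr// ler_peMr// ?ler1n// ltW// mulr_gt0// divr_gt0.
  - apply: lt_le_trans h2 _; rewrite lerD2l; apply: (le_trans (hN _ Nk)).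
    by rewrite ler_pdivrMr// ler_peMr// ?ler1n// ltW// mulr_gt0// divr_gt0.
have gd n k x : grad2 (d n k) x = 2^-1 *: (grad2 (psi n) x - grad2 (psi k) x).
  rewrite /d (grad_scale _ (test_lin (-1) (tpsi n) (tpsi k))) (grad_lin _ (tpsi n) (tpsi k)).
  by rewrite scaleN1r.
have four (B K : R) : B <= K -> 4 * B <= 4 * K by rewrite ler_pM2l.
have cauchy_u (e : R) : 0 < e -> exists N, forall n k, (N <= n)%N -> (N <= k)%N ->
    I (fun x => (psi n x - psi k x) ^+ 2) <= e.
  (* The factor [4] comes from [psi n - psi k = 2 d n k], the factor [M] from Poincare's
     inequality. *)
  have M1 : 0 < 4 * (M + 1) by rewrite mulr_gt0// ltr_wpDl// M_ge0.
  move=> e0; have e10 : 0 < e / (4 * (M + 1)) by rewrite divr_gt0.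
  have [N hN] := cauchy _ e10; exists N => n k Nn Nk.
  have -> : I (fun x => (psi n x - psi k x) ^+ 2) = 4 * I (fun x => d n k x ^+ 2).
    rewrite -(RintegralZl _ mOm); last exact: (L2_sqr (L2_test Om_open Om_bdd (td n k))).
    by apply: I_eq => x _; rewrite /d mulN1r; field.
  apply: (le_trans (four _ _ (sobolev2 Om_open Om_bdd (td n k)))).
  apply: (@le_trans _ _ (4 * (M + 1) * dirichlet (d n k))).
    rewrite mulrA ler_wpM2r ?dirichlet_ge0// ler_wpM2l//.
    by rewrite lerDl.
  by rewrite mulrC -ler_pdivlMr// hN.
have cauchy_g (i : bool) (e : R) : 0 < e -> exists N, forall n k, (N <= n)%N -> (N <= k)%N ->
    I (fun x => (pderiv [:: i] (psi n) x - pderiv [:: i] (psi k) x) ^+ 2) <= e.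
  move=> e0; have e10 : 0 < e / 4 by rewrite divr_gt0.
  have [N hN] := cauchy _ e10; exists N => n k Nn Nk.
  have gdb x : pderiv [:: i] (d n k) x = 2^-1 * (pderiv [:: i] (psi n) x - pderiv [:: i] (psi k) x).
    have := gd n k x; rewrite /grad2; case: i => [] [h1 h2].
      exact: h1.
    exact: h2.
  have ib b' := L2_sqr (L2_pderiv Om_open Om_bdd b' (td n k)).
  have -> : I (fun x => (pderiv [:: i] (psi n) x - pderiv [:: i] (psi k) x) ^+ 2) =
      4 * I (fun x => pderiv [:: i] (d n k) x ^+ 2).
    rewrite -(RintegralZl _ mOm); last exact: ib.
    apply: I_eq => x _; rewrite gdb; move: (_ - _) => z; by field.
  rewrite mulrC -ler_pdivlMr//; apply: le_trans (hN _ _ Nn Nk).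
  rewrite (dirichletE Om_open Om_bdd (td n k)).
  have p0 b' : 0 <= I (fun x => pderiv [:: b'] (d n k) x ^+ 2).
    by apply: Rintegral_ge0 => x _; exact: sqr_ge0.
  by case: i {gdb} => /=; [rewrite lerDl; exact: (p0 false)|rewrite lerDr; exact: (p0 true)].
have [u u2 cu] := L2_complete mOm Omfin (fun n => L2_test Om_open Om_bdd (tpsi n)) cauchy_u.
have [g1 g12 cg1] := L2_complete mOm Omfin
  (fun n => L2_pderiv Om_open Om_bdd true (tpsi n)) (cauchy_g true).
have [g2 g22 cg2] := L2_complete mOm Omfin
  (fun n => L2_pderiv Om_open Om_bdd false (tpsi n)) (cauchy_g false).
pose G x := (g1 x, g2 x).
have app : approx psi u G.
  split=> // e e0; have e20 : 0 < e / 2 by rewrite divr_gt0.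
  have [N0 h0] := cu e e0; have [N1 h1] := cg1 _ e20; have [N2 h2] := cg2 _ e20.
  exists (maxn N0 (maxn N1 N2)) => n; rewrite !geq_max => /and3P[n0 n1 n2].
  split; first exact: h0.
  rewrite (splitr e); apply: le_trans (lerD (h1 _ n1) (h2 _ n2)).
  rewrite -(RintegralD mOm)//.
  - exact: (L2_sqr (L2_sub mOm (L2_pderiv Om_open Om_bdd true (tpsi n)) g12)).
  - exact: (L2_sqr (L2_sub mOm (L2_pderiv Om_open Om_bdd false (tpsi n)) g22)).
exists psi, u, G; split=> //.
(* The energy of [u] and the infimum are both limits of the energies of [psi n]. *)
apply: dist_eq0 => e e0; have e20 : 0 < e / 2 by rewrite divr_gt0.
have [N hN] := approx_energy (N0 := 0) F_ge0 F_cont F_sub F_sqr_bounds Om_open Om_bdd app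
  (fun n _ => Dpsi n) (ltW lam_gt0) e20.
have [N' hN'] := archi _ e20.
pose n := maxn N N'.
have k1 := hN n (leq_maxl _ _).
have k2 := hN' n (leq_maxr _ _).
have [t1 D1 h1] := psiP n; have h2 := inf_levels_le t1 D1.
rewrite (splitr e) -(subrKA (en (psi n))) (le_trans (ler_normD _ _))// lerD//.
  by rewrite distrC.
rewrite ger0_norm ?subr_ge0// lerBlDl; apply: ltW; apply: (lt_le_trans h1).
by rewrite lerD2l.
Qed.

End Minimizer.

(** * The minimizer is critical and its energy lies below that of zero *)

Section Critical.
Variables (R : realType) (F : R * R -> R) (a b : R) (Om : set (R * R)).
Hypotheses (F_ge0 : forall x, 0 <= F x) (F_cont : continuous F)
  (F_sub : forall x y, F (x + y) <= F x + F y)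
  (F_sqr_bounds : forall x, a ^+ 2 * sqn x <= F x ^+ 2 <= b ^+ 2 * sqn x)
  (a_gt0 : 0 < a) (Om_open : open Om) (Om_bdd : bounded_set Om).
Let mOm : measurable_for (lebesgue2 R) Om := open2_measurable Om_open.
Let Omfin : (lebesgue2 R Om < +oo)%E := leb2_bounded_lty mOm Om_bdd.
Local Notation mu := (lebesgue2 R).
Local Notation I f := (\int[mu]_(x in Om) f x).
Local Notation L1 f := (mu.-integrable Om (EFin \o f)).
Local Notation L2 f := (L2 mu Om f).
Local Notation M := (fine (mu Om)).
Local Notation dirichlet := (dirichlet Om).
Implicit Types (phi psi u v f h : R * R -> R) (G H : R * R -> R * R).

Local Notation L2v G := (L2v Om G).
Local Notation vnorm2 G := (vnorm2 Om G).
Local Notation approx := (approx Om).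

Lemma approx_lin (psi chi : nat -> R * R -> R) u v G H (t : R) :
  approx psi u G -> approx chi v H ->
  approx (fun n x => psi n x + t * chi n x) (fun x => u x + t * v x)
    (fun x => G x + t *: H x).
Proof.
move=> [tpsi u2 G2 cu] [tchi v2 H2 cv].
split; first by move=> n; exact: test_lin.
- by apply: L2_add => //; exact: L2_scale.
- exact: L2v_lin.
move=> e e0; have t0 : 0 < 2 * (t ^+ 2 + 1) by rewrite mulr_gt0// ltr_wpDl// sqr_ge0.
have e40 : 0 < e / 2 / 2 by rewrite !divr_gt0.
have et0 : 0 < e / 2 / (2 * (t ^+ 2 + 1)) by rewrite !divr_gt0.
have [N hN] := cu _ e40; have [N' hN'] := cv _ et0.
have comb (A B : R) : 0 <= B -> A <= e / 2 / 2 -> B <= e / 2 / (2 * (t ^+ 2 + 1)) ->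
    2 * A + 2 * t ^+ 2 * B <= e.
  move=> B0 hA hB; rewrite (splitr e); apply: lerD.
    by rewrite mulrC -ler_pdivlMr.
  rewrite ler_pdivlMr// in hB; apply: le_trans hB; rewrite mulrC ler_wpM2l//.
  by rewrite ler_wpM2l// lerDl.
exists (maxn N N') => n; rewrite geq_max => /andP[n1 n2].
have [a1 a2] := hN _ n1; have [b1 b2] := hN' _ n2.
have du := L2_sub mOm (L2_test Om_open Om_bdd (tpsi n)) u2.
have dv := L2_sub mOm (L2_test Om_open Om_bdd (tchi n)) v2.
have dG := L2v_sub Om_open (L2v_grad Om_open Om_bdd (tpsi n)) G2.
have dH := L2v_sub Om_open (L2v_grad Om_open Om_bdd (tchi n)) H2.
have sG := L2v_sqn Om_open dG; have sH := L2v_sqn Om_open dH.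
split.
  have B0 : 0 <= I (fun x => (chi n x - v x) ^+ 2).
    by apply: Rintegral_ge0 => x _; exact: sqr_ge0.
  apply: le_trans (comb _ _ B0 a1 b1).
  have i1 := L1_scale mOm 2 (L2_sqr du); have i2 := L1_scale mOm (2 * t ^+ 2) (L2_sqr dv).
  rewrite -!(RintegralZl _ mOm); [|exact: L2_sqr dv|exact: L2_sqr du].
  rewrite -(RintegralD mOm)//; apply: (I_le mOm).
  - apply: (L1_eq mOm) (L2_sqr (L2_add mOm du (L2_scale mOm t dv))) => x _.
    by congr (_ ^+ 2); ring.
  - exact: L1_add.
  - move=> x _; rewrite (_ : _ - _ = (psi n x - u x) + t * (chi n x - v x)); last by ring.
    by rewrite (le_trans (sqrD_le _ _))// exprMn [2 * (t ^+ 2 * _)]mulrA.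
apply: le_trans (comb _ _ (vnorm2_ge0 Om _) a2 b2).
have i1 := L1_scale mOm 2 sG; have i2 := L1_scale mOm (2 * t ^+ 2) sH.
have -> : vnorm2 (fun x => grad2 (fun y => psi n y + t * chi n y) x - (G x + t *: H x)) =
    vnorm2 (fun x => (grad2 (psi n) x - G x) + t *: (grad2 (chi n) x - H x)).
  apply: I_eq => x _; rewrite (grad_lin t (tpsi n) (tchi n)); congr sqn.
  by rewrite scalerBr opprD addrACA.
rewrite -!(RintegralZl _ mOm)// -(RintegralD mOm)//; apply: (I_le mOm).
- by apply: L2v_sqn => //; exact: L2v_lin.
- exact: L1_add.
move=> x _; rewrite /sqn /= /GRing.scale/=.
move: (_ - _) (_ - _) (_ - _) (_ - _) => p q r s.
apply: (le_trans (lerD (sqrD_le _ _) (sqrD_le _ _))).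
by rewrite !exprMn le_eqVlt; apply/orP; left; apply/eqP; ring.
Qed.

(** The room between [1/32] and [1/4] takes in the step [t H] and two approximation errors below
    [1/128]. *)
Lemma ball_lin (psi chi : nat -> R * R -> R) u v G H (t : R) :
  approx psi u G -> approx chi v H -> vnorm2 G <= 32^-1 -> t ^+ 2 <= 1 ->
  t ^+ 2 * vnorm2 H <= 64^-1 ->
  exists N, forall n, (N <= n)%N -> dirichlet (fun x => psi n x + t * chi n x) <= 4^-1.
Proof.
move=> [tpsi u2 G2 cu] [tchi v2 H2 cv] hG t1 tH.
have e0 : 0 < 128^-1 :> R by rewrite invr_gt0.
have [N hN] := cu _ e0; have [N' hN'] := cv _ e0.
exists (maxn N N') => n; rewrite geq_max => /andP[n1 n2].
have [_ a2] := hN _ n1; have [_ b2] := hN' _ n2.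
have gpsi := L2v_grad Om_open Om_bdd (tpsi n).
have gchi := L2v_grad Om_open Om_bdd (tchi n).
have i1 := L1_scale mOm 4 (L2v_sqn Om_open G2).
have i2 := L1_scale mOm 4 (L2v_sqn Om_open (L2v_sub Om_open gpsi G2)).
have i3 := L1_scale mOm (4 * t ^+ 2) (L2v_sqn Om_open H2).
have i4 := L1_scale mOm (4 * t ^+ 2) (L2v_sqn Om_open (L2v_sub Om_open gchi H2)).
have i12 := L1_add mOm i1 i2; have i34 := L1_add mOm i3 i4.
apply: le_trans (ball_arith (sqr_ge0 t) t1 hG a2 tH b2).
rewrite -!(RintegralZl _ mOm).
- rewrite -!(RintegralD mOm)//.
  apply: (I_le mOm); [|exact: L1_add|].
    exact: (L2v_sqn Om_open (L2v_grad Om_open Om_bdd (test_lin t (tpsi n) (tchi n)))).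
  move=> x _; rewrite (grad_lin t (tpsi n) (tchi n)) /sqn /= /GRing.scale/=.
  apply: (le_trans (lerD (sqr4_le _ (G x).1 _ (H x).1 _) (sqr4_le _ (G x).2 _ (H x).2 _))).
  move: (_ - _) (_ - _) (_ - _) (_ - _) => p q r s.
  by rewrite le_eqVlt; apply/orP; left; apply/eqP; ring.
- exact: (L2v_sqn Om_open (L2v_sub Om_open gchi H2)).
- exact: (L2v_sqn Om_open H2).
- exact: (L2v_sqn Om_open (L2v_sub Om_open gpsi G2)).
- exact: (L2v_sqn Om_open G2).
Qed.

Variables (c C lam : R).
Hypotheses (C_ge0 : 0 <= C) (F_second : forall x V,
    c * sqn V <= F (x + V) ^+ 2 + F (x - V) ^+ 2 - 2 * F x ^+ 2 <= C * sqn V)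
  (lam_gt0 : 0 < lam)
  (lam_ball : 10 * (lam * M) <= a ^+ 2 / 32).
Local Notation en phi := (energy F lam Om phi (grad2 phi)).
Local Notation levels := (levels F Om lam).

Lemma inf_levels_lt : Om !=set0 -> inf levels < - (lam * M).
Proof.
move=> Om_ne; have [phi [tphi I0]] := bump_exists Om_open Om_bdd Om_ne.
set D0 := dirichlet phi; have D00 : 0 <= D0 := dirichlet_ge0 Om phi.
have p1 : 0 < 2 * (D0 + 1) by rewrite mulr_gt0// ltr_wpDl.
have p2 : 0 < b ^+ 2 * D0 + 1 by rewrite ltr_wpDl// mulr_ge0// sqr_ge0.
(* The first bound keeps [s phi] in the ball, the second lets the linear gain [lam s int phi] exceed
   the quadratic cost. *)
pose s := Num.min (2 * (D0 + 1))^-1 (lam * I phi / (b ^+ 2 * D0 + 1)).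
have s0 : 0 < s by rewrite lt_min invr_gt0 p1 divr_gt0// mulr_gt0.
have s1 : s * (2 * (D0 + 1)) <= 1 by rewrite -ler_pdivlMr// div1r ge_min lexx.
have s2 : s * (b ^+ 2 * D0 + 1) <= lam * I phi.
  by rewrite -ler_pdivlMr// ge_min lexx orbT.
have ts := test_scale s tphi; have gphi := L2v_grad Om_open Om_bdd tphi.
have Ds : vnorm2 (grad2 (fun x => s * phi x)) = s ^+ 2 * D0.
  by rewrite (grad_scale s tphi) (vnorm2Z Om_open s gphi).
have D4 : dirichlet (fun x => s * phi x) <= 4^-1.
  by rewrite -[leLHS]/(vnorm2 (grad2 _)) Ds; exact: scale_ball_arith.
apply: (le_lt_trans (inf_levels_le F Om_open Om_bdd lam_gt0 ts D4)).
rewrite energyE; apply: (bump_arith lam_gt0 (sqr_ge0 b) D00 s0 s2).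
  have := I_F_le F_cont F_sqr_bounds Om_open (L2v_grad Om_open Om_bdd ts).
  by rewrite Ds.
have iphi := L2_L1 mOm Omfin (L2_test Om_open Om_bdd tphi).
have is_ := L1_scale mOm s iphi.
rewrite -(RintegralZl _ mOm)// -{1}[M]mul1r -(I_cst _ mOm 1) -(RintegralD mOm)//; last first.
  exact: L1_cst.
apply: (I_le mOm).
- by apply: L1_add => //; exact: L1_cst.
- exact: (L2_L1 mOm Omfin (L2_exp_test Om_open Om_bdd ts)).
- by move=> x _; exact: expR_ge1Dx.
Qed.

Lemma minimizer_critical (psi : nat -> R * R -> R) u G : approx psi u G ->
  (forall n, dirichlet (psi n) <= 4^-1) -> energy F lam Om u G = inf levels ->
  critical_point F lam Om u G.
Proof.
move=> app Dpsi Emin phi Gphi Wphi; rewrite /=.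
have [chi appchi] := W012_approx Om_open Om_bdd Wphi.
have [tpsi u2 G2 _] := app; have [tchi phi2 Gphi2 _] := appchi.
set e := fun t : R => _.
have e0E : e 0 = inf levels.
  rewrite -Emin /e !energyE; congr (_ * _ - _ * _); apply: I_eq => x _.
    by rewrite scale0r addr0.
  by rewrite mul0r addr0.
have M0 := M_ge0 Om.
(* The minimizer is interior: its energy is at most [E(0) <= 0], so [int F^2 (G) <= 2 lam int exp u
   <= 10 lam M]. *)
have hG : vnorm2 G <= 32^-1.
  apply: (small_norm_arith a_gt0 (ltW lam_gt0) M0 lam_ball
    (I_F_ge F_cont F_sqr_bounds Om_open G2)
    (approx_exp_le (N0 := 0) Om_open Om_bdd app (fun n _ => Dpsi n))
    (energyE F Om lam u G)).
  rewrite Emin; have D4 : dirichlet (fun=> 0) <= 4^-1.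
    by rewrite (dirichlet0 Om_open) invr_ge0.
  apply: (le_trans (inf_levels_le F Om_open Om_bdd lam_gt0 (test0 Om) D4)).
  by rewrite (en0 F_sqr_bounds Om_open) oppr_le0 mulr_ge0// ltW.
set X := vnorm2 Gphi; have X0 : 0 <= X := vnorm2_ge0 Om Gphi.
pose t0 := (8 * (X + 1))^-1.
have t00 : 0 < t0 by rewrite invr_gt0 mulr_gt0// ltr_wpDl.
(* [u + t phi] is a limit of test functions from the ball, whose energies are at least the infimum;
   the same approximation makes its exponential integrable. *)
have emin (t : R) : `|t| < t0 -> e 0 <= e t /\ L1 (fun x => expR (u x + t * phi x)).
  move=> ht; have [tt1 tX] := small_t X0 ht.
  have [N hN] := ball_lin app appchi hG tt1 tX.
  have appt := approx_lin t app appchi.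
  split; last exact: (L2_L1 mOm Omfin (approx_L2_exp Om_open Om_bdd appt hN)).
  rewrite e0E; apply/ler_addgt0Pr => eps eps0.
  have [N' hN'] := approx_energy F_ge0 F_cont F_sub F_sqr_bounds Om_open Om_bdd appt hN
    (ltW lam_gt0) eps0.
  pose n := maxn N N'.
  have h1 := hN' n (leq_maxr _ _); have h2 := hN n (leq_maxl _ _).
  have [tn _ _ _] := appt.
  have h3 := inf_levels_le F Om_open Om_bdd lam_gt0 (tn n) h2.
  apply: (le_trans h3); rewrite -lerBlDl; apply: le_trans h1; exact: ler_norm.
suff [De dE] : is_derive (0 : R) 1 e 0 by [].
apply: (is_derive_quadratic (K := 2^-1 * (C * X)) t00).
  by rewrite mulr_ge0// ?invr_ge0// mulr_ge0.
move=> t ht; have [et iet] := emin t ht.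
(* Minimality at [- t] turns the bound on the second difference into one on [e t - e 0]. *)
have htN : `|- t| < t0 by rewrite normrN.
have [etN ietN] := emin (- t) htN.
rewrite subr_ge0 et /=.
have i0 := L2_L1 mOm Omfin (approx_L2_exp (N0 := 0) Om_open Om_bdd app (fun n _ => Dpsi n)).
have q1 := L1_F F_cont F_sqr_bounds Om_open (L2v_lin Om_open t G2 Gphi2).
have q2 := L1_F F_cont F_sqr_bounds Om_open (L2v_lin Om_open (- t) G2 Gphi2).
have q0 := L1_F F_cont F_sqr_bounds Om_open G2.
have Qd : I (fun x => F (G x + t *: Gphi x) ^+ 2) +
    I (fun x => F (G x + (- t) *: Gphi x) ^+ 2) -
    2 * I (fun x => F (G x) ^+ 2) <= C * (t ^+ 2 * X).
  have q12 := L1_add mOm q1 q2; have q02 := L1_scale mOm 2 q0.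
  have sX := L2v_sqn Om_open Gphi2; have sXt := L1_scale mOm (t ^+ 2) sX.
  rewrite -!(RintegralZl _ mOm)// -(RintegralD mOm)// -(RintegralB mOm)//.
  apply: (I_le mOm); [exact: L1_sub|exact: L1_scale|move=> x _].
  have /andP[_] := F_second (G x) (t *: Gphi x).
  rewrite -scaleNr => /le_trans; apply; rewrite ler_wpM2l//.
  by rewrite /sqn /= /GRing.scale/= !exprMn mulrDr.
have Ed : 2 * I (fun x => expR (u x)) <=
    I (fun x => expR (u x + t * phi x)) + I (fun x => expR (u x + (- t) * phi x)).
  have i12 := L1_add mOm iet ietN; have i02 := L1_scale mOm 2 i0.
  rewrite -(RintegralZl _ mOm)// -(RintegralD mOm)//.
  by apply: (I_le mOm) => // x _; rewrite mulNr; exact: expR_mid_ge.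
have := second_diff_arith (ltW lam_gt0) (energyE F Om lam _ _) (energyE F Om lam _ _)
  (energyE F Om lam _ _) Qd Ed.
rewrite -/(e t) -/(e (- t)) Emin -e0E => /(_ etN) /le_trans; apply.
by rewrite le_eqVlt; apply/orP; left; apply/eqP; ring.
Qed.

End Critical.

Theorem theorem3p3 (R : realType) (F : R * R -> R) (a b mu Lam : R)
  (F_ge0 : forall xi, 0 <= F xi)
  (F_convex : forall (x y : R * R) (t : R), 0 <= t <= 1 ->
     F (t *: x + (1 - t) *: y) <= t * F x + (1 - t) * F y)
  (F_C2 : C2_on [set xi : R * R | xi != 0] F)
  (F_hom : forall (t : R) (xi : R * R), F (t *: xi) = `|t| * F xi)
  (F_pos : forall xi : R * R, xi != 0 -> 0 < F xi)
  (a_gt0 : 0 < a) (a_le_b : a <= b)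
  (F_bounds : forall xi : R * R, a * enorm2 xi <= F xi /\ F xi <= b * enorm2 xi)
  (mu_gt0 : 0 < mu) (Lam_gt0 : 0 < Lam)
  (F_ell : forall xi V : R * R, enorm2 xi = 1 -> dot2 V xi = 0 ->
     mu ^+ 2 * enorm2 V ^+ 2 <= hess_form F xi V /\
     hess_form F xi V <= Lam * enorm2 V ^+ 2)
  (Om : set (R * R)) (Om_open : open Om) (Om_conn : connected Om)
  (Om_bdd : bounded_set Om) (Om_ne : Om !=set0) :
  exists lam0 : R, 0 < lam0 /\
    forall lam : R, 0 < lam < lam0 ->
      exists (u : R * R -> R) (G : R * R -> R * R),
        W012 Om u G /\ critical_point F lam Om u G /\
        ((energy F lam Om u G)%:E < - (lam%:E * @leb2 R Om))%E.
Proof.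
have [c [C [c0 C0 Fsd]]] := F_sqr_second_difference F_ge0 F_convex F_C2 F_hom a_gt0
  a_le_b F_bounds mu_gt0 Lam_gt0 F_ell.
have Fsub := F_sub F_convex F_hom.
have Fcont := F_continuous F_convex F_hom a_gt0 a_le_b F_bounds.
have Fsq := F_sqr_bounds F_ge0 a_gt0 a_le_b F_bounds.
set M := fine (lebesgue2 R Om); have M0 : 0 <= M := M_ge0 Om.
have M1 : 0 < M + 1 by rewrite ltr_wpDl.
(* The first bound leaves the convexity constant [c / 2 - 8 lam M >= c / 4], the second places the
   minimizer in the ball of level [1/32]; [M + 1] makes both denominators positive. *)
exists (Num.min (c / 4 / (8 * (M + 1))) (a ^+ 2 / 32 / (10 * (M + 1)))); split.
  by rewrite lt_min !divr_gt0 ?mulr_gt0// exprn_gt0.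
move=> lam /andP[lam0]; rewrite lt_min => /andP[l1 l2].
have lc : lam * (8 * M) <= c / 4.
  rewrite ltr_pdivlMr ?mulr_gt0// in l1; apply: le_trans (ltW l1).
  by rewrite ler_pM2l// ler_pM2l// lerDl.
have lb : 10 * (lam * M) <= a ^+ 2 / 32.
  rewrite ltr_pdivlMr ?mulr_gt0// in l2; apply: le_trans (ltW l2).
  by rewrite mulrCA ler_pM2l// ler_pM2l// lerDl.
have [psi [u [G [app Dpsi Emin]]]] := minimizer F_ge0 Fcont Fsub Fsq Om_open Om_bdd
  c0 Fsd lam0 lc.
exists u, G; split; first exact: approx_W012 app.
split.
  exact: (minimizer_critical F_ge0 Fcont Fsub Fsq a_gt0 Om_open Om_bdd C0 Fsd lam0 lb
    app Dpsi Emin).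
have Mfin : (@leb2 R Om = M%:E)%E.
  rewrite /M fineK// ge0_fin_numE//.
  exact: (leb2_bounded_lty (open2_measurable Om_open) Om_bdd).
rewrite Mfin -EFinM -EFinN lte_fin Emin.
exact: inf_levels_lt.
Qed.
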